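(* Let $1<q<p<\infty$, let $\mu\in\Psi$ and let $K(\cdot,\cdot)\equiv K_1(\cdot,\cdot)\in\mathcal{O}_1^{+}$, with associated functions $r_1$ and $K_{1,0}$. Then the operator $$\mathbf{K^+}f(x)=\int_0^x K(x,s)v(s)f(s)\,ds,\quad x>0,$$ is bounded from $L_p(I)$ to $L_{q,\mu}(I)$ if and only if $B_1^+=\max\{B^+_{1,0},B^+_{1,1}\}<\infty$, where $$B^+_{1,0}=\left(\int_0^\infty\left(\int_{[z,\infty]}K_{1,0}^q(x,z)\,d\mu(x)\right)^{\frac{p}{p-q}}\left(\int_0^z r_1^{p'}(s)v^{p'}(s)\,ds\right)^{\frac{p(q-1)}{p-q}}r_1^{p'}(z)v^{p'}(z)\,dz\right)^{\frac{p-q}{pq}},$$ $$B^+_{1,1}=\left(\int_{(0,\infty]}\left(\mu([x,\infty])\right)^{\frac{p}{p-q}}\left(\int_0^x K_1^{p'}(x,s)v^{p'}(s)\,ds\right)^{\frac{p(q-1)}{p-q}}d\left(\int_0^x K_1^{p'}(x,t)v^{p'}(t)\,dt\right)\right)^{\frac{p-q}{pq}}.$$ Moreover, $\|\mathbf{K^+}\|_{p\to q}\approx B_1^+$, where $\|\mathbf{K^+}\|_{p\to q}$ is the norm of $\mathbf{K^+}$ from $L_p(I)$ to $L_{q,\mu}(I)$.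
   Context: Notation. $I=(0,\infty)$, $p'=\frac{p}{p-1}$; $v$ is a positive locally summable function on $I$ with $v\in L_{p'}^{loc}(I)$. $L_p(I)$ is the usual Lebesgue space. $\Psi$ is the set of nonnegative Borel measures on $I$ (intervals of integration are written with endpoints $0,\infty$; since $\mu$ lives on $I$ these endpoints carry no $\mu$-mass). $L_{q,\mu}(I)$ is the space of $\mu$-measurable $g$ with $\|g\|_{q,\mu}=\left(\int_{[0,\infty]}|g(x)|^q d\mu(x)\right)^{1/q}<\infty$. $A\ll B$ means $A\le CB$ with some constant $C>0$; $A\approx B$ means $A\ll B\ll A$. Class $\mathcal{O}_1^+$. Let $\Omega=\{(x,s)\in I\times I:x\ge s>0\}$. A measurable $K_1\ge 0$ on $\Omega$ belongs to $\mathcal{O}_1^+$ if $K_1$ is non-decreasing in the first argument and there exist a measurable function $r_1(s)\ge0$ on $I$, a measurable function $K_{1,0}\ge 0$ on $\Omega$ and a number $h_1\ge1$ such that $$h_1^{-1}\left(K_{1,0}(x,t)r_1(s)+K_1(t,s)\right)\le K_1(x,s)\le h_1\left(K_{1,0}(x,t)r_1(s)+K_1(t,s)\right)$$ for all $x\ge t\ge s>0$. By the paper's convention, $K_{1,0}$ is taken non-decreasing in the first argument and non-increasing in the second argument. Stieltjes convention. If $\varphi$ is non-decreasing on $I$ (taken right-continuous, replacing $\varphi(t)$ by $\varphi(t+0)$ if necessary), $d\varphi$ denotes the Borel measure $\eta$ with $\varphi(t)=\int_{[0,t]}d\eta$ (and $\varphi(t)=\int_{(0,t]}d\eta$ if 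$\varphi(0)=0$).
   Formalization: Added hypothesis: φ(x)=∫_0^x K_1^{p'}(x,s)v^{p'}(s)ds satisfies φ(x+0)=φ(x) at every atom x of μ; without it the claim fails (e.g. μ=δ_{x0} and K_1 jumping just after x0). *)

(* Defs.v *)
From HB Require Import structures.
From mathcomp Require Import all_boot all_order all_algebra.
From mathcomp Require Import all_classical all_reals all_analysis.

Set Implicit Arguments.
Unset Strict Implicit.
Unset Printing Implicit Defensive.

Import Order.TTheory GRing.Theory Num.Theory.
Import numFieldNormedType.Exports.

Local Open Scope classical_set_scope.
Local Open Scope ring_scope.

Section Defs.
Variable R : realType.

(* A Borel measure on I = (0,oo) is encoded as a Borel measure on R of which
   only the values on subsets of I are ever used. *)
Definition Ipos : set R := `]0, +oo[%classic.

Local Notation leb := (@lebesgue_measure R).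

Definition conj_exp (p : R) : R := p / (p - 1).

(* (\int_I |g|^q dm)^(1/q) *)
Definition norm_on_I (m : {measure set (measurableTypeR R) -> \bar R}) (q : R)
    (g : R -> \bar R) : \bar R :=
  ('N[m]_(q%:E)[g \_ Ipos])%E.

Definition in_Lp (p : R) (f : R -> R) : Prop :=
  measurable_fun (Ipos : set (measurableTypeR R)) f /\
  (norm_on_I leb p (EFin \o f) < +oo)%E.

Definition Omega : set (measurableTypeR R * measurableTypeR R) :=
  [set xs | 0 < xs.2 /\ xs.2 <= xs.1].

(* K belongs to O_1^+, with constant h and associated functions r and K0. *)
Record O1plus (h : R) (K : R -> R -> R) (r : R -> R) (K0 : R -> R -> R) : Prop
    := {
  O1_K_meas : measurable_fun Omega (fun xs => K xs.1 xs.2) ;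
  O1_K_ge0 : forall x s, 0 < s -> s <= x -> 0 <= K x s ;
  O1_K_homo : forall x y s, 0 < s -> s <= x -> x <= y -> K x s <= K y s ;
  O1_r_meas : measurable_fun (Ipos : set (measurableTypeR R)) r ;
  O1_r_ge0 : forall s, 0 < s -> 0 <= r s ;
  O1_K0_meas : measurable_fun Omega (fun xs => K0 xs.1 xs.2) ;
  O1_K0_ge0 : forall x s, 0 < s -> s <= x -> 0 <= K0 x s ;
  O1_K0_homo : forall x y s, 0 < s -> s <= x -> x <= y -> K0 x s <= K0 y s ;
  O1_K0_anti : forall x s t, 0 < s -> s <= t -> t <= x -> K0 x t <= K0 x s ;
  O1_h_ge1 : 1 <= h ;
  O1_ineq : forall x t s, 0 < s -> s <= t -> t <= x ->
    h^-1 * (K0 x t * r s + K t s) <= K x s /\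
    K x s <= h * (K0 x t * r s + K t s) }.

(* When s |-> K x s * v s * f s is not integrable on (0, x], this value is
   infinite (+oo - +oo = -oo), hence |K^+ f x| = +oo: a finite norm of K^+ f
   entails that the integral converges absolutely for almost every x. *)
Definition Kplus (K : R -> R -> R) (v f : R -> R) (x : R) : \bar R :=
  (\int[leb]_(s in `]0%R, x]) (K x s * v s * f s)%:E)%E.

Definition Kplus_bounded (p q : R)
    (mu : {measure set (measurableTypeR R) -> \bar R})
    (K : R -> R -> R) (v : R -> R) : Prop :=
  exists C : R, forall f : R -> R, in_Lp p f ->
    (norm_on_I mu q (Kplus K v f) <= C%:E * norm_on_I leb p (EFin \o f))%E.

Definition Kplus_norm (p q : R)
    (mu : {measure set (measurableTypeR R) -> \bar R})
    (K : R -> R -> R) (v : R -> R) : \bar R :=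
  ereal_sup [set norm_on_I mu q (Kplus K v f) | f in
    [set f | in_Lp p f /\ (norm_on_I leb p (EFin \o f) <= 1)%E]].

Definition phi (p : R) (K : R -> R -> R) (v : R -> R) (x : R) : \bar R :=
  (\int[leb]_(s in `]0%R, x])
     (K x s `^ conj_exp p * v s `^ conj_exp p)%:E)%E.

(* g (x + 0) *)
Definition right_lim (g : R -> \bar R) (x : R) : \bar R :=
  lim (g y @[y --> x^'+]).

(* eta = dg on I for a non-decreasing g with g 0 = 0, after replacing g by its
   right-continuous modification; g may take the value +oo. *)
Definition is_stieltjes (g : R -> \bar R)
    (eta : {measure set (measurableTypeR R) -> \bar R}) : Prop :=
  forall t : R, 0 < t -> right_lim g t = eta `]0, t]%classic.

Definition B10 (p q : R)
    (mu : {measure set (measurableTypeR R) -> \bar R})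
    (r : R -> R) (K0 : R -> R -> R) (v : R -> R) : \bar R :=
  ((\int[leb]_(z in Ipos)
      ((\int[mu]_(x in `[z, +oo[) (K0 x z `^ q)%:E) `^ (p / (p - q))
       * (\int[leb]_(s in `]0%R, z])
            (r s `^ conj_exp p * v s `^ conj_exp p)%:E)
           `^ (p * (q - 1) / (p - q))
       * (r z `^ conj_exp p * v z `^ conj_exp p)%:E))
   `^ ((p - q) / (p * q)))%E.

Definition B11 (p q : R)
    (mu eta : {measure set (measurableTypeR R) -> \bar R})
    (K : R -> R -> R) (v : R -> R) : \bar R :=
  ((\int[eta]_(x in Ipos)
      (mu `[x, +oo[%classic `^ (p / (p - q))
       * right_lim (phi p K v) x `^ (p * (q - 1) / (p - q))))
   `^ ((p - q) / (p * q)))%E.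

Definition B1plus (p q : R)
    (mu eta : {measure set (measurableTypeR R) -> \bar R})
    (K : R -> R -> R) (r : R -> R) (K0 : R -> R -> R) (v : R -> R) : \bar R :=
  maxe (B10 p q mu r K0 v) (B11 p q mu eta K v).

End Defs.

Arguments Ipos : clear implicits.

(* Main.v *)
Require Import Defs.
From HB Require Import structures.
From mathcomp Require Import all_boot all_order all_algebra.
From mathcomp Require Import all_classical all_reals all_analysis.
From mathcomp Require Import measurable_realfun ring lra.
Import Order.TTheory GRing.Theory Num.Theory.
Import numFieldNormedType.Exports.
Local Open Scope classical_set_scope.
Local Open Scope ring_scope.

Set Implicit Arguments.
Unset Strict Implicit.
Unset Printing Implicit Defensive.

(** All data are extended by zero from the half-line to the line. With p' the
    conjugate exponent, b = p/(p-q) and a = p(q-1)/(p-q), put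
      k(x,s) = K(x,s) v(s) and kap(x,s) = K0(x,s) for 0 < s <= x,  g = r v,
      M(x) = mu [x,oo),  ph(x) = int k(x,s)^p' ds,  W(x) = ph(x+0) = eta (-oo,x],
      U(z) = int kap(x,z)^q dmu(x),  G(z) = int_(s <= z) g(s)^p' ds.
    The two functionals are powers of S1 = int M^b W^a deta and
    S2 = int U^b G^a g^p' dz, and the norm of the operator has to be compared
    with S1^(1/(bq)) and S2^(1/(bq)).

    Integration by parts fails for measures with atoms and for functions that
    take the value +oo. Its substitute is the lemma [poweR_integral_le_tails]:
    if W(x) dominates the integral of w over the part of E beyond x, then
    (int_E w)^(b+1) <= 2^(b+1) int_E W^b w, since half of the mass of w sits where
    W is at least half of that mass. In particular M(x)^b is controlled by the
    integral of M^(b-1) dmu over [x,oo), and W(x)^(a+1) by the integral of W^a deta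
    over (-oo,x].

    Lower bounds for the norm come from test functions.
    - By Fubini, S1 is controlled by S = int M^(b-1) W^(a+1) dmu. Here W may be
      replaced by ph, because they differ only at countably many points, none of
      which is an atom of mu. The function f with
      f(s)^p = int k(y,s)^p' M(y)^(b-1) ph(y)^a dmu(y) satisfies int f^p = S, and
      as k increases in its first variable its image is at least
      ph(x) (int_[x,oo) M^(b-1) ph^a dmu)^(1/p). The norm inequality then reads
      S <= C N^q S^(q/p), so that S <= (C N^q)^b ([dual_sum_le]).
    - The condition on K at t = s says that kap(x,s) g(s) <= h k(x,s), so the
      kernel kap g is bounded as well. It is tested on
      f = (U^b G^a g^p')^(1/p), and Fubini is applied to the bound
      int kap(x,s)^q H(s)^(q-1) g(s) f(s) ds <= (int kap(x,s) g(s) f(s) ds)^q,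
      where H(s) is the integral of g f over (-oo,s] ([split_sum_le]).
    Both arguments need S to be finite, which is achieved by truncation
    ([lower_tail_bound], [lower_split_bound]).

    For the upper bound let f >= 0 have norm at most 1. The image F of f is
    nondecreasing; cut the line into the level sets c <= F < 4hc with c in a
    geometric progression. In each of them choose x so that the part E to the
    right of x has half of the mu-measure of the level set. Splitting the kernel
    at a suitable t <= x where F is still smaller than c/(4h) gives
      c <= C (kap(x,t) R(t) + ph(x)^(1/p') (int_D f^p)^(1/p)),
    where R(t) is the integral of g f over (-oo,t] and D is the union of the level
    set and the preceding one ([level_point]). Raise to the power q, multiply by
    mu E and sum over the levels. The sum of the second terms is bounded by
    Young's inequality with exponents 1/b + q/p = 1, because the sets D overlap at
    most twice and, for the disjoint sets E_i, the sum of mu(E_i)^b W(x_i)^(a+1) is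
    controlled by S1 ([disjoint_tails_sum]). The sum of the first terms has the
    form of the integral of R^q for a discrete measure nu; this is Hardy's
    inequality, that is, the same argument for the kernel g(s) on s <= x, whose
    outer kernel is zero, and nu [z,oo) <= U(z) because kap is antitone in its
    second variable ([discrete_hardy]). *)

(** * Powers of extended reals *)

Section PowersOfExtendedReals.
Context {R : realType}.
Local Open Scope ereal_scope.
Implicit Types (x y z : \bar R) (r s : R).

Lemma le_poweR x y r : 0 <= x -> x <= y -> (0 <= r)%R -> x `^ r <= y `^ r.
Proof.
move=> x0 xy r0; apply: gt0_ler_poweR => //; rewrite in_itv/= ?leey ?andbT//.
exact: le_trans xy.
Qed.

Lemma ge0_poweRD x r s : (0 <= r)%R -> (0 <= s)%R ->
  x `^ (r + s) = x `^ r * x `^ s.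
Proof.
move=> r0 s0; have [->|rn0] := eqVneq r 0%R; first by rewrite add0r poweRe0 mul1e.
have [->|sn0] := eqVneq s 0%R; first by rewrite addr0 poweRe0 mule1.
apply: poweRD; apply: add_neq0_poweRD_def; apply: lt0r_neq0.
by rewrite addr_gt0// lt0r ?rn0 ?sn0.
Qed.

Lemma poweRrK x r s : 0 <= x -> (r * s = 1)%R -> (x `^ r) `^ s = x.
Proof. by move=> x0 rs; rewrite -poweRrM rs poweRe1. Qed.

Lemma maxe_le_add x y : 0 <= x -> 0 <= y -> maxe x y <= x + y.
Proof. by move=> x0 y0; rewrite ge_max leeDl// leeDr. Qed.

(** Young's inequality without its sharp constant: both factors are compared with
    the same power of the maximum, which keeps infinite values harmless. *)
Lemma poweR_mul_le_add x y r s : 0 <= x -> 0 <= y ->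
  (0 <= r)%R -> (0 <= s)%R -> (r + s = 1)%R -> x `^ r * y `^ s <= x + y.
Proof.
move=> x0 y0 r0 s0 rs1; apply: le_trans (maxe_le_add x0 y0).
have m0 : 0 <= maxe x y by rewrite le_max x0.
apply: (@le_trans _ _ (maxe x y `^ r * maxe x y `^ s)).
  by apply: lee_pmul; rewrite ?poweR_ge0//; apply: le_poweR => //; rewrite le_max lexx ?orbT.
by rewrite -ge0_poweRD// rs1 poweRe1.
Qed.

Lemma poweR_add_le x y r : 0 <= x -> 0 <= y -> (0 <= r)%R ->
  (x + y) `^ r <= 2%:E `^ r * (x `^ r + y `^ r).
Proof.
move=> x0 y0 r0.
have m0 : 0 <= maxe x y by rewrite le_max x0.
apply: (@le_trans _ _ ((2%:E * maxe x y) `^ r)).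
  apply: le_poweR => //; first exact: adde_ge0.
  by rewrite mule_natl mule2n leeD// le_max lexx ?orbT.
rewrite poweRM// lee_pmul ?poweR_ge0//.
rewrite (le_trans _ (maxe_le_add _ _)) ?poweR_ge0//.
by case: (leP x y) => xy; rewrite le_max lexx ?orbT.
Qed.

Lemma poweR_superadd x y r : 0 <= x -> 0 <= y -> (1 <= r)%R ->
  x `^ r + y `^ r <= (x + y) `^ r.
Proof.
move=> x0 y0 r1; have r0 : (0 <= r - 1)%R by rewrite subr_ge0.
have E z : 0 <= z -> z `^ r = z * z `^ (r - 1).
  by move=> z0; rewrite -{2}(poweRe1 z0) -ge0_poweRD// addrC subrK.
rewrite !E ?adde_ge0// ge0_muleDl//.
by apply: leeD; apply: lee_pmul => //; rewrite ?poweR_ge0//;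
  apply: le_poweR => //; rewrite ?leeDl ?leeDr.
Qed.

Lemma lee_poweRV x y r : 0 <= x -> 0 <= y -> (0 < r)%R ->
  x `^ r <= y `^ r -> x <= y.
Proof.
move=> x0 y0 r0 /(@le_poweR _ _ r^-1 (poweR_ge0 _ _)); rewrite invr_ge0.
by move=> /(_ (ltW r0)); rewrite !poweRrK// mulfV// gt_eqF.
Qed.

(** Division by x^r. It is here that a lower bound for the norm needs the tested
    functional to be finite. *)
Lemma absorb_poweR x c r s : 0 <= x -> x < +oo -> 0 <= c ->
  (0 < s)%R -> (r + s = 1)%R -> (0 <= r)%R ->
  x <= c * x `^ r -> x <= c `^ s^-1.
Proof.
move=> x0 xoo c0 s0 rs1 r0 xcx.
have [->|xn0] := eqVneq x 0; first exact: poweR_ge0.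
have xgt0 : 0 < x by rewrite lt0e xn0.
have xr : x = x `^ r * x `^ s by rewrite -ge0_poweRD ?(ltW s0)// rs1 poweRe1.
have xrgt0 : 0 < x `^ r by rewrite poweR_gt0.
have xrfin : x `^ r \is a fin_num by rewrite ge0_fin_numE ?poweR_lty ?ltW.
have : x `^ s <= c.
  move: xcx; rewrite {1}xr muleC.
  by rewrite lee_pmul2r.
move=> /(@le_poweR _ _ s^-1 (poweR_ge0 _ _)); rewrite invr_ge0 => /(_ (ltW s0)).
by rewrite poweRrK// mulfV ?gt_eqF.
Qed.

Lemma nd_cvg_mule_le (a b : nat -> \bar R) l m c :
  (forall n, 0 <= a n) -> (forall n, 0 <= b n) ->
  nondecreasing_seq a -> nondecreasing_seq b ->
  a @ \oo --> l -> b @ \oo --> m -> (forall n, a n * b n <= c) -> l * m <= c.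
Proof.
move=> a0 b0 nda ndb al bm abc.
have ub (u : nat -> \bar R) k : nondecreasing_seq u -> u @ \oo --> k -> forall n, u n <= k.
  move=> ndu uk n; rewrite -(cvg_lim _ uk)//.
  by rewrite (cvg_lim _ (ereal_nondecreasing_cvgn ndu))//; apply: ereal_sup_ubound; exists n.
have c0 : 0 <= c by apply: le_trans (abc 0%N); exact: mule_ge0.
have [l0|ln0] := eqVneq l 0; first by rewrite l0 mul0e.
have [m0|mn0] := eqVneq m 0; first by rewrite m0 mule0.
have abd : l *? m.
  by apply: neq0_mule_def; rewrite mule_neq0.
have cv : (fun n => a n * b n) @ \oo --> l * m by exact: cvgeM.
rewrite -(cvg_lim _ cv)//.
by apply: lime_le; [exact: cvgP cv|exact: nearW].
Qed.

Lemma nd_cvg_poweR_le (a : nat -> \bar R) l r c : (0 < r)%R ->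
  (forall n, 0 <= a n) -> a @ \oo --> l -> (forall n, a n `^ r <= c) -> l `^ r <= c.
Proof.
move=> r0 a0 al ac.
have c0 : 0 <= c by apply: le_trans (ac 0%N); exact: poweR_ge0.
have l0 : 0 <= l.
  by rewrite -(cvg_lim _ al)//; apply: lime_ge; [exact: cvgP al|exact: nearW].
have : l <= c `^ r^-1.
  rewrite -(cvg_lim _ al)//; apply: lime_le; [exact: cvgP al|apply: nearW => n].
  rewrite -[a n](@poweRrK _ r r^-1)// ?mulfV ?gt_eqF//.
  by rewrite le_poweR ?poweR_ge0// invr_ge0 ltW.
move=> /(le_poweR l0) /(_ (ltW r0)).
by rewrite poweRrK// mulVf// gt_eqF.
Qed.

Lemma nd_cvg_lub (u : nat -> \bar R) l : nondecreasing_seq u ->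
  (forall n, u n <= l) -> (forall c, (forall n, u n <= c) -> l <= c) ->
  u @ \oo --> l.
Proof.
move=> ndu ul lub; have -> : l = ereal_sup (range u).
  apply/eqP; rewrite eq_le; apply/andP; split.
    by apply: lub => n; apply: ereal_sup_ubound; exists n.
  by apply: ge_ereal_sup => _ [n _ <-].
exact: ereal_nondecreasing_cvgn.
Qed.

Lemma nd_cvg_poweR (u : nat -> \bar R) l r : (0 < r)%R -> nondecreasing_seq u ->
  (forall n, 0 <= u n) -> u @ \oo --> l -> (fun n => u n `^ r) @ \oo --> l `^ r.
Proof.
move=> r0 ndu u0 ul; apply: nd_cvg_lub.
- by move=> i j ij; apply: le_poweR => //; [exact: ndu|exact: ltW].
- move=> n; apply: le_poweR; rewrite ?(ltW r0)//.
  rewrite -(cvg_lim _ ul)// (cvg_lim _ (ereal_nondecreasing_cvgn ndu))//.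
  by apply: ereal_sup_ubound; exists n.
- by move=> c; exact: nd_cvg_poweR_le.
Qed.

End PowersOfExtendedReals.

(** * Tails of a measure *)

Section MonotoneMeasurable.
Context {R : realType}.
Local Open Scope ereal_scope.

Lemma nondecreasing_emeasurable (f : R -> \bar R) :
  {homo f : x y / (x <= y)%R >-> x <= y} ->
  measurable_fun [set: measurableTypeR R] f.
Proof.
move=> ndf; apply: (measurability _ (ErealGenOInfty.measurableE R)).
move=> /= _ [_ [a ->]] <-; rewrite setTI; apply: is_interval_measurable.
move=> x y /=; rewrite !in_itv/= !andbT => ax ay z /andP[xz zy].
by rewrite in_itv/= andbT; apply: lt_le_trans ax (ndf _ _ xz).
Qed.

Lemma nonincreasing_emeasurable (f : R -> \bar R) :
  {homo f : x y / (x <= y)%R >-> y <= x} ->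
  measurable_fun [set: measurableTypeR R] f.
Proof.
move=> ndf; apply: (measurability _ (ErealGenOInfty.measurableE R)).
move=> /= _ [_ [a ->]] <-; rewrite setTI; apply: is_interval_measurable.
move=> x y /=; rewrite !in_itv/= !andbT => ax ay z /andP[xz zy].
by rewrite in_itv/= andbT; apply: lt_le_trans ay (ndf _ _ zy).
Qed.

End MonotoneMeasurable.

Lemma measurable_fun_poweR d (T : measurableType d) (R : realType) (D : set T)
  (f : T -> \bar R) (r : R) :
  measurable_fun D f -> measurable_fun D (fun x => f x `^ r)%E.
Proof. by move=> mf; exact: (measurableT_comp (measurable_poweR r) mf). Qed.

Section Tails.
Context d (T : measurableType d) (R : realType) (m : {measure set T -> \bar R}).
Variables (h : T -> R) (w : T -> \bar R).
Hypothesis mh : measurable_fun setT h.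
Hypothesis mw : measurable_fun setT w.
Hypothesis w0 : (forall x, 0 <= w x)%E.
Local Open Scope ereal_scope.

Let tail (E : set T) t := E `&` [set y | (h t <= h y)%R].

Let measurable_tail E t : measurable E -> measurable (tail E t).
Proof.
move=> mE; rewrite /tail; apply: measurableI => //; rewrite -[X in measurable X]setTI.
rewrite (_ : [set y | _] = h @^-1` `[h t, +oo[%classic); last first.
  by apply/seteqP; split => y /=; rewrite in_itv/= andbT.
by apply: mh => //; exact: measurable_itv.
Qed.

(** The set E is the increasing union of a sequence of its tails, cut at rational
    levels of h: if h attains its infimum on E one tail is enough. *)
Lemma integral_le_of_tails (E : set T) (c : \bar R) : measurable E -> 0 <= c ->
  (forall t, E t -> \int[m]_(y in E `&` [set y | (h t <= h y)%R]) w y <= c) ->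
  \int[m]_(y in E) w y <= c.
Proof.
move=> mE c0 Ec.
have [->|/set0P[x0 Ex0]] := eqVneq E set0; first by rewrite integral_set0.
have [[t [Et Emin]]|nomin] := pselect (exists t, E t /\ forall y, E y -> (h t <= h y)%R).
  have EE : E = E `&` [set y | (h t <= h y)%R].
    by apply/seteqP; split => [y Ey|y []//]; split => //=; exact: Emin.
  by rewrite {1}EE; exact: Ec.
have P (o : option rat) : exists t, E t /\ forall r, o = Some r ->
    (exists2 y, E y & (h y < ratr r)%R) -> (h t < ratr r)%R.
  case: o => [r|]; last by exists x0.
  have [[y Ey yr]|nr] := pselect (exists2 y, E y & (h y < ratr r)%R).
    by exists y; split => // _ [<-].
  by exists x0; split => // _ [<-].
have [u Pu] := choice P.
pose t n := u (unpickle n).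
have Et n : E (t n) by have [] := Pu (unpickle n).
have cof y : E y -> exists n, (h (t n) <= h y)%R.
  move=> Ey; have [z Ez zy] : exists2 z, E z & (h z < h y)%R.
    apply: contrapT => H; apply: nomin; exists y; split => // z Ez.
    by rewrite leNgt; apply/negP => zy; apply: H; exists z.
  have [r /andP[zr ry]] : exists r : rat, ((h z < ratr r) && (ratr r < h y))%R.
    by have [r] := rat_in_itvoo zy; rewrite in_itv/= => H; exists r.
  exists (pickle r); rewrite /t pickleK.
  have [_ /(_ r erefl)] := Pu (Some r).
  by move=> /(_ (ex_intro2 _ _ z Ez zr)) H; apply/ltW/(lt_trans H).
(* running minimum along the cofinal sequence t, so that the tails increase *)
pose s := fix s n := if n is n'.+1 then if (h (s n') <= h (t n))%R then s n' else t n
                     else t 0%N.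
have Es n : E (s n) by elim: n => [|n IH] //=; case: ifP.
have hs n : (h (s n.+1) <= h (s n))%R.
  by rewrite /=; case: ifPn => //; rewrite -ltNge => /ltW.
have st n : (h (s n) <= h (t n))%R by case: n => [|n] //=; case: ifPn.
have EU : E = \bigcup_n tail E (s n).
  apply/seteqP; split => y; last by case=> n _ [].
  by move=> Ey; have [n tn] := cof y Ey; exists n => //; split => //=; exact: le_trans (st n) tn.
have nds : nondecreasing_seq (fun n => tail E (s n)).
  apply/nondecreasing_seqP => n; rewrite subsetEset => y [Ey /= sy]; split => //=.
  exact: le_trans (hs n) sy.
have mt n : measurable (tail E (s n)) by exact: measurable_tail.
have := @ge0_nondecreasing_set_cvg_integral _ _ _ _ w m nds mt.
rewrite -EU => /(_ (fun n => measurable_funTS mw) (fun _ x _ => w0 x)) cv.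
rewrite -(cvg_lim _ cv)//; apply: lime_le; first exact: cvgP cv.
by apply: nearW => n; exact: Ec.
Qed.

(** Substitute for integration by parts. At most the mass c of w sits where
    W < c; so at least half of the mass of w sits where W is at least half of the
    total mass. *)
Lemma poweR_integral_le_tails (E : set T) (W : T -> \bar R) (b : R) :
  measurable E -> measurable_fun setT W -> (forall x, 0 <= W x) -> (0 <= b)%R ->
  (forall x, E x -> \int[m]_(y in E `&` [set y | (h x <= h y)%R]) w y <= W x) ->
  (\int[m]_(y in E) w y) `^ (b + 1) <=
    2%:E `^ (b + 1) * \int[m]_(y in E) (W y `^ b * w y).
Proof.
move=> mE mW W0 b0 WE.
set I := \int[m]_(y in E) w y.
have I0 : 0 <= I by exact: integral_ge0.
have mlt c : measurable [set y | W y < c].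
  rewrite -[X in measurable X]setTI; exact: emeasurable_fun_infty_o.
have mge c : measurable [set y | c <= W y].
  rewrite -[X in measurable X]setTI; exact: emeasurable_fun_c_infty.
have low c : 0 <= c -> \int[m]_(y in E `&` [set y | W y < c]) w y <= c.
  move=> c0; apply: integral_le_of_tails => //; first exact: measurableI.
  move=> t [Et /= Wtc]; apply/ltW/le_lt_trans/Wtc/le_trans/WE/Et.
  apply: ge0_subset_integral => //.
  - by apply: measurable_tail; exact: measurableI.
  - exact: measurable_tail.
  - exact: measurable_funTS.
  - by move=> y [[]].
have split_ c : 0 <= c -> I <= c + \int[m]_(y in E `&` [set y | c <= W y]) w y.
  move=> c0; rewrite /I.
  have EU : E = (E `&` [set y | W y < c]) `|` (E `&` [set y | c <= W y]).
    apply/seteqP; split => y; last by case=> -[].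
    by move=> Ey; case: (ltP (W y) c) => H; [left|right].
  rewrite {1}EU ge0_integral_setU//.
  - by apply: leeD => //; exact: low.
  - exact: measurableI.
  - exact: measurableI.
  - exact: measurable_funTS.
  - rewrite disj_set2E; apply/eqP/seteqP; split => y //= -[[_ H1] [_ H2]].
    by have := lt_le_trans H1 H2; rewrite ltxx.
have mWw : measurable_fun setT (fun y => W y `^ b * w y).
  by apply: emeasurable_funM => //; exact: measurable_fun_poweR.
have up c : 0 <= c -> c `^ b * \int[m]_(y in E `&` [set y | c <= W y]) w y <=
    \int[m]_(y in E) (W y `^ b * w y).
  move=> c0; rewrite -ge0_integralZl ?poweR_ge0//; last 2 first.
  - exact: measurableI.
  - exact: measurable_funTS.
  apply: (@le_trans _ _ (\int[m]_(y in E `&` [set y | c <= W y]) (W y `^ b * w y))).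
    apply: ge0_le_integral => //.
    - exact: measurableI.
    - by move=> y _; rewrite mule_ge0 ?poweR_ge0.
    - by apply: measurable_funTS; exact: measurable_funeM.
    - exact: measurable_funTS.
    - by move=> y [_ /= cW]; rewrite lee_wpmul2r// le_poweR.
  apply: ge0_subset_integral => //.
  - exact: measurableI.
  - exact: measurable_funTS.
  - by move=> y _; rewrite mule_ge0 ?poweR_ge0.
have [Ioo|Ifin] := eqVneq I +oo; last first.
  have Ifn : I \is a fin_num by rewrite ge0_fin_numE// ltey.
  pose c := (fine I / 2)%:E.
  have c0 : 0 <= c by rewrite lee_fin divr_ge0 ?fine_ge0.
  have I2c : I = 2%:E * c.
    by rewrite -EFinM mulrCA mulfV ?mulr1 ?fineK// pnatr_eq0.
  have cE : c <= \int[m]_(y in E `&` [set y | c <= W y]) w y.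
    have := split_ _ c0; rewrite {1}I2c mule_natl mule2n leeD2lE//.
  rewrite I2c poweRM// lee_wpmul2l ?poweR_ge0//.
  rewrite ge0_poweRD// poweRe1//; apply: le_trans (up _ c0).
  by rewrite lee_wpmul2l ?poweR_ge0.
have upoo : +oo <= \int[m]_(y in E) (W y `^ b * w y).
  apply: le_trans (up 1 lee01); rewrite poweR1r mul1e.
  have := split_ 1 lee01; rewrite Ioo leye_eq addeC.
  by move/eqP; case: (\int[m]_(y in E `&` [set y | 1 <= W y]) w y).
move: upoo; rewrite leye_eq => /eqP ->.
by rewrite gt0_muley ?leey// poweR_gt0// lte_fin.
Qed.

End Tails.

(** * Integral operators with a monotone kernel *)

Section Kernels.
Context {R : realType}.
Local Open Scope ereal_scope.
Local Notation RT := (measurableTypeR R).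
Local Notation leb := (@lebesgue_measure R).
Implicit Types (mu eta : {measure set RT -> \bar R}) (k : R -> R -> R)
  (f w : R -> \bar R).

Definition tail_mass mu (x : R) : \bar R := mu `[x, +oo[%classic.

Definition kernel_op k f (x : R) : \bar R := \int[leb]_s ((k x s)%:E * f s).

Definition kernel_pow (r : R) k (x : R) : \bar R :=
  \int[leb]_s ((k x s)%:E `^ r).

(** Kernels live on the whole plane; triangular ones vanish for x < s, which is
    compatible with being nondecreasing in x. *)
Record positive_kernel k : Prop := {
  pk_meas : measurable_fun (setT : set (RT * RT)) (fun xs => k xs.1 xs.2) ;
  pk_ge0 : forall x s, (0 <= k x s)%R ;
  pk_homo : forall x y s, (x <= y)%R -> (k x s <= k y s)%R }.

(** The q-th power of the norm inequality. The constant is a real number, so that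
    it can be cancelled, while the test functions may take the value +oo, as
    integrals of nonnegative functions do. *)
Definition operator_bound (p q : R) mu k (N : R) : Prop :=
  forall f, measurable_fun [set: R] f -> (forall s, 0 <= f s) ->
    \int[leb]_s (f s `^ p) < +oo ->
    \int[mu]_x (kernel_op k f x `^ q) <=
      N%:E * (\int[leb]_s (f s `^ p)) `^ (q / p).

Lemma tail_mass_ge0 mu x : 0 <= tail_mass mu x.
Proof. exact: measure_ge0. Qed.

Lemma tail_mass_nonincreasing mu : {homo tail_mass mu : x y / (x <= y)%R >-> y <= x}.
Proof.
move=> x y xy; rewrite /tail_mass; apply: le_measure; rewrite ?inE//.
by move=> z /=; rewrite !in_itv/= !andbT; exact: le_trans xy.
Qed.

Lemma measurable_tail_mass mu : measurable_fun [set: R] (tail_mass mu).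
Proof. by apply: nonincreasing_emeasurable; exact: tail_mass_nonincreasing. Qed.

Lemma kernel_section_meas k x : positive_kernel k -> measurable_fun [set: R] (k x).
Proof. by move=> [mk _ _]; exact: (measurableT_comp mk (pair1_measurable x)). Qed.

Lemma kernel_pow_meas r k x : positive_kernel k ->
  measurable_fun [set: R] (fun s => (k x s)%:E `^ r).
Proof.
move=> hk; apply: measurable_fun_poweR.
apply/measurable_EFinP; exact: kernel_section_meas.
Qed.

Lemma kernel_pow_ge0 r k x : 0 <= kernel_pow r k x.
Proof. by apply: integral_ge0 => s _; exact: poweR_ge0. Qed.

Lemma kernel_pow_nondecreasing r k : positive_kernel k -> (0 <= r)%R ->
  {homo kernel_pow r k : x y / (x <= y)%R >-> x <= y}.
Proof.
move=> hk r0 x y xy; apply: ge0_le_integral => //.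
- by move=> s _; exact: poweR_ge0.
- exact: kernel_pow_meas.
- exact: kernel_pow_meas.
- by move=> s _; apply: le_poweR; rewrite // lee_fin ?(pk_ge0 hk)// (pk_homo hk).
Qed.

Lemma measurable_kernel_pow r k : positive_kernel k -> (0 <= r)%R ->
  measurable_fun [set: R] (kernel_pow r k).
Proof. by move=> hk r0; apply: nondecreasing_emeasurable; exact: kernel_pow_nondecreasing. Qed.

Lemma kernel_op_ge0 k f x : positive_kernel k -> (forall s, 0 <= f s) ->
  0 <= kernel_op k f x.
Proof.
move=> hk f0; apply: integral_ge0 => s _; apply: mule_ge0 => //.
by rewrite lee_fin (pk_ge0 hk).
Qed.

Lemma kernel_op_nondecreasing k f : positive_kernel k ->
  measurable_fun [set: R] f -> (forall s, 0 <= f s) ->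
  {homo kernel_op k f : x y / (x <= y)%R >-> x <= y}.
Proof.
move=> hk mf f0 x y xy.
have mkf z : measurable_fun [set: R] (fun s => (k z s)%:E * f s).
  by apply: emeasurable_funM => //; apply/measurable_EFinP; exact: kernel_section_meas.
apply: ge0_le_integral => //.
- by move=> s _; rewrite mule_ge0// lee_fin (pk_ge0 hk).
- exact: mkf.
- exact: mkf.
- by move=> s _; apply: lee_wpmul2r => //; rewrite lee_fin (pk_homo hk).
Qed.

Lemma measurable_kernel_op k f : positive_kernel k ->
  measurable_fun [set: R] f -> (forall s, 0 <= f s) ->
  measurable_fun [set: R] (kernel_op k f).
Proof. by move=> hk mf f0; apply: nondecreasing_emeasurable; exact: kernel_op_nondecreasing. Qed.

Lemma ge0_integral_iterated (m1 m2 : {sigma_finite_measure set RT -> \bar R})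
    (F : R -> R -> \bar R) :
  measurable_fun (setT : set (RT * RT)) (fun z => F z.1 z.2) ->
  (forall x y, 0 <= F x y) ->
  \int[m1]_x \int[m2]_y F x y = \int[m2]_y \int[m1]_x F x y.
Proof.
move=> mF F0; exact: (@fubini_tonelli _ _ _ _ _ m1 m2 (fun z => F z.1 z.2)).
Qed.

Lemma integral_tailE mu w x : \int[mu]_(y in `[x, +oo[) w y =
  \int[mu]_y (if (x <= y)%R then w y else 0).
Proof.
rewrite integral_mkcond; apply: eq_integral => y _.
by rewrite patchE mem_setE/= in_itv/= andbT.
Qed.

Lemma integral_headE mu w x : \int[mu]_(y in `]-oo, x]) w y =
  \int[mu]_y (if (y <= x)%R then w y else 0).
Proof.
rewrite integral_mkcond; apply: eq_integral => y _.
by rewrite patchE mem_setE/= in_itv.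
Qed.

Lemma measurable_fst_comp w : measurable_fun [set: R] w ->
  measurable_fun (setT : set (RT * RT)) (fun z => w z.1).
Proof. by move=> mw; exact: (measurableT_comp mw measurable_fst). Qed.

Lemma measurable_snd_comp w : measurable_fun [set: R] w ->
  measurable_fun (setT : set (RT * RT)) (fun z => w z.2).
Proof. by move=> mw; exact: (measurableT_comp mw measurable_snd). Qed.

Lemma measurable_swap_comp (F : R -> R -> \bar R) :
  measurable_fun (setT : set (RT * RT)) (fun z => F z.1 z.2) ->
  measurable_fun (setT : set (RT * RT)) (fun z => F z.2 z.1).
Proof.
move=> mF; exact: (measurableT_comp mF (measurable_fun_pair measurable_snd measurable_fst)).
Qed.

Lemma measurable_if_le (F : R -> R -> \bar R) :
  measurable_fun (setT : set (RT * RT)) (fun z => F z.1 z.2) ->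
  measurable_fun (setT : set (RT * RT))
    (fun z => if (z.1 <= z.2)%R then F z.1 z.2 else 0).
Proof.
move=> mF; apply: measurable_fun_ifT => //.
exact: (measurable_fun_ler (measurable_fst : measurable_fun setT (@fst RT RT)) measurable_snd).
Qed.

Lemma measurable_if_ge w x : measurable_fun [set: R] w ->
  measurable_fun [set: R] (fun y => if (x <= y)%R then w y else 0).
Proof. by move=> mw; apply: measurable_fun_ifT => //; exact: measurable_fun_ler. Qed.

Lemma measurable_if_le_cst w x : measurable_fun [set: R] w ->
  measurable_fun [set: R] (fun y => if (y <= x)%R then w y else 0).
Proof. by move=> mw; apply: measurable_fun_ifT => //; exact: measurable_fun_ler. Qed.

Lemma measurable_kernel_poweR r k : positive_kernel k ->
  measurable_fun (setT : set (RT * RT)) (fun z => (k z.1 z.2)%:E `^ r).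
Proof.
by move=> hk; apply: measurable_fun_poweR; apply/measurable_EFinP; exact: (pk_meas hk).
Qed.

Lemma measurable_integral_fst (m2 : {sigma_finite_measure set RT -> \bar R})
    (F : R -> R -> \bar R) :
  measurable_fun (setT : set (RT * RT)) (fun z => F z.1 z.2) ->
  (forall x y, 0 <= F x y) -> measurable_fun [set: R] (fun x => \int[m2]_y F x y).
Proof.
move=> mF F0.
exact: (@measurable_fun_fubini_tonelli_F _ _ RT RT R m2 (fun z => F z.1 z.2)).
Qed.

End Kernels.

(** * Exponents, heads and tails *)

Section Exponents.
Context {R : realType} (p q : R) (hq : 1 < q) (hqp : q < p).

Lemma exponent_gt0 : [/\ 0 < q, 0 < p, 0 < p - 1, 0 < p - q & 0 < q - 1].
Proof. by have := hq; have := hqp => *; split; lra. Qed.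

Lemma exponent_neq0 : [/\ q != 0, p != 0, p - 1 != 0, p - q != 0 & q - 1 != 0].
Proof. by have [? ? ? ? ?] := exponent_gt0; split; apply: lt0r_neq0. Qed.

Lemma conj_exp_gt0 : 0 < conj_exp p.
Proof. by have [? ? ? ? ?] := exponent_gt0; apply: divr_gt0. Qed.

Lemma conj_expD1 : conj_exp p = conj_exp p * p^-1 + 1.
Proof. by have [? ? ? ? ?] := exponent_neq0; rewrite /conj_exp; field; apply/andP. Qed.

Lemma beta_gt0 : 0 < p / (p - q).
Proof. by have [? ? ? ? ?] := exponent_gt0; apply: divr_gt0. Qed.

Lemma betaB1 : p / (p - q) - 1 = p / (p - q) * (q / p).
Proof. by have [? ? ? ? ?] := exponent_neq0; field; apply/andP. Qed.

Lemma qdivp_gt0 : 0 < q / p.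
Proof. by have [? ? ? ? ?] := exponent_gt0; apply: divr_gt0. Qed.

Lemma betaB1_gt0 : 0 < p / (p - q) - 1.
Proof. by rewrite betaB1 mulr_gt0 ?beta_gt0 ?qdivp_gt0. Qed.

Lemma beta_inv : q / p + (p - q) / p = 1.
Proof. by have [? ? ? ? ?] := exponent_neq0; field. Qed.

Lemma beta_invE : ((p - q) / p)^-1 = p / (p - q).
Proof. by rewrite invf_div. Qed.

Lemma alpha_gt0 : 0 < p * (q - 1) / (p - q).
Proof. by have [? ? ? ? ?] := exponent_gt0; apply: divr_gt0 => //; apply: mulr_gt0. Qed.

Lemma alphaD1 :
  p * (q - 1) / (p - q) + 1 = q + p * (q - 1) / (p - q) * (q / p).
Proof. by have [? ? ? ? ?] := exponent_neq0; field; apply/andP. Qed.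

End Exponents.

Section HeadsAndTails.
Context {R : realType}.
Local Open Scope ereal_scope.
Local Notation RT := (measurableTypeR R).
Variables (m : {measure set RT -> \bar R}) (w : R -> \bar R) (b : R).
Hypothesis mw : measurable_fun [set: R] w.
Hypothesis w0 : forall x, 0 <= w x.
Hypothesis b0 : (0 <= b)%R.

Lemma head_nondecreasing :
  {homo (fun x => \int[m]_(y in `]-oo, x]) w y) : x y / (x <= y)%R >-> x <= y}.
Proof.
move=> x y xy; apply: ge0_subset_integral => //.
- exact: measurable_funTS.
- by move=> z /=; rewrite !in_itv/= => /le_trans; apply.
Qed.

Lemma measurable_head : measurable_fun [set: R] (fun x => \int[m]_(y in `]-oo, x]) w y).
Proof. by apply: nondecreasing_emeasurable; exact: head_nondecreasing. Qed.

Lemma tail_nonincreasing :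
  {homo (fun x => \int[m]_(y in `[x, +oo[) w y) : x y / (x <= y)%R >-> y <= x}.
Proof.
move=> x y xy; apply: ge0_subset_integral => //.
- exact: measurable_funTS.
- by move=> z /=; rewrite !in_itv/= !andbT; exact: le_trans xy.
Qed.

Lemma measurable_tail : measurable_fun [set: R] (fun x => \int[m]_(y in `[x, +oo[) w y).
Proof. by apply: nonincreasing_emeasurable; exact: tail_nonincreasing. Qed.

Lemma poweR_head_le x :
  (\int[m]_(y in `]-oo, x]) w y) `^ (b + 1) <= 2%:E `^ (b + 1) *
  \int[m]_(y in `]-oo, x]) ((\int[m]_(z in `]-oo, y]) w z) `^ b * w y).
Proof.
apply: (@poweR_integral_le_tails _ _ _ _ (fun y : RT => - y)%R) => //.
- exact: oppr_measurable.
- exact: measurable_head.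
- by move=> y; exact: integral_ge0.
- move=> t xt; apply: ge0_subset_integral => //.
  + by apply: measurableI => //; rewrite (_ : [set _ | _] = `]-oo, t]%classic)//;
      apply/seteqP; split => y /=; rewrite in_itv/= lerN2.
  + exact: measurable_funTS.
  + by move=> y [_] /=; rewrite in_itv/= lerN2.
Qed.

Lemma poweR_tail_le x :
  (\int[m]_(y in `[x, +oo[) w y) `^ (b + 1) <= 2%:E `^ (b + 1) *
  \int[m]_(y in `[x, +oo[) ((\int[m]_(z in `[y, +oo[) w z) `^ b * w y).
Proof.
apply: (@poweR_integral_le_tails _ _ _ _ (fun y : RT => y)) => //.
- exact: measurable_tail.
- by move=> y; exact: integral_ge0.
- move=> t xt; apply: ge0_subset_integral => //.
  + by apply: measurableI => //; rewrite (_ : [set _ | _] = `[t, +oo[%classic)//;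
      apply/seteqP; split => y /=; rewrite in_itv/= andbT.
  + exact: measurable_funTS.
  + by move=> y [_] /=; rewrite in_itv/= andbT.
Qed.

End HeadsAndTails.

Section LowerTail.
Context {R : realType} (p q : R) (hq : 1 < q) (hqp : q < p).
Local Open Scope ereal_scope.
Local Notation RT := (measurableTypeR R).
Local Notation leb := (@lebesgue_measure R).
Local Notation p' := (conj_exp p).
Local Notation b := (p / (p - q))%R.
Local Notation a := (p * (q - 1) / (p - q))%R.

(** The tail lemma for w = 1: here M^(b-1) plays the role of W^b. *)
Lemma poweR_tail_mass_le (mu : {measure set RT -> \bar R}) x :
  tail_mass mu x `^ b <=
    2%:E `^ b * \int[mu]_(y in `[x, +oo[) (tail_mass mu y `^ (b - 1)).
Proof.
have E y : \int[mu]_(z in `[y, +oo[) (cst 1 z) = tail_mass mu y.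
  by rewrite integral_cst//= mul1e.
have := @poweR_tail_le R mu (cst 1) (b - 1)%R (measurable_cst _) (fun _ => lee01)
  (ltW (betaB1_gt0 hq hqp)) x.
rewrite subrK E => /le_trans; apply; rewrite lee_wpmul2l ?poweR_ge0//.
by under eq_integral => y _ do rewrite E mule1.
Qed.

Variables (mu : {finite_measure set RT -> \bar R}) (k : R -> R -> R) (N : R).
Hypothesis hk : positive_kernel k.
Hypothesis N0 : (0 <= N)%R.
Hypothesis opN : operator_bound p q mu k N.

(** The test function f has f(s)^p = int k(y,s)^p' w(y) dmu(y), where
    w = M^(b-1) ph^a, so that int f^p = S by Fubini. Let om(x) be the
    integral of w dmu over [x,oo). As k increases in its first variable,
    f(s) >= k(x,s)^(p'/p) om(x)^(1/p), and as p'/p + 1 = p' the image of f at x is at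
    least ph(x) om(x)^(1/p). *)
Lemma dual_sum_le :
  let S := \int[mu]_y (tail_mass mu y `^ (b - 1) * kernel_pow p' k y `^ (a + 1)) in
  S < +oo -> S <= (2%:E `^ (b - 1) * N%:E) `^ b.
Proof.
move=> S Soo.
have [[p'0 a0] b1] := (conj_exp_gt0 hq hqp, alpha_gt0 hq hqp, betaB1_gt0 hq hqp).
pose M := tail_mass mu; pose ph := kernel_pow p' k.
have M0 y : 0 <= M y by exact: tail_mass_ge0.
have ph0 y : 0 <= ph y by exact: kernel_pow_ge0.
have mM : measurable_fun [set: R] M by exact: measurable_tail_mass.
have mph : measurable_fun [set: R] ph by apply: measurable_kernel_pow; rewrite // ltW.
pose w y := M y `^ (b - 1) * ph y `^ a.
have w0 y : 0 <= w y by rewrite mule_ge0 ?poweR_ge0.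
have mw : measurable_fun [set: R] w by apply: emeasurable_funM; exact: measurable_fun_poweR.
have S0 : 0 <= S by apply: integral_ge0 => y _; rewrite mule_ge0 ?poweR_ge0.
pose F s y := (k y s)%:E `^ p' * w y.
have F0 s y : 0 <= F s y by rewrite mule_ge0 ?poweR_ge0.
have mF : measurable_fun (setT : set (RT * RT)) (fun z => F z.1 z.2).
  apply: emeasurable_funM; last exact: measurable_snd_comp.
  exact: (@measurable_swap_comp _ (fun y s => (k y s)%:E `^ p') (measurable_kernel_poweR p' hk)).
pose f s := (\int[mu]_y F s y) `^ p^-1.
have f0 s : 0 <= f s by exact: poweR_ge0.
have mf : measurable_fun [set: R] f.
  by apply: measurable_fun_poweR; exact: measurable_integral_fst.
have [q0 p0 p10 pq0 q10] := exponent_gt0 hq hqp.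
have fS : \int[leb]_s (f s `^ p) = S.
  transitivity (\int[leb]_s \int[mu]_y F s y).
    apply: eq_integral => s _; rewrite poweRrK ?mulVf ?gt_eqF//.
    exact: integral_ge0.
  rewrite ge0_integral_iterated//; apply: eq_integral => y _.
  rewrite ge0_integralZr//; last 2 first.
  - exact: kernel_pow_meas.
  - by move=> s _; exact: poweR_ge0.
  rewrite -/(kernel_pow p' k y) -/(ph y) /w muleCA -/(M y); congr (_ * _).
  by rewrite (ge0_poweRD _ (ltW a0))// poweRe1// muleC.
pose om x := \int[mu]_(y in `[x, +oo[) w y.
have om0 x : 0 <= om x by exact: integral_ge0.
have op_ge x : ph x * om x `^ p^-1 <= kernel_op k f x.
  rewrite /ph /kernel_pow -ge0_integralZr ?poweR_ge0//; last 2 first.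
  - exact: kernel_pow_meas.
  - by move=> s _; exact: poweR_ge0.
  apply: ge0_le_integral => //.
  - by move=> s _; rewrite mule_ge0 ?poweR_ge0.
  - by apply: emeasurable_funM => //; exact: kernel_pow_meas.
  - apply: emeasurable_funM => //; apply/measurable_EFinP; exact: kernel_section_meas.
  move=> s _; have ks0 : 0 <= (k x s)%:E by rewrite lee_fin (pk_ge0 hk).
  have -> : (k x s)%:E `^ p' * om x `^ p^-1 =
      (k x s)%:E * ((k x s)%:E `^ p' * om x) `^ p^-1.
    rewrite poweRM ?poweR_ge0// -poweRrM muleA; congr (_ * _).
    rewrite {1}(conj_expD1 hq hqp) addrC ge0_poweRD ?poweRe1//.
    by rewrite mulr_ge0 ?invr_ge0 ?ltW.
  apply: lee_wpmul2l => //; apply: le_poweR.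
  - by rewrite mule_ge0 ?poweR_ge0.
  - rewrite /om -ge0_integralZl; [|exact: measurable_itv|exact: measurable_funTS
      |by move=> y _; exact: w0|exact: poweR_ge0].
    apply: (@le_trans _ _ (\int[mu]_(y in `[x, +oo[) F s y)).
      apply: ge0_le_integral; first exact: measurable_itv.
      - by move=> y _; rewrite mule_ge0 ?poweR_ge0.
      - by apply: measurable_funTS; exact: measurable_funeM.
      - by apply: measurable_funTS; exact: (measurableT_comp mF (pair1_measurable s)).
      - move=> y /=; rewrite in_itv/= andbT => xy; apply: lee_wpmul2r => //.
        by rewrite -poweR_EFin; apply: le_poweR; rewrite ?lee_fin ?(pk_ge0 hk) ?(pk_homo hk)// ltW.
    apply: ge0_subset_integral; [exact: measurable_itv|exact: measurableT| |
      by move=> y _; exact: F0|exact: subsetT].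
    exact: (measurableT_comp mF (pair1_measurable s)).
  - by rewrite invr_ge0 ltW.
(* ph is nondecreasing, hence can be moved into the tail integral *)
have om_ge x : ph x `^ a * M x `^ b <= 2%:E `^ b * om x.
  apply: (@le_trans _ _ (ph x `^ a * (2%:E `^ b * \int[mu]_(y in `[x, +oo[) (M y `^ (b - 1))))).
    by rewrite lee_wpmul2l ?poweR_ge0//; exact: poweR_tail_mass_le.
  rewrite muleCA lee_wpmul2l ?poweR_ge0// -ge0_integralZl ?poweR_ge0//; last 2 first.
  - by apply: measurable_funTS; exact: measurable_fun_poweR.
  - by move=> y _; exact: poweR_ge0.
  apply: ge0_le_integral => //.
  - by move=> y _; rewrite mule_ge0 ?poweR_ge0.
  - by apply: measurable_funTS; apply: measurable_funeM; exact: measurable_fun_poweR.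
  - exact: measurable_funTS.
  - move=> y /=; rewrite in_itv/= andbT => xy; rewrite muleC lee_wpmul2l ?poweR_ge0//.
    apply: le_poweR => //; last exact: ltW.
    by apply: kernel_pow_nondecreasing; rewrite // ltW.
have qp0 : (0 <= q / p)%R by exact: ltW (qdivp_gt0 hq hqp).
have mop : measurable_fun [set: R] (kernel_op k f) by exact: measurable_kernel_op.
have key : S <= 2%:E `^ (b - 1) * \int[mu]_x (kernel_op k f x `^ q).
  rewrite -ge0_integralZl ?poweR_ge0//; last 2 first.
  - exact: measurable_fun_poweR.
  - by move=> y _; exact: poweR_ge0.
  apply: ge0_le_integral => //.
  - by move=> y _; rewrite mule_ge0 ?poweR_ge0.
  - by apply: emeasurable_funM; exact: measurable_fun_poweR.
  - by apply: measurable_funeM; exact: measurable_fun_poweR.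
  move=> x _; rewrite -/(M x) -/(ph x).
  apply: (@le_trans _ _ (2%:E `^ (b - 1) * (ph x * om x `^ p^-1) `^ q)); last first.
    rewrite lee_wpmul2l ?poweR_ge0// le_poweR ?(ltW q0)//.
    by rewrite mule_ge0 ?poweR_ge0.
  have -> : M x `^ (b - 1) * ph x `^ (a + 1) = ph x `^ q * (ph x `^ a * M x `^ b) `^ (q / p).
    rewrite poweRM ?poweR_ge0// -!poweRrM (betaB1 hq hqp) (alphaD1 hq hqp).
    have aqp0 : (0 <= a * (q / p))%R by rewrite mulr_ge0 // ltW.
    by rewrite (ge0_poweRD _ (ltW q0) aqp0) muleC muleA.
  have -> : 2%:E `^ (b - 1) * (ph x * om x `^ p^-1) `^ q =
      ph x `^ q * (2%:E `^ b * om x) `^ (q / p).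
    rewrite !poweRM ?poweR_ge0// -!poweRrM (betaB1 hq hqp) muleCA.
    by rewrite (mulrC p^-1%R).
  rewrite lee_wpmul2l ?poweR_ge0//; apply: le_poweR => //.
  by rewrite mule_ge0 ?poweR_ge0.
have := opN mf f0; rewrite fS => /(_ Soo) opS.
have := @absorb_poweR _ S (2%:E `^ (b - 1) * N%:E) (q / p)%R ((p - q) / p)%R.
rewrite beta_invE; apply => //.
- by rewrite mule_ge0 ?poweR_ge0.
- exact: divr_gt0.
- exact: beta_inv hq hqp.
- by apply: (le_trans key); rewrite -muleA lee_wpmul2l ?poweR_ge0.
Qed.

End LowerTail.

(** * The lower bound by the tail functional *)

Section MeasureTheory.
Context d (T : measurableType d) (R : realType).
Local Open Scope ereal_scope.

Lemma ge0_integral_mrestr (m : {measure set T -> \bar R}) (D : set T)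
    (mD : measurable D) (f : T -> \bar R) :
  measurable_fun setT f -> (forall x, 0 <= f x) ->
  \int[mrestr m mD]_x f x = \int[m]_(x in D) f x.
Proof.
move=> mf f0.
rewrite -(setvU D) ge0_integral_setU//=; last 3 first.
- exact: measurableC.
- by rewrite setvU.
- by rewrite disj_set2E setICl.
have -> : \int[mrestr m mD]_(x in ~` D) f x = 0.
  rewrite (eq_measure_integral mzero) ?integral_measure_zero// => A mA AD.
  have AD0 : A `&` D = set0 by apply/seteqP; split => // x [/AD].
  by transitivity (m (A `&` D)) => //; rewrite AD0 measure0.
rewrite add0e; apply: eq_measure_integral => A mA AD.
transitivity (m (A `&` D)) => //; congr (m _); exact/setIidPl.
Qed.

(** Monotone convergence in the form used for exhaustions: h lies
    below every upper bound of the sequence, a condition that names no limit. *)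
Lemma ge0_integral_le_nd (m : {measure set T -> \bar R}) (h : T -> \bar R)
    (u : nat -> T -> \bar R) (C : \bar R) :
  measurable_fun setT h -> (forall x, 0 <= h x) ->
  (forall n, measurable_fun setT (u n)) -> (forall n x, 0 <= u n x) ->
  (forall x, nondecreasing_seq (u ^~ x)) ->
  (forall x c, (forall n, u n x <= c) -> h x <= c) ->
  (forall n, \int[m]_x u n x <= C) -> \int[m]_x h x <= C.
Proof.
move=> mh h0 mu_ u0 ndu hu uC.
have cv x : cvgn (u ^~ x) by apply: ereal_nondecreasing_is_cvgn; exact: ndu.
apply: (@le_trans _ _ (\int[m]_x (limn (u ^~ x)))).
  apply: ge0_le_integral => //.
  - apply: (emeasurable_fun_cvg u) => // x _; exact: cv.
  - move=> x _; apply: hu => n; rewrite (cvg_lim _ (ereal_nondecreasing_cvgn (ndu x)))//.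
    by apply: ereal_sup_ubound; exists n.
rewrite monotone_convergence//; apply: lime_le; last exact: nearW.
apply: ereal_nondecreasing_is_cvgn => i j ij; apply: ge0_le_integral => //.
by move=> x _; exact: ndu.
Qed.

End MeasureTheory.

Section LowerTailLimit.
Context {R : realType} (p q : R) (hq : 1 < q) (hqp : q < p).
Local Open Scope ereal_scope.
Local Notation RT := (measurableTypeR R).
Local Notation leb := (@lebesgue_measure R).
Local Notation p' := (conj_exp p).
Local Notation b := (p / (p - q))%R.
Local Notation a := (p * (q - 1) / (p - q))%R.

(** The power M^b of the tail mass is replaced by the tail integral of M^(b-1);
    after exchanging the integrals the inner one is at most
    W(y)^a eta (-oo,y] <= W(y)^(a+1). *)
Lemma integral_tail_le_dual_sum (mu eta : {finite_measure set RT -> \bar R})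
    (W : R -> \bar R) :
  {homo W : x y / (x <= y)%R >-> x <= y} -> (forall x, 0 <= W x) ->
  (forall y, eta `]-oo, y]%classic <= W y) ->
  \int[eta]_x (tail_mass mu x `^ b * W x `^ a) <=
    2%:E `^ b * \int[mu]_y (tail_mass mu y `^ (b - 1) * W y `^ (a + 1)).
Proof.
move=> ndW W0 etaW.
have mW : measurable_fun [set: R] W by exact: nondecreasing_emeasurable.
have a0 := alpha_gt0 hq hqp.
pose M := tail_mass mu.
have M0 y : 0 <= M y by exact: tail_mass_ge0.
have mM : measurable_fun [set: R] M by exact: measurable_tail_mass.
have mMb r : measurable_fun [set: R] (fun y => M y `^ r) by exact: measurable_fun_poweR.
have mWa r : measurable_fun [set: R] (fun y => W y `^ r) by exact: measurable_fun_poweR.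
pose F x y := if (x <= y)%R then M y `^ (b - 1) * W x `^ a else 0.
have F0 x y : 0 <= F x y by rewrite /F; case: ifP => // _; rewrite mule_ge0 ?poweR_ge0.
have mF : measurable_fun (setT : set (RT * RT)) (fun z => F z.1 z.2).
  apply: (@measurable_if_le _ (fun x y => M y `^ (b - 1) * W x `^ a)).
  apply: emeasurable_funM.
    exact: (@measurable_snd_comp _ (fun y => M y `^ (b - 1))).
  exact: (@measurable_fst_comp _ (fun x => W x `^ a)).
apply: (@le_trans _ _ (\int[eta]_x (2%:E `^ b * \int[mu]_y F x y))).
  apply: ge0_le_integral => //.
  - by move=> x _; rewrite mule_ge0 ?poweR_ge0.
  - by apply: emeasurable_funM; [exact: mMb|exact: mWa].
  - by apply: measurable_funeM; exact: measurable_integral_fst.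
  move=> x _; rewrite -/(M x).
  have -> : \int[mu]_y F x y = W x `^ a * \int[mu]_(y in `[x, +oo[) (M y `^ (b - 1)).
    rewrite integral_tailE -ge0_integralZl ?poweR_ge0//; last 2 first.
    - by apply: measurable_if_ge; exact: mMb.
    - by move=> y _; case: ifP => // _; exact: poweR_ge0.
    by apply: eq_integral => y _; rewrite /F muleC; case: ifP; rewrite ?mul0e ?mule0.
  rewrite muleCA muleC lee_wpmul2l ?poweR_ge0//.
  exact: poweR_tail_mass_le.
rewrite ge0_integralZl ?poweR_ge0//; last 2 first.
- exact: measurable_integral_fst.
- by move=> x _; exact: integral_ge0.
rewrite lee_wpmul2l ?poweR_ge0// ge0_integral_iterated//.
apply: ge0_le_integral => //.
- by move=> y _; exact: integral_ge0.
- exact: (@measurable_integral_fst _ eta (fun y x => F x y) (measurable_swap_comp mF)).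
- by apply: emeasurable_funM; [exact: mMb|exact: mWa].
move=> y _; rewrite -/(M y).
apply: (@le_trans _ _ (\int[eta]_(x in `]-oo, y]) (M y `^ (b - 1) * W y `^ a))).
  rewrite integral_headE; apply: ge0_le_integral => //.
  - exact: (measurableT_comp mF (pair2_measurable y)).
  - by apply: measurable_if_le_cst; exact: measurable_cst.
  - move=> x _; rewrite /F; case: ifP => // xy; rewrite lee_wpmul2l ?poweR_ge0//.
    by apply: le_poweR; rewrite ?ndW// ltW.
rewrite integral_cst//= -muleA lee_wpmul2l ?poweR_ge0//.
rewrite ge0_poweRD ?(ltW a0)// poweRe1// lee_wpmul2l ?poweR_ge0//.
Qed.

End LowerTailLimit.

Section TailEstimate.
Context {R : realType} (p q : R) (hq : 1 < q) (hqp : q < p).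
Local Open Scope ereal_scope.
Local Notation RT := (measurableTypeR R).
Local Notation leb := (@lebesgue_measure R).
Local Notation p' := (conj_exp p).
Variables (mu : {measure set RT -> \bar R}) (k : R -> R -> R) (N : R).
Hypothesis hk : positive_kernel k.
Hypothesis N0 : (0 <= N)%R.
Hypothesis opN : operator_bound p q mu k N.

Lemma qBqp_gt0 : (0 < q - q / p)%R.
Proof.
have [q0 p0 _ _ _] := exponent_gt0 hq hqp.
rewrite subr_gt0 ltr_pdivrMr// ltr_pMr//; exact: lt_trans hq hqp.
Qed.

(** Obtained by testing on f = k(x,.)^(p'/p): on [x,oo) its image is at least
    ph(x) = int f^p. The function is truncated to have a finite norm. *)
Lemma tail_mass_kernel_pow_le x :
  tail_mass mu x * kernel_pow p' k x `^ (q - q / p) <= N%:E.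
Proof.
have [q0 p0 p10 pq0 q10] := exponent_gt0 hq hqp.
have p'0 := conj_exp_gt0 hq hqp.
have pp0 : (0 < p' * p^-1)%R by rewrite mulr_gt0// invr_gt0.
have r0 := qBqp_gt0.
have qp0 := ltW (qdivp_gt0 hq hqp).
pose M := tail_mass mu x.
have M0 : 0 <= M by exact: tail_mass_ge0.
pose c n s := ((k x s <= n%:R) && (`|s| <= n%:R))%R.
have mc n : measurable_fun [set: R] (c n).
  apply: measurable_and; apply: measurable_fun_ler => //.
    exact: kernel_section_meas.
pose u n s := if c n s then (k x s)%:E `^ p' else 0.
pose f n s := if c n s then (k x s)%:E `^ (p' * p^-1) else 0.
have u0 n s : 0 <= u n s by rewrite /u; case: ifP => // _; exact: poweR_ge0.
have f0 n s : 0 <= f n s by rewrite /f; case: ifP => // _; exact: poweR_ge0.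
have mu_ n : measurable_fun [set: R] (u n).
  by apply: measurable_fun_ifT => //; exact: kernel_pow_meas.
have mf n : measurable_fun [set: R] (f n).
  by apply: measurable_fun_ifT => //; exact: kernel_pow_meas.
have ku n s y : (x <= y)%R -> u n s <= (k y s)%:E * f n s.
  rewrite /u /f; case: ifP => _ xy; last by rewrite mule0.
  rewrite {1}(conj_expD1 hq hqp) addrC ge0_poweRD ?ler01 ?(ltW pp0)//.
  rewrite poweRe1 ?lee_fin ?(pk_ge0 hk)//.
  by apply: ler_wpM2r; [exact: powR_ge0|exact: (pk_homo hk)].
pose phn n := \int[leb]_s u n s.
have phn0 n : 0 <= phn n by exact: integral_ge0.
have phnoo n : phn n < +oo.
  have phle : phn n <= \int[leb]_(s in `[(- n%:R)%R, n%:R]) (n%:R%:E `^ p').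
    rewrite [leRHS]integral_mkcond; apply: ge0_le_integral => //.
    - exact: mu_.
    - exact: (iffLR (measurable_restrictT _ (measurable_itv _)) (measurable_cst _)).
    move=> s _; rewrite patchE mem_setE/= in_itv/= /u /c -ler_norml.
    case: ifP => [/andP[kn ->]|_]; last by case: ifP => // _; exact: poweR_ge0.
    by rewrite -[leRHS]poweR_EFin; apply: le_poweR; rewrite ?lee_fin ?(pk_ge0 hk)// ltW.
  apply: (le_lt_trans phle); rewrite integral_cst//= lebesgue_measure_itv/=; apply: lte_mul_pinfty.
  - by rewrite -poweR_EFin poweR_ge0.
  - by [].
  - by case: ifP => _; rewrite ?ltry// -EFinN -EFinD ltry.
have fp n : \int[leb]_s (f n s `^ p) = phn n.
  apply: eq_integral => s _; rewrite /f /u; case: ifP => _.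
    by rewrite -poweRrM -mulrA mulVf ?mulr1 ?gt_eqF.
  by rewrite poweR0r// gt_eqF.
have bnd n : M * phn n `^ (q - q / p) <= N%:E.
  have [->|ph_neq0] := eqVneq (phn n) 0.
    by rewrite poweR0r ?gt_eqF// mule0 lee_fin.
  have phgt0 : 0 < phn n `^ (q / p) by rewrite poweR_gt0// lt0e ph_neq0 phn0.
  have phfin : phn n `^ (q / p) \is a fin_num.
    by rewrite ge0_fin_numE ?poweR_ge0// poweR_lty.
  rewrite -(lee_pmul2r phfin phgt0) -muleA -ge0_poweRD ?(ltW r0)// subrK.
  have := opN (mf n) (f0 n); rewrite fp => /(_ (phnoo n)); apply: le_trans.
  have mop : measurable_fun [set: R] (fun y => kernel_op k (f n) y `^ q).
    by apply: measurable_fun_poweR; exact: measurable_kernel_op.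
  apply: (@le_trans _ _ (\int[mu]_(y in `[x, +oo[) (kernel_op k (f n) y `^ q))).
    rewrite muleC -integral_cst//; apply: ge0_le_integral => //.
    - by move=> y _; exact: poweR_ge0.
    - exact: measurable_funTS.
    - move=> y /=; rewrite in_itv/= andbT => xy; apply: le_poweR; rewrite ?(ltW q0)//.
      apply: ge0_le_integral => //.
      + exact: mu_.
      + apply: emeasurable_funM; last exact: mf.
        by apply/measurable_EFinP; exact: kernel_section_meas.
      + by move=> s _; exact: ku.
  by apply: ge0_subset_integral => // y _; exact: poweR_ge0.
pose t := (q - q / p)^-1%R.
have t0 : (0 <= t)%R by rewrite invr_ge0 ltW.
apply: (@le_trans _ _ ((M `^ t * kernel_pow p' k x) `^ (q - q / p))).
  by rewrite poweRM ?poweR_ge0 ?kernel_pow_ge0// poweRrK// mulVf// gt_eqF.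
rewrite -[leRHS](@poweRrK _ _ t (q - q / p)) ?mulVf ?gt_eqF//.
apply: le_poweR; [by rewrite mule_ge0 ?poweR_ge0 ?kernel_pow_ge0| |exact: ltW].
have mk := kernel_pow_meas p' x hk.
rewrite /kernel_pow -ge0_integralZl ?poweR_ge0//; last by move=> s _; exact: poweR_ge0.
apply: (@ge0_integral_le_nd _ _ _ leb _ (fun n s => M `^ t * u n s)).
- exact: measurable_funeM.
- by move=> s; rewrite mule_ge0 ?poweR_ge0.
- by move=> n; apply: measurable_funeM; exact: mu_.
- by move=> n s; rewrite mule_ge0 ?poweR_ge0.
- move=> s; apply/nondecreasing_seqP => n; rewrite lee_wpmul2l ?poweR_ge0//.
  rewrite /u; case: ifPn => [/andP[kn sn]|_]; last by case: ifP => // _; exact: poweR_ge0.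
  by rewrite ifT// /c (le_trans kn) ?ler_nat// (le_trans sn)// ler_nat.
- move=> s C uC.
  pose n := maxn (Num.bound (k x s)) (Num.bound `|s|).
  have := uC n; rewrite /u ifT// /c; apply/andP; split.
    rewrite (le_trans (ltW (archi_boundP (pk_ge0 hk x s))))// ler_nat; exact: leq_maxl.
  rewrite (le_trans (ltW (archi_boundP (normr_ge0 s))))// ler_nat; exact: leq_maxr.
- move=> n; rewrite ge0_integralZl ?poweR_ge0//; last exact: mu_.
  rewrite -/(phn n) -[phn n](@poweRrK _ _ (q - q / p) t) ?mulfV ?gt_eqF//.
  by rewrite -poweRM ?poweR_ge0//; apply: le_poweR => //; rewrite mule_ge0 ?poweR_ge0.
Qed.

End TailEstimate.

Section Restriction.
Context {R : realType} (p q : R) (hq : 1 < q) (hqp : q < p).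
Local Open Scope ereal_scope.
Local Notation RT := (measurableTypeR R).
Local Notation leb := (@lebesgue_measure R).
Local Notation p' := (conj_exp p).

Lemma measure_le_of_tails (m : {measure set RT -> \bar R}) (E : set R) (c : \bar R) :
  measurable E -> 0 <= c -> (forall t, E t -> m (E `&` `[t, +oo[) <= c) -> m E <= c.
Proof.
move=> mE c0 Ec; have H (A : set R) : measurable A -> m A = \int[m]_(y in A) cst 1 y.
  by move=> mA; rewrite integral_cst//= mul1e.
rewrite H//; apply: (@integral_le_of_tails _ _ _ m (fun y : RT => y)) => // t Et.
rewrite (_ : [set _ | _] = `[t, +oo[%classic).
  by rewrite -H ?Ec//; exact: measurableI.
by apply/seteqP; split => y /=; rewrite in_itv/= andbT.
Qed.

Lemma measure_le_of_heads (m : {measure set RT -> \bar R}) (E : set R) (c : \bar R) :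
  measurable E -> 0 <= c -> (forall t, E t -> m (E `&` `]-oo, t]) <= c) -> m E <= c.
Proof.
move=> mE c0 Ec; have H (A : set R) : measurable A -> m A = \int[m]_(y in A) cst 1 y.
  by move=> mA; rewrite integral_cst//= mul1e.
rewrite H//; apply: (@integral_le_of_tails _ _ _ m (fun y : RT => - y)%R) => //.
  exact: oppr_measurable.
move=> t Et; rewrite (_ : [set _ | _] = `]-oo, t]%classic).
  by rewrite -H ?Ec//; exact: measurableI.
by apply/seteqP; split => y /=; rewrite in_itv/= lerN2.
Qed.

Lemma operator_bound_mrestr (mu : {measure set RT -> \bar R}) (D : set RT)
    (mD : measurable D) (k : R -> R -> R) (N : R) :
  positive_kernel k -> operator_bound p q mu k N ->
  operator_bound p q (mrestr mu mD) k N.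
Proof.
move=> hk opN f mf f0 foo.
have mop : measurable_fun [set: R] (fun x => kernel_op k f x `^ q).
  by apply: measurable_fun_poweR; exact: measurable_kernel_op.
rewrite ge0_integral_mrestr//; last by move=> x; exact: poweR_ge0.
apply: le_trans (opN f mf f0 foo); apply: ge0_subset_integral => // x _.
exact: poweR_ge0.
Qed.

Variables (mu : {measure set RT -> \bar R}) (k : R -> R -> R) (N : R).
Hypothesis hk : positive_kernel k.
Hypothesis N0 : (0 <= N)%R.
Hypothesis opN : operator_bound p q mu k N.

(** By [tail_mass_kernel_pow_le] a tail of mu is null as soon as it starts at a
    point where ph is infinite, and finite where ph is positive. These two facts
    make the truncations exhaust mu. *)
Lemma measure_kernel_pow_infty (E : set R) : measurable E ->
  (forall x, E x -> kernel_pow p' k x = +oo) -> mu E = 0.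
Proof.
move=> mE Eoo; apply/eqP; rewrite eq_le measure_ge0 andbT.
apply: measure_le_of_tails => // t Et.
apply: (@le_trans _ _ (tail_mass mu t)).
  by apply: le_measure; rewrite ?inE//; exact: measurableI.
have := tail_mass_kernel_pow_le hq hqp hk N0 opN t.
rewrite (Eoo _ Et) poweRyr ?gt_eqF ?(qBqp_gt0 hq hqp)//.
have [->//|M0] := eqVneq (tail_mass mu t) 0.
by rewrite gt0_muley// lt0e M0 tail_mass_ge0.
Qed.

Lemma measure_kernel_pow_ge (E : set R) (c : R) : (0 < c)%R -> measurable E ->
  (forall x, E x -> c%:E <= kernel_pow p' k x) -> mu E < +oo.
Proof.
move=> c0 mE Ec; have r0 := qBqp_gt0 hq hqp.
apply: (@le_lt_trans _ _ (N / c `^ (q - q / p))%:E); last exact: ltry.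
apply: measure_le_of_tails => //.
  by rewrite lee_fin divr_ge0 ?powR_ge0.
move=> t Et; apply: (@le_trans _ _ (tail_mass mu t)).
  by apply: le_measure; rewrite ?inE//; exact: measurableI.
rewrite EFinM lee_pdivlMr ?powR_gt0//.
apply: le_trans (tail_mass_kernel_pow_le hq hqp hk N0 opN t).
rewrite lee_wpmul2l ?tail_mass_ge0// -poweR_EFin; apply: le_poweR => //.
- by rewrite lee_fin ltW.
- exact: Ec.
- exact: ltW.
Qed.

End Restriction.

Section LowerTailBound.
Context {R : realType} (p q : R) (hq : 1 < q) (hqp : q < p).
Local Open Scope ereal_scope.
Local Notation RT := (measurableTypeR R).
Local Notation leb := (@lebesgue_measure R).
Local Notation p' := (conj_exp p).
Local Notation b := (p / (p - q))%R.
Local Notation a := (p * (q - 1) / (p - q))%R.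
(** W stands for the right-continuous modification of ph, described by its sandwich
    between the values of ph at x and at larger points, which avoids limits. *)
Variables (mu eta : {measure set RT -> \bar R}) (k : R -> R -> R) (N : R).
Variable W : R -> \bar R.
Hypothesis hk : positive_kernel k.
Hypothesis N0 : (0 <= N)%R.
Hypothesis opN : operator_bound p q mu k N.
Hypothesis etaW : forall y, eta `]-oo, y]%classic = W y.
Local Notation ph := (kernel_pow p' k).
Hypothesis phW : forall x, ph x <= W x.
Hypothesis Wph : forall x y, (x < y)%R -> W x <= ph y.
Hypothesis atoms : forall x, 0 < mu [set x] -> ph x = W x.

Let W0 x : 0 <= W x. Proof. by rewrite -etaW. Qed.

Let ndW : {homo W : x y / (x <= y)%R >-> x <= y}.
Proof.
move=> x y; rewrite le_eqVlt => /predU1P[->//|xy].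
exact: le_trans (Wph xy) (phW y).
Qed.

Let mW : measurable_fun [set: R] W. Proof. exact: nondecreasing_emeasurable. Qed.

Let mph : measurable_fun [set: R] ph.
Proof. by apply: measurable_kernel_pow => //; exact: ltW (conj_exp_gt0 hq hqp). Qed.

(** The open intervals between ph x and W x are disjoint for distinct x, and
    each contains a rational: only countably many x are concerned, and none of
    them is an atom of mu. *)
Let jumps_null : mu [set x | ph x < W x] = 0.
Proof.
pose S (r : rat) := [set x | ph x < (ratr r)%:E < W x].
have S_sub r x y : S r x -> S r y -> x = y.
  move=> /andP[xr rx] /andP[yr ry]; apply/eqP; rewrite eq_le.
  apply/andP; split; rewrite leNgt; apply/negP => /Wph => H.
    by have := lt_trans ry (le_lt_trans H xr); rewrite ltxx.
  by have := lt_trans rx (le_lt_trans H yr); rewrite ltxx.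
have S_null r : mu.-negligible (S r).
  have [->|/set0P[x Sx]] := eqVneq (S r) set0; first exact: negligible_set0.
  have -> : S r = [set x].
    by apply/seteqP; split => y; [move=> Sy; exact: S_sub Sy Sx|move=> /= ->].
  apply/negligibleP => //; apply/eqP; rewrite eq_le measure_ge0 andbT leNgt.
  apply/negP => /atoms E; move: Sx; rewrite /S/= E => /andP[].
  by move=> /lt_trans/[apply]; rewrite ltxx.
have sub : [set x | ph x < W x] `<=`
    \bigcup_n (if unpickle n is Some r then S r else set0).
  move=> x /= phWx.
  have [r Sr] : exists r : rat, S r x.
    rewrite /S/=; have := kernel_pow_ge0 p' k x; move: phWx (W0 x).
    case: (ph x) => [u||]//; case: (W x) => [w||]// uw _ _.
      by have [r] := rat_in_itvoo uw; rewrite in_itv/= => H; exists r.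
    have [r] := rat_in_itvoo (ltr_pwDr ltr01 (lexx u)).
    by rewrite in_itv/= => /andP[H _]; exists r; rewrite lte_fin H ltry.
  by exists (pickle r); [exact: Logic.I|rewrite pickleK; exact: Sr].
have mD : measurable [set x : RT | ph x < W x].
  rewrite -[X in measurable X]setTI; exact: measurable_lte.
apply/(negligibleP _ mD). apply: negligibleS; first exact: sub; apply: negligible_bigcup => n.
by case: (unpickle n) => [r|]; [exact: S_null|exact: negligible_set0].
Qed.

(** Truncation: on A n the measure mu is finite and the integrand of the dual sum is
    bounded; it is cut off by a bound on W, because W and not ph enters the
    integral against eta. *)
Let A n := [set x : RT | (n.+1%:R^-1)%:E <= ph x] `&` [set x : RT | W x <= n.+1%:R%:E]
  `&` [set x : RT | ph x = W x].

Let mA n : measurable (A n).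
Proof.
apply: measurableI; first apply: measurableI.
- rewrite -[X in measurable X]setTI; exact: emeasurable_fun_c_infty.
- rewrite -[X in measurable X]setTI; exact: emeasurable_fun_infty_c.
- rewrite -[X in measurable X]setTI; exact: measurable_eqe.
Qed.

Let Y n := [set x : RT | W x <= n.+1%:R%:E].

Let mY n : measurable (Y n).
Proof. rewrite -[X in measurable X]setTI; exact: emeasurable_fun_infty_c. Qed.

Let muA n : mu (A n) < +oo.
Proof.
apply: (@measure_kernel_pow_ge _ _ _ hq hqp _ _ _ hk N0 opN _ n.+1%:R^-1) => //.
  exact: mA.
by move=> x [[]].
Qed.

Let etaY n : eta (Y n) < +oo.
Proof.
apply: (@le_lt_trans _ _ n.+1%:R%:E); last exact: ltry.
apply: measure_le_of_heads => // [|t Yt]; first exact: mY.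
apply: le_trans Yt; rewrite -etaW.
by apply: le_measure; rewrite ?inE//; apply: measurableI => //; exact: mY.
Qed.

Let mun n : {finite_measure set RT -> \bar R} := mfrestr (mA n) (muA n).
Let etan n : {finite_measure set RT -> \bar R} := mfrestr (mY n) (etaY n).

Let mun_bound n : \int[eta]_x (tail_mass (mun n) x `^ b * W x `^ a) <=
  2%:E `^ b * (2%:E `^ (b - 1) * N%:E) `^ b.
Proof.
have a0 := alpha_gt0 hq hqp; have b1 := betaB1_gt0 hq hqp.
have mM : measurable_fun [set: R] (tail_mass (mun n)) by exact: measurable_tail_mass.
have mMb r : measurable_fun [set: R] (fun x => tail_mass (mun n) x `^ r).
  exact: measurable_fun_poweR.
have mWr r : measurable_fun [set: R] (fun x => W x `^ r) by exact: measurable_fun_poweR.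
have Moff x : ~ Y n x -> tail_mass (mun n) x = 0.
  move=> nY; transitivity (mu (`[x, +oo[ `&` A n)) => //.
  rewrite (_ : _ `&` _ = set0) ?measure0//; apply/seteqP; split => // y [] /=.
  rewrite in_itv/= andbT => xy [[_ Wy] _]; apply: nY.
  exact: le_trans (ndW xy) Wy.
have -> : \int[eta]_x (tail_mass (mun n) x `^ b * W x `^ a) =
          \int[etan n]_x (tail_mass (mun n) x `^ b * W x `^ a).
  rewrite [RHS](@ge0_integral_mrestr _ _ _ eta _ (mY n))//; last 2 first.
  - by apply: emeasurable_funM; [exact: mMb|exact: mWr].
  - by move=> x; rewrite mule_ge0 ?poweR_ge0.
  rewrite [RHS]integral_mkcond; apply: eq_integral => x _; rewrite patchE.
  case: ifPn => // /negP; rewrite inE => /Moff ->.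
  by rewrite poweR0r ?mul0e// gt_eqF// (beta_gt0 hq hqp).
apply: le_trans (integral_tail_le_dual_sum hq hqp (mun n) ndW W0 _) _.
  move=> y; rewrite -etaW; apply: le_measure; rewrite ?inE//; exact: measurableI.
rewrite lee_wpmul2l ?poweR_ge0//.
have mWph r : \int[mun n]_y (tail_mass (mun n) y `^ (b - 1) * W y `^ r) =
    \int[mun n]_y (tail_mass (mun n) y `^ (b - 1) * ph y `^ r).
  have mphr : measurable_fun [set: R] (fun x => ph x `^ r) by exact: measurable_fun_poweR.
  rewrite [LHS](@ge0_integral_mrestr _ _ _ mu _ (mA n))//; last 2 first.
  - by apply: emeasurable_funM; [exact: mMb|exact: mWr].
  - by move=> x; rewrite mule_ge0 ?poweR_ge0.
  rewrite [RHS](@ge0_integral_mrestr _ _ _ mu _ (mA n))//; last 2 first.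
  - by apply: emeasurable_funM; [exact: mMb|exact: mphr].
  - by move=> x; rewrite mule_ge0 ?poweR_ge0.
  by apply: eq_integral => x; rewrite inE => -[_ ->].
rewrite mWph; apply: (dual_sum_le hq hqp hk N0); first exact: operator_bound_mrestr.
rewrite -mWph (@ge0_integral_mrestr _ _ _ mu _ (mA n))//; last 2 first.
- by apply: emeasurable_funM; [exact: mMb|exact: mWr].
- by move=> x; rewrite mule_ge0 ?poweR_ge0.
pose c : \bar R := mu (A n) `^ (b - 1) * n.+1%:R%:E `^ (a + 1).
have coo : c < +oo.
  apply: lte_mul_pinfty; first exact: poweR_ge0.
    by rewrite fin_num_poweR// ge0_fin_numE.
  by rewrite poweR_lty// ltry.
apply: (@le_lt_trans _ _ (\int[mu]_(x in A n) cst c x)).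
  apply: ge0_le_integral => //.
  - by move=> x _; rewrite mule_ge0 ?poweR_ge0.
  - by apply: measurable_funTS; apply: emeasurable_funM; [exact: mMb|exact: mWr].
  move=> x [[_ Wx] _]; apply: lee_pmul; rewrite ?poweR_ge0//; apply: le_poweR => //.
  - apply: (@le_measure _ _ _ mu); rewrite ?inE; do ?[exact: mA|exact: subIsetr].
    by apply: measurableI => //; exact: mA.
  - exact: ltW.
  - by rewrite addr_ge0 // ltW.
rewrite integral_cst//=; apply: lte_mul_pinfty => //.
- by rewrite mule_ge0 ?poweR_ge0.
- by rewrite ge0_fin_numE// mule_ge0 ?poweR_ge0.
Qed.

Let A_nd n : A n `<=` A n.+1.
Proof.
move=> x [[phx Wx] phWx]; split => //; split; rewrite /=.
  by apply: le_trans phx; rewrite lee_fin lef_pV2 ?posrE// ler_nat.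
by apply: (le_trans Wx); rewrite lee_fin ler_nat.
Qed.

Let mun_nd n x : tail_mass (mun n) x <= tail_mass (mun n.+1) x.
Proof.
apply: (@le_measure _ _ _ mu); rewrite ?inE; do ?exact: measurableI.
by apply: setIS; exact: A_nd.
Qed.

(** The sets A n exhaust the line up to the points where ph is infinite or differs
    from W, which form a mu-null set, and up to those where ph vanishes. The latter
    do not matter at x with W(x) > 0: then W is positive on [x,oo). *)
Lemma lower_tail_bound : \int[eta]_x (tail_mass mu x `^ b * W x `^ a) <=
  2%:E `^ b * (2%:E `^ (b - 1) * N%:E) `^ b.
Proof.
have a0 := alpha_gt0 hq hqp; have b0 := beta_gt0 hq hqp.
have mMb m r : measurable_fun [set: R] (fun x => tail_mass m x `^ r).
  by apply: measurable_fun_poweR; exact: measurable_tail_mass.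
have mWr r : measurable_fun [set: R] (fun x => W x `^ r) by exact: measurable_fun_poweR.
apply: (@ge0_integral_le_nd _ _ _ eta _
  (fun n x => tail_mass (mun n) x `^ b * W x `^ a)) => //.
- by apply: emeasurable_funM; [exact: mMb|exact: mWr].
- by move=> x; rewrite mule_ge0 ?poweR_ge0.
- by move=> n; apply: emeasurable_funM; [exact: mMb|exact: mWr].
- by move=> n x; rewrite mule_ge0 ?poweR_ge0.
- move=> x; apply/nondecreasing_seqP => n; rewrite lee_wpmul2r ?poweR_ge0//.
  by apply: le_poweR; [exact: tail_mass_ge0|exact: mun_nd|exact: ltW].
move=> x c Mc.
have c0 : 0 <= c by apply: le_trans (Mc 0%N); rewrite mule_ge0 ?poweR_ge0.
have [Wx0|Wx0] := eqVneq (W x) 0.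
  by rewrite Wx0 (poweR0r (lt0r_neq0 a0)) mule0.
have Wxgt0 : 0 < W x by rewrite lt0e Wx0 W0.
have bV : (b * b^-1 = 1)%R by rewrite mulfV// gt_eqF.
have Vb : (b^-1 * b = 1)%R by rewrite mulVf// gt_eqF.
have E (M : \bar R) : 0 <= M -> M `^ b * W x `^ a = (M * W x `^ (a * b^-1)) `^ b.
  by move=> M0; rewrite poweRM ?poweR_ge0// -poweRrM (divfK (lt0r_neq0 b0)).
rewrite E ?tail_mass_ge0// -[leRHS](poweRrK c0 Vb).
apply: le_poweR; [by rewrite mule_ge0 ?poweR_ge0 ?tail_mass_ge0| |exact: ltW].
have mXA : measurable (\bigcup_n (`[x, +oo[%classic `&` A n)).
  by apply: bigcupT_measurable => n; apply: measurableI => //; exact: mA.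
have cvM : tail_mass (mun n) x @[n --> \oo] --> mu (\bigcup_n (`[x, +oo[%classic `&` A n)).
  apply: (@nondecreasing_cvg_mu _ _ _ mu (fun n => `[x, +oo[%classic `&` A n)) => //.
  - by move=> n; apply: measurableI => //; exact: mA.
  - by apply/nondecreasing_seqP => n; rewrite subsetEset; apply: setIS; exact: A_nd.
apply: (@le_trans _ _ (mu (\bigcup_n (`[x, +oo[%classic `&` A n)) * W x `^ (a * b^-1))).
  rewrite lee_wpmul2r ?poweR_ge0//.
  pose P := [set y : RT | ph y = +oo].
  pose D := [set y : RT | ph y < W y].
  have mP : measurable P by rewrite -[X in measurable X]setTI; exact: measurable_eqe.
  have mD : measurable D by rewrite -[X in measurable X]setTI; exact: measurable_lte.
  have P0 : mu P = 0 by exact: (measure_kernel_pow_infty hq hqp hk N0 opN mP).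
  rewrite -[leRHS]adde0 -P0 -[in leRHS](adde0 (mu P)) -jumps_null -/D.
  apply: (@le_trans _ _ (mu (\bigcup_n (`[x, +oo[%classic `&` A n) `|` (P `|` D)))).
    apply: le_measure; rewrite ?inE//; first by apply: measurableU => //; exact: measurableU.
    move=> y xy; have [phy|phWy] := eqVneq (ph y) (W y); last first.
      by right; right; rewrite /D/= lt_neqAle phWy phW.
    have [phoo|phfin] := eqVneq (ph y) +oo; first by right; left.
    have phgt0 : 0 < ph y.
      by rewrite phy; apply: lt_le_trans Wxgt0 _; apply: ndW; move: xy; rewrite /= in_itv/= andbT.
    left; have phn : ph y \is a fin_num by rewrite ge0_fin_numE ?kernel_pow_ge0// ltey.
    have fph : (0 < fine (ph y))%R by rewrite fine_gt0// phgt0 ltey.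
    pose n := maxn (Num.bound (fine (ph y))) (Num.bound (fine (ph y))^-1).
    exists n => //; split => //; split; last by [].
    split => /=.
      rewrite -(fineK phn) lee_fin invf_ple ?posrE//.
      apply: (le_trans (ltW (archi_boundP _))); first by rewrite invr_ge0 ltW.
      by rewrite ler_nat leqW// leq_maxr.
    rewrite -phy -(fineK phn) lee_fin; apply: (le_trans (ltW (archi_boundP (ltW fph)))).
    by rewrite ler_nat leqW// leq_maxl.
  apply: (le_trans (measureU2 _ _ _)) => //; first exact: measurableU.
  by rewrite leeD2l//; exact: measureU2.
apply: (@nd_cvg_mule_le _ (fun n => tail_mass (mun n) x) (cst (W x `^ (a * b^-1)))) => //.
- by move=> n; exact: poweR_ge0.
- by apply/nondecreasing_seqP => n; exact: mun_nd.
- exact: cvg_cst.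
- move=> n; apply: (@lee_poweRV _ _ _ b) => //; rewrite ?poweR_ge0//.
    by rewrite mule_ge0 ?poweR_ge0 ?tail_mass_ge0.
  by rewrite -E ?tail_mass_ge0// (poweRrK c0 Vb).
Qed.

End LowerTailBound.

(** * The lower bound by the split kernel *)

Section LowerSplit.
Context {R : realType} (p q : R) (hq : 1 < q) (hqp : q < p).
Local Open Scope ereal_scope.
Local Notation RT := (measurableTypeR R).
Local Notation leb := (@lebesgue_measure R).
Local Notation p' := (conj_exp p).
Local Notation b := (p / (p - q))%R.
Local Notation a := (p * (q - 1) / (p - q))%R.
Variables (kap : R -> R -> R) (g : R -> R).
Hypothesis mkap : measurable_fun (setT : set (RT * RT)) (fun z => kap z.1 z.2).
Hypothesis kap0 : forall x s, (0 <= kap x s)%R.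
Hypothesis kap_anti : forall x s t, (0 < s)%R -> (s <= t)%R -> (kap x t <= kap x s)%R.
Hypothesis g_neg : forall s, (s <= 0)%R -> g s = 0%R.

Let mkapq z : measurable_fun [set: R] (fun x => (kap x z)%:E `^ q).
Proof.
apply: measurable_fun_poweR; apply/measurable_EFinP.
exact: (measurableT_comp mkap (pair2_measurable z)).
Qed.

(** U and G in the integrand of the functional of the split kernel. *)
Definition kernel_tail (m : {measure set RT -> \bar R}) (z : R) : \bar R :=
  \int[m]_x ((kap x z)%:E `^ q).

Definition head_pow (w : R -> R) (z : R) : \bar R :=
  \int[leb]_(s in `]-oo, z]) ((w s)%:E `^ p').

Lemma kernel_tail_anti m s t : (0 < s)%R -> (s <= t)%R ->
  kernel_tail m t <= kernel_tail m s.
Proof.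
have [q0 p0 p10 pq0 q10] := exponent_gt0 hq hqp.
move=> s0 st; apply: ge0_le_integral => //.
- by move=> x _; exact: poweR_ge0.
- exact: mkapq.
- exact: mkapq.
- by move=> x _; apply: le_poweR; rewrite ?lee_fin ?kap0 ?kap_anti// ltW.
Qed.

(** V and gn stand for truncations of kernel_tail mu and of g. *)
Section Finite.
Variables (mu : {finite_measure set RT -> \bar R}) (N : R).
Hypothesis N0 : (0 <= N)%R.
Hypothesis hk : positive_kernel (fun x s => (kap x s * g s)%R).
Hypothesis opN : operator_bound p q mu (fun x s => (kap x s * g s)%R) N.
Variables (V : R -> \bar R) (gn : R -> R).
Hypothesis mV : measurable_fun [set: R] V.
Hypothesis V0 : forall z, 0 <= V z.
Hypothesis V_anti : forall s t, (0 < s)%R -> (s <= t)%R -> V t <= V s.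
Hypothesis VU : forall z, V z <= kernel_tail mu z.
Hypothesis mgn : measurable_fun [set: R] gn.
Hypothesis gn0 : forall s, (0 <= gn s)%R.
Hypothesis gng : forall s, (gn s <= g s)%R.

(** The test function f = (V^b G^a gn^p')^(1/p) has int f^p = S. With ww = gn f and
    H its integral over (-oo,s], antitonicity of kap in its second variable gives
    kap(x,s) H(s) <= P(x) = int kap(x,t) ww(t) dt, hence
    int kap^q H^(q-1) ww <= P^q, and Fubini turns the mu-integral of the left-hand
    side into int U H^(q-1) ww. Finally H^(q-1) ww is bounded below by means of the
    tail lemma, applied to the heads of gn^p'. *)
Lemma split_sum_le :
  let S := \int[leb]_z (V z `^ b * head_pow gn z `^ a * (gn z)%:E `^ p') in
  S < +oo -> S <= (2%:E `^ ((a / p + 1) * (q - 1)) * N%:E) `^ b.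
Proof.
move=> S Soo.
have [q0 p0 p10 pq0 q10] := exponent_gt0 hq hqp.
have [[p'0 a0] b0] := (conj_exp_gt0 hq hqp, alpha_gt0 hq hqp, beta_gt0 hq hqp).
have qp0 := qdivp_gt0 hq hqp.
have pi0 : (0 < p^-1)%R by rewrite invr_gt0.
have ap0 : (0 < a / p)%R by rewrite divr_gt0.
pose w t := (gn t)%:E `^ p'.
have w0 t : 0 <= w t by exact: poweR_ge0.
have mw : measurable_fun [set: R] w.
  by apply: measurable_fun_poweR; exact/measurable_EFinP.
pose G := head_pow gn.
have G0 z : 0 <= G z by apply: integral_ge0 => s _; exact: w0.
have mG : measurable_fun [set: R] G by exact: (measurable_head leb mw w0).
have gn_neg t : (t <= 0)%R -> gn t = 0%R.
  by move=> t0; apply/eqP; rewrite eq_le gn0 andbT -(g_neg t0) gng.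
have w_neg t : (t <= 0)%R -> w t = 0.
  by move=> t0; rewrite /w gn_neg// poweR0r// gt_eqF.
pose f z := (V z `^ b * G z `^ a * w z) `^ p^-1.
have f0 z : 0 <= f z by exact: poweR_ge0.
have mVr r : measurable_fun [set: R] (fun z => V z `^ r) by exact: measurable_fun_poweR.
have mGr r : measurable_fun [set: R] (fun z => G z `^ r) by exact: measurable_fun_poweR.
have mf : measurable_fun [set: R] f.
  apply: measurable_fun_poweR; apply: emeasurable_funM => //.
  by apply: emeasurable_funM; [exact: mVr|exact: mGr].
have fp : \int[leb]_z (f z `^ p) = S.
  apply: eq_integral => z _; rewrite poweRrK ?mulVf ?gt_eqF//.
  by rewrite !mule_ge0 ?poweR_ge0.
pose ww t := (gn t)%:E * f t.
have ww0 t : 0 <= ww t by rewrite mule_ge0// lee_fin.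
have mww : measurable_fun [set: R] ww.
  by apply: emeasurable_funM => //; exact/measurable_EFinP.
have wwE t : ww t = V t `^ (b / p) * G t `^ (a / p) * w t.
  rewrite /ww /f !poweRM ?mule_ge0 ?poweR_ge0// -!poweRrM muleCA; congr (_ * _).
  rewrite /w [in RHS](conj_expD1 hq hqp) addrC ge0_poweRD ?ler01//.
    by rewrite poweRe1// lee_fin.
  by rewrite ltW// mulr_gt0.
have ww_neg t : (t <= 0)%R -> ww t = 0 by move=> t0; rewrite wwE w_neg// mule0.
pose H s := \int[leb]_(t in `]-oo, s]) ww t.
have H0 s : 0 <= H s by exact: integral_ge0.
have mH : measurable_fun [set: R] H by exact: (measurable_head leb mww ww0).
have H_ge s : V s `^ (b / p) * G s `^ (a / p + 1) <= 2%:E `^ (a / p + 1) * H s.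
  apply: (@le_trans _ _ (V s `^ (b / p) * (2%:E `^ (a / p + 1) *
      \int[leb]_(t in `]-oo, s]) (G t `^ (a / p) * w t)))).
    by rewrite lee_wpmul2l ?poweR_ge0//; apply: poweR_head_le; rewrite // ltW.
  rewrite muleCA lee_wpmul2l ?poweR_ge0// -ge0_integralZl ?poweR_ge0//; last 2 first.
  - by apply: measurable_funTS; apply: emeasurable_funM; [exact: mGr|].
  - by move=> t _; rewrite mule_ge0 ?poweR_ge0.
  apply: ge0_le_integral => //.
  - by move=> t _; rewrite !mule_ge0 ?poweR_ge0.
  - apply: measurable_funTS; apply: measurable_funeM.
    by apply: emeasurable_funM; [exact: mGr|].
  - exact: measurable_funTS.
  move=> t; rewrite /= in_itv/= => ts; rewrite wwE muleA.
  have [t0|t0] := leP t 0%R; first by rewrite w_neg// !mule0.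
  rewrite lee_wpmul2r// lee_wpmul2r ?poweR_ge0//; apply: le_poweR => //.
    exact: V_anti.
  by rewrite ltW// divr_gt0.
pose k x s := (kap x s * g s)%R.
pose P x := \int[leb]_s ((kap x s)%:E * ww s).
have mkapx x : measurable_fun [set: R] (fun s => (kap x s)%:E).
  by apply/measurable_EFinP; exact: (measurableT_comp mkap (pair1_measurable x)).
have mkw x : measurable_fun [set: R] (fun s => (kap x s)%:E * ww s).
  exact: emeasurable_funM.
have kw0 x s : 0 <= (kap x s)%:E * ww s by rewrite mule_ge0// lee_fin.
have P0 x : 0 <= P x by exact: integral_ge0.
have Pop x : P x <= kernel_op k f x.
  apply: ge0_le_integral => //.
  - exact: mkw.
  - apply: emeasurable_funM => //; apply/measurable_EFinP.
    exact: (kernel_section_meas x hk).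
  - move=> s _; rewrite /ww /k EFinM -muleA lee_wpmul2l ?lee_fin//.
    by rewrite lee_wpmul2r// lee_fin.
have kHP x s : (0 < s)%R -> (kap x s)%:E * H s <= P x.
  move=> s0; rewrite /H -ge0_integralZl ?lee_fin//; last exact: measurable_funTS.
  apply: (@le_trans _ _ (\int[leb]_(t in `]-oo, s]) ((kap x t)%:E * ww t))).
    apply: ge0_le_integral => //.
    - by move=> t _; rewrite mule_ge0// lee_fin.
    - by apply: measurable_funTS; exact: measurable_funeM.
    - by apply: measurable_funTS; exact: mkw.
    - move=> t; rewrite /= in_itv/= => ts.
      have [t0|t0] := leP t 0%R; first by rewrite ww_neg// !mule0.
      by rewrite lee_wpmul2r// lee_fin kap_anti.
  apply: ge0_subset_integral; [exact: measurable_itv|exact: measurableT|exact: mkw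
    |by move=> t _; exact: kw0|exact: subsetT].
pose F x s := (kap x s)%:E `^ q * (H s `^ (q - 1) * ww s).
have Hw0 s : 0 <= H s `^ (q - 1) * ww s by apply: mule_ge0; [exact: poweR_ge0|exact: ww0].
have F0 x s : 0 <= F x s by apply: mule_ge0; [exact: poweR_ge0|exact: Hw0].
have mHw : measurable_fun [set: R] (fun s => H s `^ (q - 1) * ww s).
  by apply: emeasurable_funM => //; exact: measurable_fun_poweR.
have mF : measurable_fun (setT : set (RT * RT)) (fun z => F z.1 z.2).
  apply: emeasurable_funM; last exact: (@measurable_snd_comp _ (fun s => H s `^ (q - 1) * ww s)).
  by apply: measurable_fun_poweR; exact/measurable_EFinP.
have FP x : \int[leb]_s F x s <= P x `^ q.
  have -> : P x `^ q = P x `^ (q - 1) * P x.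
    by rewrite -[in RHS](poweRe1 (P0 x)) -poweRrM mul1r -ge0_poweRD ?ltW// subrK.
  rewrite -ge0_integralZl; [|exact: measurableT|exact: mkw|by move=> s _; exact: kw0
    |exact: poweR_ge0].
  apply: ge0_le_integral; first exact: measurableT.
  - by move=> s _; exact: F0.
  - exact: (measurableT_comp mF (pair1_measurable x)).
  - by apply: measurable_funeM; exact: mkw.
  move=> s _; rewrite /F; have [s0|s0] := leP s 0%R.
    by rewrite ww_neg// !mule0.
  have -> : (kap x s)%:E `^ q = (kap x s)%:E `^ (q - 1) * (kap x s)%:E.
    rewrite -[X in _ = _ * X](@poweRe1 _ (kap x s)%:E) ?lee_fin//.
    by rewrite -ge0_poweRD ?ltW// subrK.
  have -> : (kap x s)%:E `^ (q - 1) * (kap x s)%:E * (H s `^ (q - 1) * ww s) =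
      ((kap x s)%:E * H s) `^ (q - 1) * ((kap x s)%:E * ww s).
    by rewrite poweRM ?lee_fin// muleACA.
  apply: lee_wpmul2r; first exact: kw0.
  by apply: le_poweR; [rewrite mule_ge0// lee_fin|exact: kHP|exact: ltW].
have mop : measurable_fun [set: R] (kernel_op k f) by exact: measurable_kernel_op.
have mU : measurable_fun [set: R] (kernel_tail mu).
  apply: (@measurable_integral_fst _ mu (fun z x => (kap x z)%:E `^ q)).
    apply: measurable_fun_poweR; apply/measurable_EFinP.
    exact: (measurableT_comp mkap (measurable_fun_pair measurable_snd measurable_fst)).
  by move=> z x; exact: poweR_ge0.
have U0 z : 0 <= kernel_tail mu z by apply: integral_ge0 => x _; exact: poweR_ge0.
have swap : \int[mu]_x \int[leb]_s F x s =
    \int[leb]_s (kernel_tail mu s * (H s `^ (q - 1) * ww s)).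
  rewrite ge0_integral_iterated; [|exact: mF|exact: F0].
  apply: eq_integral => s _; rewrite ge0_integralZr; [by []|exact: measurableT
    |exact: mkapq|by move=> x _; exact: poweR_ge0|exact: Hw0].
pose C := 2%:E `^ ((a / p + 1) * (q - 1)) : \bar R.
have C0 : 0 <= C by exact: poweR_ge0.
have pt s : V s `^ b * G s `^ a * w s <= C * (kernel_tail mu s * (H s `^ (q - 1) * ww s)).
  apply: (@le_trans _ _ (C * (V s * (H s `^ (q - 1) * ww s)))); last first.
    apply: lee_wpmul2l; first exact: C0.
    by apply: lee_wpmul2r; [exact: Hw0|exact: VU].
  have -> : C * (V s * (H s `^ (q - 1) * ww s)) =
      (2%:E `^ (a / p + 1) * H s) `^ (q - 1) * (V s * ww s).
    by rewrite poweRM ?poweR_ge0// -poweRrM -/C -[RHS]muleA; congr (C * _); exact: muleCA.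
  apply: (@le_trans _ _ ((V s `^ (b / p) * G s `^ (a / p + 1)) `^ (q - 1) * (V s * ww s))); last first.
    apply: lee_wpmul2r; first by apply: mule_ge0; [exact: V0|exact: ww0].
    by apply: le_poweR; [rewrite mule_ge0 ?poweR_ge0|exact: H_ge|exact: ltW].
  have bp0 : (0 <= b / p)%R by rewrite ltW// divr_gt0.
  have ap1 : (0 <= a / p + 1)%R by rewrite addr_ge0// ltW.
  have q1 := ltW q10; have ap2 := ltW ap0.
  have bpq : (0 <= b / p * (q - 1))%R by exact: mulr_ge0.
  have apq : (0 <= (a / p + 1) * (q - 1))%R by exact: mulr_ge0.
  have bp1 : (0 <= 1 + b / p)%R by exact: addr_ge0.
  have [? ? ? ? ?] := exponent_neq0 hq hqp.
  (* b = (b/p)(q-1) + 1 + b/p and a = (a/p+1)(q-1) + a/p *)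
  have Vb : V s `^ b = (V s `^ (b / p)) `^ (q - 1) * (V s * V s `^ (b / p)).
    rewrite -[X in _ = _ * (X * _)](poweRe1 (V0 s)) -poweRrM.
    rewrite -(ge0_poweRD _ ler01 bp0) -(ge0_poweRD _ bpq bp1).
    by congr (_ `^ _); field; apply/andP.
  have Ga : G s `^ a = (G s `^ (a / p + 1)) `^ (q - 1) * G s `^ (a / p).
    rewrite -poweRrM -(ge0_poweRD _ apq ap2).
    by congr (_ `^ _); field; apply/andP.
  rewrite wwE Vb Ga poweRM ?poweR_ge0//.
  move: (V s `^ (b / p)) (G s `^ (a / p + 1)) (G s `^ (a / p)) => X Y Z.
  by rewrite muleACA -!muleA.
have key : S <= C * \int[mu]_x (kernel_op k f x `^ q).
  apply: (@le_trans _ _ (C * \int[leb]_s (kernel_tail mu s * (H s `^ (q - 1) * ww s)))).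
    rewrite -ge0_integralZl; [|exact: measurableT|exact: emeasurable_funM
      |by move=> s _; apply: mule_ge0; [exact: U0|exact: Hw0]|exact: C0].
    apply: ge0_le_integral; first exact: measurableT.
    - by move=> s _; rewrite !mule_ge0 ?poweR_ge0.
    - apply: emeasurable_funM => //.
      by apply: emeasurable_funM; [exact: mVr|exact: mGr].
    - by apply: measurable_funeM; exact: emeasurable_funM.
    - by move=> s _; exact: pt.
  apply: lee_wpmul2l; first exact: C0.
  rewrite -swap; apply: ge0_le_integral; first exact: measurableT.
  - by move=> x _; apply: integral_ge0 => s _; exact: F0.
  - by apply: measurable_integral_fst; [exact: mF|exact: F0].
  - by apply: measurable_fun_poweR.
  - move=> x _; apply: (le_trans (FP x)).
    by apply: le_poweR; [exact: P0|exact: Pop|exact: ltW].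
have := opN mf f0; rewrite fp => /(_ Soo) opS.
have := @absorb_poweR _ S (C * N%:E) (q / p)%R ((p - q) / p)%R.
rewrite beta_invE; apply => //.
- by apply: integral_ge0 => s _; rewrite !mule_ge0 ?poweR_ge0.
- by rewrite mule_ge0.
- exact: divr_gt0.
- exact: beta_inv hq hqp.
- exact: ltW.
- apply: (le_trans key); rewrite -muleA.
  by apply: lee_wpmul2l; [exact: C0|exact: opS].
Qed.

End Finite.
End LowerSplit.

Section LowerSplitBound.
Context {R : realType} (p q : R) (hq : 1 < q) (hqp : q < p).
Local Open Scope ereal_scope.
Local Notation RT := (measurableTypeR R).
Local Notation leb := (@lebesgue_measure R).
Local Notation p' := (conj_exp p).
Local Notation b := (p / (p - q))%R.
Local Notation a := (p * (q - 1) / (p - q))%R.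
Variables (kap : R -> R -> R) (g : R -> R).
Hypothesis mkap : measurable_fun (setT : set (RT * RT)) (fun z => kap z.1 z.2).
Hypothesis kap0 : forall x s, (0 <= kap x s)%R.
Hypothesis kap_anti : forall x s t, (0 < s)%R -> (s <= t)%R -> (kap x t <= kap x s)%R.
Hypothesis mg : measurable_fun [set: R] g.
Hypothesis g0 : forall s, (0 <= g s)%R.
Hypothesis g_neg : forall s, (s <= 0)%R -> g s = 0%R.
Variables (mu : {measure set RT -> \bar R}) (N : R).
Hypothesis N0 : (0 <= N)%R.
Let k x s := (kap x s * g s)%R.
Hypothesis hk : positive_kernel k.
Hypothesis opN : operator_bound p q mu k N.
Local Notation ph := (kernel_pow p' k).
Local Notation U := (kernel_tail q kap).

Let p'0 : (0 < p')%R. Proof. exact: conj_exp_gt0 hq hqp. Qed.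

Let mph : measurable_fun [set: R] ph.
Proof. by apply: measurable_kernel_pow => //; exact: ltW. Qed.

(** Truncation: mu is restricted to a set where it is finite, U is capped at n, and
    g is cut off where it or its argument is large. *)
Let E n := [set x : RT | (n.+1%:R^-1)%:E <= ph x] `&` [set x : RT | ph x <= n.+1%:R%:E].

Let mE n : measurable (E n).
Proof.
apply: measurableI; rewrite -[X in measurable X]setTI.
- exact: emeasurable_fun_c_infty.
- exact: emeasurable_fun_infty_c.
Qed.

Let muE n : mu (E n) < +oo.
Proof.
apply: (@measure_kernel_pow_ge _ _ _ hq hqp _ _ _ hk N0 opN _ n.+1%:R^-1) => //.
  exact: mE.
by move=> x [].
Qed.

Let mun n : {finite_measure set RT -> \bar R} := mfrestr (mE n) (muE n).

Let E_nd n : E n `<=` E n.+1.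
Proof.
move=> x [phx xph]; split; rewrite /=.
  by apply: le_trans phx; rewrite lee_fin lef_pV2 ?posrE// ler_nat.
by apply: (le_trans xph); rewrite lee_fin ler_nat.
Qed.

Let c n s := ((g s <= n%:R) && (`|s| <= n%:R))%R.
Let gn n s := if c n s then g s else 0%R.

Let mgn n : measurable_fun [set: R] (gn n).
Proof.
apply: measurable_fun_ifT => //; apply: measurable_and; apply: measurable_fun_ler => //.
Qed.

Let gn0 n s : (0 <= gn n s)%R. Proof. by rewrite /gn; case: ifP. Qed.
Let gng n s : (gn n s <= g s)%R. Proof. by rewrite /gn; case: ifP. Qed.
Let gn_nd n s : (gn n s <= gn n.+1 s)%R.
Proof.
rewrite /gn; case: ifPn => [/andP[cn sn]|_]; last by case: ifP.
by rewrite ifT// /c (le_trans cn) ?ler_nat// (le_trans sn)// ler_nat.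
Qed.
Let gn_ev s : exists n, gn n s = g s.
Proof.
exists (maxn (Num.bound (g s)) (Num.bound `|s|)); rewrite /gn ifT// /c.
apply/andP; split.
  by rewrite (le_trans (ltW (archi_boundP (g0 s))))// ler_nat; exact: leq_maxl.
by rewrite (le_trans (ltW (archi_boundP (normr_ge0 s))))// ler_nat; exact: leq_maxr.
Qed.

Let mkapq z : measurable_fun [set: R] (fun x => (kap x z)%:E `^ q).
Proof.
apply: measurable_fun_poweR; apply/measurable_EFinP.
exact: (measurableT_comp mkap (pair2_measurable z)).
Qed.

Let mU (m : {sigma_finite_measure set RT -> \bar R}) : measurable_fun [set: R] (U m).
Proof.
apply: (@measurable_integral_fst _ m (fun z x => (kap x z)%:E `^ q)).
  apply: measurable_fun_poweR; apply/measurable_EFinP.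
  exact: (measurableT_comp mkap (measurable_fun_pair measurable_snd measurable_fst)).
by move=> z x; exact: poweR_ge0.
Qed.

Let U0 m z : 0 <= U m z. Proof. by apply: integral_ge0 => x _; exact: poweR_ge0. Qed.

Let UE n z : U (mun n) z = \int[mu]_(x in E n) ((kap x z)%:E `^ q).
Proof.
apply: (@ge0_integral_mrestr _ _ _ mu _ (mE n)); first exact: mkapq.
by move=> x; exact: poweR_ge0.
Qed.

Let V n z := mine (U (mun n) z) n%:R%:E.

Let V0 n z : 0 <= V n z. Proof. by rewrite le_min U0 lee_fin ler0n. Qed.

Let V_nd n z : V n z <= V n.+1 z.
Proof.
rewrite /V le_min !ge_min; apply/andP; split.
  apply/orP; left; rewrite !UE; apply: ge0_subset_integral; [exact: mE|exact: mE
    |exact: measurable_funTS (mkapq z)|by move=> x _; exact: poweR_ge0|exact: E_nd].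
by apply/orP; right; rewrite lee_fin ler_nat.
Qed.

Let mw (w : R -> R) : measurable_fun [set: R] w ->
  measurable_fun [set: R] (fun s => (w s)%:E `^ p').
Proof. by move=> m; apply: measurable_fun_poweR; exact/measurable_EFinP. Qed.

Let head_pow0 (w : R -> R) z : 0 <= head_pow p w z.
Proof. by apply: integral_ge0 => s _; exact: poweR_ge0. Qed.

Let mhead (w : R -> R) : measurable_fun [set: R] w -> measurable_fun [set: R] (head_pow p w).
Proof. by move=> m; apply: (measurable_head leb (mw m)) => s; exact: poweR_ge0. Qed.

Let le_w (u w : R -> R) s : (0 <= u s)%R -> (u s <= w s)%R ->
  (u s)%:E `^ p' <= (w s)%:E `^ p'.
Proof. by move=> u0 uw; apply: le_poweR; rewrite ?lee_fin// ltW. Qed.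

Let head_pow_le (u w : R -> R) z : measurable_fun [set: R] u -> measurable_fun [set: R] w ->
  (forall s, 0 <= u s)%R -> (forall s, u s <= w s)%R -> head_pow p u z <= head_pow p w z.
Proof.
move=> mu_ mw_ u0 uw; apply: ge0_le_integral; first exact: measurable_itv.
- by move=> s _; exact: poweR_ge0.
- by apply: measurable_funTS; exact: mw.
- by apply: measurable_funTS; exact: mw.
- by move=> s _; exact: le_w.
Qed.

Let head_pow_lty n z : head_pow p (gn n) z <= (n%:R%:E `^ p') * (2 * n%:R)%:E.
Proof.
apply: (@le_trans _ _ (\int[leb]_(s in `[(- n%:R)%R, n%:R]) cst (n%:R%:E `^ p') s)).
  rewrite /head_pow [leLHS]integral_mkcond [leRHS]integral_mkcond.
  apply: ge0_le_integral; first exact: measurableT.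
  - by move=> s _; apply: erestrict_ge0 => t _; exact: poweR_ge0.
  - apply: (iffLR (measurable_restrictT _ (measurable_itv _))).
    by apply: measurable_funTS; exact: mw.
  - exact: (iffLR (measurable_restrictT _ (measurable_itv _)) (measurable_cst _)).
  move=> s _; rewrite !patchE !mem_setE/= !in_itv/= -ler_norml.
  have [gs|gs] := boolP (c n s); last first.
    have -> : gn n s = 0%R by rewrite /gn (negbTE gs).
    rewrite powR0 ?gt_eqF//; case: ifP => _; case: ifP => // _;
      by rewrite lee_fin powR_ge0.
  have -> : gn n s = g s by rewrite /gn gs.
  case/andP: gs => gns ->.
  case: ifP => _; last by rewrite lee_fin powR_ge0.
  by rewrite lee_fin ge0_ler_powR ?nnegrE// ltW.
rewrite integral_cst//= -!poweR_EFin; apply: lee_wpmul2l; first exact: poweR_ge0.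
rewrite lebesgue_measure_itv/=; case: ifP => _.
  by rewrite -EFinD lee_fin opprK mulr_natl mulr2n.
by rewrite lee_fin mulr_ge0.
Qed.

Let un n z := V n z `^ b * head_pow p (gn n) z `^ a * (gn n z)%:E `^ p'.

Let un_lty n : \int[leb]_z un n z < +oo.
Proof.
have [q0 p0 p10 pq0 q10] := exponent_gt0 hq hqp.
have [a0 b0] := (alpha_gt0 hq hqp, beta_gt0 hq hqp).
pose C : R := ((n%:R `^ b) * ((n%:R `^ p') * (2 * n%:R)) `^ a)%R.
have C0 : (0 <= C)%R by rewrite mulr_ge0 ?powR_ge0.
apply: (@le_lt_trans _ _ (\int[leb]_z (C%:E * ((gn n z)%:E `^ p')))).
  apply: ge0_le_integral; first exact: measurableT.
  - by move=> z _; rewrite !mule_ge0 ?poweR_ge0.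
  - apply: emeasurable_funM; last exact: mw.
    apply: emeasurable_funM; apply: measurable_fun_poweR; last exact: mhead.
    by apply: measurable_mine; [exact: mU|exact: measurable_cst].
  - by apply: measurable_funeM; exact: mw.
  - move=> z _; apply: lee_wpmul2r; first exact: poweR_ge0.
    rewrite /C EFinM; apply: lee_pmul; rewrite ?poweR_ge0// -poweR_EFin.
      by apply: le_poweR; [exact: V0|rewrite ge_min lexx orbT|exact: ltW].
    by apply: le_poweR; [exact: head_pow0|exact: head_pow_lty|exact: ltW].
rewrite ge0_integralZl_EFin; [|exact: measurableT|by move=> z _; exact: poweR_ge0
  |exact: mw|exact: C0].
rewrite lte_mul_pinfty ?lee_fin//.
apply: (@le_lt_trans _ _ (head_pow p (gn n) n%:R)); last first.
  by apply: le_lt_trans (head_pow_lty n n%:R) _; rewrite poweR_EFin -EFinM ltry.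
rewrite /head_pow [leRHS]integral_mkcond; apply: ge0_le_integral; first exact: measurableT.
- by move=> z _; exact: poweR_ge0.
- exact: mw.
- apply: (iffLR (measurable_restrictT _ (measurable_itv _))).
  by apply: measurable_funTS; exact: mw.
- move=> z _; rewrite patchE mem_setE/= in_itv/=; case: ifPn => // zn.
  have -> : gn n z = 0%R.
    rewrite /gn ifF//; apply/negbTE; apply: contra zn => /andP[_].
    exact: le_trans (ler_norm _).
  by rewrite powR0 ?gt_eqF.
Qed.

Let un_bound n : \int[leb]_z un n z <= (2%:E `^ ((a / p + 1) * (q - 1)) * N%:E) `^ b.
Proof.
apply: (@split_sum_le _ _ _ hq hqp _ _ mkap kap0 kap_anti g_neg (mun n) N N0 hk _ (V n) (gn n)).
- exact: (operator_bound_mrestr (mE n) hk opN).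
- by apply: measurable_mine; [exact: mU|exact: measurable_cst].
- exact: V0.
- move=> s t s0 st; rewrite /V le_min !ge_min lexx orbT andbT.
  by rewrite (kernel_tail_anti hq hqp mkap kap0 kap_anti).
- by move=> z; rewrite ge_min lexx.
- exact: mgn.
- exact: gn0.
- exact: gng.
- exact: un_lty.
Qed.

(** If kap(x,z) > 0 then ph(x) >= kap(x,z)^p' G(z) > 0, and ph is finite mu-almost
    everywhere; so the sets E n exhaust the part of mu that is seen by kap(.,z). *)
Let U_le z C : 0 < head_pow p g z -> 0 <= C ->
  (forall n, U (mun n) z <= C) -> U mu z <= C.
Proof.
have [q0 _ _ _ _] := exponent_gt0 hq hqp.
move=> Gz C0 UC.
pose P := [set x : RT | ph x = +oo].
have mP : measurable P by rewrite -[X in measurable X]setTI; exact: measurable_eqe.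
have P0 : mu P = 0 by exact: (measure_kernel_pow_infty hq hqp hk N0 opN mP).
rewrite /kernel_tail (ge0_negligible_integral mP measurableT (mkapq z) _ P0); last first.
  by move=> x _; exact: poweR_ge0.
have mTP : measurable ([set: RT] `\` P) by exact: measurableD.
have mr (D : set RT) : measurable D ->
    measurable_fun [set: R] ((fun x => (kap x z)%:E `^ q) \_ D).
  move=> mD; apply: (iffLR (measurable_restrictT _ mD)).
  exact: (measurable_funTS (mkapq z)).
have r0 (D : set RT) x : 0 <= ((fun x => (kap x z)%:E `^ q) \_ D) x.
  by apply: erestrict_ge0 => y _; exact: poweR_ge0.
rewrite integral_mkcond.
apply: (@ge0_integral_le_nd _ _ _ mu _ (fun n => (fun x => (kap x z)%:E `^ q) \_ (E n))).
- exact: mr.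
- exact: r0.
- by move=> n; apply: mr; exact: mE.
- by move=> n; exact: r0.
- move=> x; apply/nondecreasing_seqP => n; rewrite !patchE.
  case: ifPn => xn; last by case: ifP => // _; exact: poweR_ge0.
  by rewrite ifT// inE; apply: E_nd; rewrite inE in xn.
- move=> x d xd; have d0 : 0 <= d by apply: le_trans (xd 0%N); exact: r0.
  rewrite patchE; case: ifPn => //; rewrite inE => -[_ phoo].
  have [kz|kz] := eqVneq (kap x z) 0%R.
    by rewrite kz poweR0r ?gt_eqF.
  have kzgt0 : (0 < kap x z)%R by rewrite lt_neqAle eq_sym kz kap0.
  have phgt0 : 0 < ph x.
    have : 0 < (kap x z)%:E `^ p' * head_pow p g z by rewrite mule_gt0// poweR_gt0.
    move=> /lt_le_trans; apply.
    rewrite /head_pow -ge0_integralZl; [|exact: measurable_itv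
      |by apply: measurable_funTS; exact: mw|by move=> s _; exact: poweR_ge0|exact: poweR_ge0].
    apply: (@le_trans _ _ (\int[leb]_(s in `]-oo, z]) ((k x s)%:E `^ p'))).
      apply: ge0_le_integral; first exact: measurable_itv.
      - by move=> s _; rewrite mule_ge0 ?poweR_ge0.
      - by apply: measurable_funTS; apply: measurable_funeM; exact: mw.
      - by apply: measurable_funTS; exact: kernel_pow_meas.
      move=> s; rewrite /= in_itv/= => sz; rewrite -EFinM lee_fin -powRM//.
      apply: ge0_ler_powR; [exact: ltW|by rewrite nnegrE mulr_ge0|by rewrite nnegrE mulr_ge0|].
      have [s0|s0] := leP s 0%R; first by rewrite /k g_neg// !mulr0.
      by rewrite /k ler_wpM2r// kap_anti.
    apply: ge0_subset_integral; [exact: measurable_itv|exact: measurableT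
      |exact: kernel_pow_meas|by move=> s _; exact: poweR_ge0|exact: subsetT].
  have phfin : ph x \is a fin_num.
    by rewrite ge0_fin_numE ?kernel_pow_ge0// ltey; apply/eqP.
  have fph : (0 < fine (ph x))%R by rewrite fine_gt0// phgt0 ltey; apply/eqP.
  pose n := maxn (Num.bound (fine (ph x))) (Num.bound (fine (ph x))^-1).
  have En : E n x.
    split; rewrite /= -(fineK phfin) lee_fin.
      rewrite invf_ple ?posrE//.
      apply: (le_trans (ltW (archi_boundP _))); first by rewrite invr_ge0 ltW.
      by rewrite ler_nat leqW// leq_maxr.
    apply: (le_trans (ltW (archi_boundP (ltW fph)))).
    by rewrite ler_nat leqW// leq_maxl.
  by have := xd n; rewrite patchE ifT// inE.
- by move=> n; rewrite -integral_mkcond -UE; exact: UC.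
Qed.

Let head_pow_lub z C : (forall n, head_pow p (gn n) z <= C) -> head_pow p g z <= C.
Proof.
move=> GC; rewrite /head_pow integral_mkcond.
have mr (w : R -> R) : measurable_fun [set: R] w ->
    measurable_fun [set: R] ((fun s => (w s)%:E `^ p') \_ `]-oo, z]).
  move=> m; apply: (iffLR (measurable_restrictT _ (measurable_itv _))).
  by apply: measurable_funTS; exact: mw.
have r0 (w : R -> R) x : 0 <= ((fun s => (w s)%:E `^ p') \_ `]-oo, z]) x.
  by apply: erestrict_ge0 => y _; exact: poweR_ge0.
apply: (@ge0_integral_le_nd _ _ _ leb _
  (fun n => (fun s => (gn n s)%:E `^ p') \_ `]-oo, z])).
- exact: mr.
- exact: r0.
- by move=> n; apply: mr; exact: mgn.
- by move=> n; exact: r0.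
- move=> x; apply/nondecreasing_seqP => n; rewrite !patchE.
  by case: ifP => // _; exact: le_w.
- move=> x d xd; have [n gx] := gn_ev x.
  by have := xd n; rewrite !patchE gx.
- by move=> n; rewrite -integral_mkcond; exact: GC.
Qed.

Let V_cvg z : 0 < head_pow p g z -> V n z @[n --> \oo] --> U mu z.
Proof.
move=> Gz; apply: nd_cvg_lub.
- by apply/nondecreasing_seqP => n; exact: V_nd.
- move=> n; rewrite /V ge_min; apply/orP; left; rewrite UE.
  apply: ge0_subset_integral; [exact: mE|exact: measurableT|exact: mkapq
    |by move=> s _; exact: poweR_ge0|exact: subsetT].
- move=> C VC; have C0 : 0 <= C by apply: le_trans (VC 0%N); exact: V0.
  have [Coo|Coo] := eqVneq C +oo; first by rewrite Coo leey.
  have Cfin : C \is a fin_num by rewrite ge0_fin_numE// ltey.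
  apply: U_le => // n.
  pose m := maxn n (Num.bound (fine C)).+1.
  have Cm : C < m%:R%:E.
    rewrite -(fineK Cfin) lte_fin; apply: (lt_le_trans (archi_boundP _)).
      exact: fine_ge0.
    by rewrite ler_nat; apply: leq_trans (leq_maxr _ _).
  apply: (@le_trans _ _ (U (mun m) z)).
    have nm : (n <= m)%N by exact: leq_maxl.
    rewrite !UE; apply: ge0_subset_integral; [exact: mE|exact: mE
      |exact: measurable_funTS (mkapq z)|by move=> x _; exact: poweR_ge0|].
    have : nondecreasing_seq E.
      by apply/nondecreasing_seqP => i; rewrite subsetEset; exact: E_nd.
    by move=> /(_ _ _ nm); rewrite subsetEset.
  have := VC m; rewrite /V ge_min => /orP[//|/(lt_le_trans Cm)].
  by rewrite ltxx.
Qed.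

Lemma lower_split_bound :
  \int[leb]_z (U mu z `^ b * head_pow p g z `^ a * (g z)%:E `^ p') <=
    (2%:E `^ ((a / p + 1) * (q - 1)) * N%:E) `^ b.
Proof.
have [a0 b0] := (alpha_gt0 hq hqp, beta_gt0 hq hqp).
pose h z := U mu z `^ b * head_pow p g z `^ a * (g z)%:E `^ p'.
have h0 z : 0 <= h z by rewrite !mule_ge0 ?poweR_ge0.
have un0 n z : 0 <= un n z by rewrite !mule_ge0 ?poweR_ge0.
have Vb0 n z : 0 <= V n z `^ b * head_pow p (gn n) z `^ a by rewrite mule_ge0 ?poweR_ge0.
have Vb_nd z : nondecreasing_seq (fun n => V n z `^ b * head_pow p (gn n) z `^ a).
  apply/nondecreasing_seqP => n.
  apply: lee_pmul; [exact: poweR_ge0|exact: poweR_ge0| |]; apply: le_poweR.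
  - exact: V0.
  - exact: V_nd.
  - exact: ltW.
  - exact: head_pow0.
  - by apply: head_pow_le; [exact: mgn|exact: mgn|exact: gn0|exact: gn_nd].
  - exact: ltW.
have un_nd z : nondecreasing_seq (un ^~ z).
  move=> i j ij; apply: lee_pmul; [exact: Vb0|exact: poweR_ge0|exact: Vb_nd|].
  apply: le_w; first exact: gn0.
  have : nondecreasing_seq (gn ^~ z) by apply/nondecreasing_seqP => n; exact: gn_nd.
  exact.
have V_le n z : 0 < head_pow p g z -> V n z <= U mu z.
  move=> Gz; have ndV : nondecreasing_seq (fun n => V n z).
    by apply/nondecreasing_seqP => i; exact: V_nd.
  rewrite -(cvg_lim _ (V_cvg Gz))// (cvg_lim _ (ereal_nondecreasing_cvgn ndV))//.
  by apply: ereal_sup_ubound; exists n.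
have Vh n z : 0 < head_pow p g z -> V n z `^ b * head_pow p (gn n) z `^ a <=
    U mu z `^ b * head_pow p g z `^ a.
  move=> Gz; apply: lee_pmul; [exact: poweR_ge0|exact: poweR_ge0| |]; apply: le_poweR.
  - exact: V0.
  - exact: V_le.
  - exact: ltW.
  - exact: head_pow0.
  - by apply: head_pow_le; [exact: mgn|exact: mg|exact: gn0|exact: gng].
  - exact: ltW.
have un_h n z : 0 < head_pow p g z -> un n z <= h z.
  move=> Gz; apply: lee_pmul; [exact: Vb0|exact: poweR_ge0|exact: Vh|exact: le_w].
have head_cvg z : head_pow p (gn n) z @[n --> \oo] --> head_pow p g z.
  apply: nd_cvg_lub.
  - by apply/nondecreasing_seqP => n; apply: head_pow_le;
      [exact: mgn|exact: mgn|exact: gn0|exact: gn_nd].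
  - by move=> n; apply: head_pow_le; [exact: mgn|exact: mg|exact: gn0|exact: gng].
  - by move=> C; exact: head_pow_lub.
have un_cvg z : un n z @[n --> \oo] --> h z.
  have [Gz0|Gzn0] := eqVneq (head_pow p g z) 0.
    have -> : h z = 0 by rewrite /h Gz0 (poweR0r (lt0r_neq0 a0)) mule0 mul0e.
    have un_0 n : un n z = 0.
      have -> : un n z = V n z `^ b * head_pow p (gn n) z `^ a * (gn n z)%:E `^ p' by [].
      suff -> : head_pow p (gn n) z = 0 by rewrite (poweR0r (lt0r_neq0 a0)) mule0 mul0e.
      apply/eqP; rewrite eq_le head_pow0 andbT -Gz0.
      by apply: head_pow_le; [exact: mgn|exact: mg|exact: gn0|exact: gng].
    by rewrite (_ : un ^~ z = cst 0); [exact: cvg_cst|apply/funext => n; exact: un_0].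
  have Gz : 0 < head_pow p g z by rewrite lt0e Gzn0 head_pow0.
  apply: nd_cvg_lub; [exact: un_nd|by move=> n; exact: un_h|].
  move=> C unC; have [n0 gz] := gn_ev z.
  have C0 : 0 <= C by apply: le_trans (unC 0%N).
  apply: (@nd_cvg_mule_le _ (fun n => V n z `^ b * head_pow p (gn n) z `^ a)
    (fun n => (gn n z)%:E `^ p')).
  - by move=> n; exact: Vb0.
  - by move=> n; exact: poweR_ge0.
  - exact: Vb_nd.
  - by apply/nondecreasing_seqP => n; exact: le_w.
  - apply: nd_cvg_lub; first exact: Vb_nd.
      by move=> n; exact: Vh.
    move=> D; apply: nd_cvg_mule_le.
    + by move=> n; exact: poweR_ge0.
    + by move=> n; exact: poweR_ge0.
    + apply/nondecreasing_seqP => n; apply: le_poweR; [exact: V0|exact: V_nd|exact: ltW].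
    + apply/nondecreasing_seqP => n; apply: le_poweR; [exact: head_pow0| |exact: ltW].
      by apply: head_pow_le; [exact: mgn|exact: mgn|exact: gn0|exact: gn_nd].
    + apply: nd_cvg_poweR => //; last exact: V_cvg.
      by apply/nondecreasing_seqP => n; exact: V_nd.
    + apply: nd_cvg_poweR => //.
      by apply/nondecreasing_seqP => n; apply: head_pow_le;
        [exact: mgn|exact: mgn|exact: gn0|exact: gn_nd].
  - apply: nd_cvg_lub.
    + by apply/nondecreasing_seqP => n; exact: le_w.
    + by move=> n; exact: le_w.
    + by move=> D /(_ n0); rewrite gz.
  - exact: unC.
have mun_ n : measurable_fun [set: R] (un n).
  apply: emeasurable_funM; last exact: mw.
  apply: emeasurable_funM; apply: measurable_fun_poweR; last exact: mhead.
  by apply: measurable_mine; [exact: mU|exact: measurable_cst].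
apply: (@ge0_integral_le_nd _ _ _ leb h un).
- by apply: (emeasurable_fun_cvg un) => // z _; exact: un_cvg.
- exact: h0.
- exact: mun_.
- exact: un0.
- exact: un_nd.
- move=> z C unC; rewrite -(cvg_lim _ (un_cvg z))//.
  by apply: lime_le; [exact: cvgP (un_cvg z)|exact: nearW].
- exact: un_bound.
Qed.

End LowerSplitBound.

(** * The upper bound on level sets *)

Section HoelderOnSets.
Context {R : realType} (p : R) (hp : 1 < p).
Local Open Scope ereal_scope.
Local Notation RT := (measurableTypeR R).
Local Notation leb := (@lebesgue_measure R).
Local Notation p' := (conj_exp p).

Lemma hoelder_set (u f : R -> R) (A : set R) : measurable A ->
  measurable_fun [set: R] u -> measurable_fun [set: R] f ->
  (forall s, 0 <= u s)%R -> (forall s, 0 <= f s)%R ->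
  \int[leb]_(s in A) ((u s)%:E * (f s)%:E) <=
    (\int[leb]_s ((u s)%:E `^ p')) `^ p'^-1 *
    (\int[leb]_(s in A) ((f s)%:E `^ p)) `^ p^-1.
Proof.
move=> mA mu mf u0 f0.
have p0 : (0 < p)%R by exact: lt_trans hp.
have p10 : (0 < p - 1)%R by rewrite subr_gt0.
have p'0 : (0 < p')%R by rewrite divr_gt0.
pose fA s := if s \in A then f s else 0%R.
have fA0 s : (0 <= fA s)%R by rewrite /fA; case: ifP.
have mfA : measurable_fun [set: R] fA.
  exact: (iffLR (measurable_restrictT f mA) (measurable_funTS mf)).
have H := @hoelder _ RT R leb u fA p' p mu mfA p'0 p0.
have pp : (p'^-1 + p^-1 = 1)%R.
  by rewrite /conj_exp; field; rewrite !gt_eqF.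
have E0 : \int[leb]_x `| (EFin \o (u \* fA)%R) x | =
    \int[leb]_(s in A) ((u s)%:E * (f s)%:E).
  rewrite [RHS]integral_mkcond; apply: eq_integral => s _.
  rewrite gee0_abs; last by rewrite lee_fin mulr_ge0.
  by rewrite /= patchE /fA; case: ifP => _; rewrite ?mulr0 ?EFinM.
have E1 : \int[leb]_x (`| (EFin \o u) x | `^ p') = \int[leb]_s ((u s)%:E `^ p').
  by apply: eq_integral => s _; rewrite gee0_abs// lee_fin.
have E2 : \int[leb]_x (`| (EFin \o fA) x | `^ p) = \int[leb]_(s in A) ((f s)%:E `^ p).
  rewrite [RHS]integral_mkcond; apply: eq_integral => s _.
  rewrite gee0_abs; last by rewrite lee_fin.
  rewrite patchE /fA /=; case: ifP => // _; by rewrite powR0 ?gt_eqF.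
by have := H pp; rewrite Lnorm1 E0 unlock E1 E2.
Qed.

End HoelderOnSets.

Section AntitoneWeight.
Context {R : realType}.
Local Open Scope ereal_scope.
Local Notation RT := (measurableTypeR R).
Variables (m : {measure set RT -> \bar R}) (w T : R -> \bar R) (a b : R).
Hypothesis mw : measurable_fun [set: R] w.
Hypothesis w0 : forall x, 0 <= w x.
Hypothesis T0 : forall x, 0 <= T x.
Hypothesis T_anti : {homo T : x y / (x <= y)%R >-> y <= x}.
Hypothesis a0 : (0 <= a)%R.
Hypothesis b0 : (0 <= b)%R.
Let W x := \int[m]_(y in `]-oo, x]) w y.

(** The tail lemma on (-oo,x], with the factor T^b moved inside the integral. *)
Lemma antitone_head_le x :
  T x `^ b * W x `^ (a + 1) <= 2%:E `^ (a + 1) * \int[m]_y (T y `^ b * W y `^ a * w y).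
Proof.
have mT : measurable_fun [set: R] T by exact: nonincreasing_emeasurable.
have mW : measurable_fun [set: R] W by exact: (measurable_head m mw w0).
have mWaw : measurable_fun [set: R] (fun y => W y `^ a * w y).
  by apply: emeasurable_funM; [exact: measurable_fun_poweR|exact: mw].
have mTWw : measurable_fun [set: R] (fun y => T y `^ b * W y `^ a * w y).
  apply: emeasurable_funM; last exact: mw.
  by apply: emeasurable_funM; exact: measurable_fun_poweR.
have Waw0 y : 0 <= W y `^ a * w y by apply: mule_ge0; [exact: poweR_ge0|exact: w0].
have TWw0 y : 0 <= T y `^ b * W y `^ a * w y.
  by rewrite -muleA; apply: mule_ge0; [exact: poweR_ge0|exact: Waw0].
apply: (@le_trans _ _ (T x `^ b * (2%:E `^ (a + 1) *
    \int[m]_(y in `]-oo, x]) (W y `^ a * w y)))).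
  by apply: lee_wpmul2l; [exact: poweR_ge0|exact: poweR_head_le].
rewrite muleCA; apply: lee_wpmul2l; first exact: poweR_ge0.
rewrite -ge0_integralZl; [|exact: measurable_itv|exact: measurable_funTS
  |by move=> y _; exact: Waw0|exact: poweR_ge0].
apply: (@le_trans _ _ (\int[m]_(y in `]-oo, x]) (T y `^ b * W y `^ a * w y))).
  apply: ge0_le_integral; first exact: measurable_itv.
  - by move=> y _; apply: mule_ge0; [exact: poweR_ge0|exact: Waw0].
  - by apply: measurable_funTS; exact: measurable_funeM.
  - exact: measurable_funTS.
  - move=> y; rewrite /= in_itv/= => yx; rewrite -muleA; apply: lee_wpmul2r; first exact: Waw0.
    by apply: le_poweR; [exact: T0|exact: T_anti|].
by apply: ge0_subset_integral; [exact: measurable_itv|exact: measurableT|exact: mTWw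
  |by move=> y _; exact: TWw0|exact: subsetT].
Qed.

End AntitoneWeight.

(** The measure eta is represented as w dm. This covers both the Stieltjes measure
    (m = eta, w = 1) and the density g^p' ds of Hardy's inequality. The function f
    with norm at most 1 is fixed, F is its image, and Rg(t) is the integral of g f
    over (-oo,t]. *)
Section Blocks.
Context {R : realType} (p q : R) (hq : 1 < q) (hqp : q < p).
Local Open Scope ereal_scope.
Local Notation RT := (measurableTypeR R).
Local Notation leb := (@lebesgue_measure R).
Local Notation p' := (conj_exp p).
Local Notation b := (p / (p - q))%R.
Local Notation a := (p * (q - 1) / (p - q))%R.
Variables (h : R) (k kap : R -> R -> R) (g : R -> R).
Hypothesis h1 : (1 <= h)%R.
Hypothesis hk : positive_kernel k.
Hypothesis k_supp : forall x s, (x < s)%R -> k x s = 0%R.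
Hypothesis mkap : measurable_fun (setT : set (RT * RT)) (fun z => kap z.1 z.2).
Hypothesis kap0 : forall x s, (0 <= kap x s)%R.
Hypothesis kap_homo : forall x y s, (x <= y)%R -> (kap x s <= kap y s)%R.
Hypothesis mg : measurable_fun [set: R] g.
Hypothesis g0 : forall s, (0 <= g s)%R.
Hypothesis k_split : forall x t s, (s <= t)%R -> (t <= x)%R ->
  (k x s <= h * (kap x t * g s + k t s))%R.
Variables (mu m : {measure set RT -> \bar R}) (w : R -> \bar R) (W : R -> \bar R).
Hypothesis mw : measurable_fun [set: R] w.
Hypothesis w0 : forall x, 0 <= w x.
Hypothesis WE : forall x, W x = \int[m]_(y in `]-oo, x]) w y.
Local Notation ph := (kernel_pow p' k).
Hypothesis phW : forall x, ph x <= W x.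
Variable (sig : R).
Hypothesis sig0 : (0 < sig)%R.
Hypothesis Ssig : \int[m]_y (tail_mass mu y `^ b * W y `^ a * w y) <= sig%:E.
Variable f : R -> R.
Hypothesis mf : measurable_fun [set: R] f.
Hypothesis f0 : forall s, (0 <= f s)%R.
Hypothesis fp1 : \int[leb]_s ((f s)%:E `^ p) <= 1.
Local Notation F := (kernel_op k (EFin \o f)).
Let Rg t := \int[leb]_(s in `]-oo, t]) ((g s)%:E * (f s)%:E).

Let W0 x : 0 <= W x. Proof. by rewrite WE; apply: integral_ge0 => y _; exact: w0. Qed.

Let mW : measurable_fun [set: R] W.
Proof.
have -> : W = (fun x => \int[m]_(y in `]-oo, x]) w y) by apply/funext => x; exact: WE.
exact: (measurable_head m mw w0).
Qed.

Let mM : measurable_fun [set: R] (tail_mass mu). Proof. exact: measurable_tail_mass. Qed.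

Let mfE : measurable_fun [set: R] (EFin \o f). Proof. exact/measurable_EFinP. Qed.

Let F0 x : 0 <= F x. Proof. exact: kernel_op_ge0. Qed.
Let F_nd : {homo F : x y / (x <= y)%R >-> x <= y}. Proof. exact: kernel_op_nondecreasing. Qed.
Let mF : measurable_fun [set: R] F. Proof. exact: measurable_kernel_op. Qed.

Let mWaw : measurable_fun [set: R] (fun y => W y `^ a * w y).
Proof. by apply: emeasurable_funM; [exact: measurable_fun_poweR|exact: mw]. Qed.

Let Waw0 y : 0 <= W y `^ a * w y.
Proof. by apply: mule_ge0; [exact: poweR_ge0|exact: w0]. Qed.

Lemma poweR_head_density_le x :
  W x `^ (a + 1) <= 2%:E `^ (a + 1) * \int[m]_(y in `]-oo, x]) (W y `^ a * w y).
Proof.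
have := poweR_head_le m mw w0 (ltW (alpha_gt0 hq hqp)) x.
rewrite -WE; under [in X in _ <= _ * X -> _]eq_integral => y _ do rewrite -WE.
by [].
Qed.

Lemma tail_mass_head_le x :
  tail_mass mu x `^ b * W x `^ (a + 1) <= 2%:E `^ (a + 1) * sig%:E.
Proof.
have WH : W = (fun x => \int[m]_(y in `]-oo, x]) w y) by apply/funext => y; exact: WE.
have [a0 b0] := (ltW (alpha_gt0 hq hqp), ltW (beta_gt0 hq hqp)).
move: Ssig; rewrite WH => Ssig'.
apply: le_trans (antitone_head_le m mw w0 (tail_mass_ge0 mu)
  (@tail_mass_nonincreasing _ mu) a0 b0 x) _.
by apply: lee_wpmul2l; first exact: poweR_ge0.
Qed.

Let hp : (1 < p)%R. Proof. exact: lt_trans hq hqp. Qed.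

Let p'0 : (0 < p')%R. Proof. exact: conj_exp_gt0 hq hqp. Qed.

Let p0 : (0 < p)%R. Proof. exact: lt_trans hp. Qed.

Let kf_hoelder x A : measurable A ->
  \int[leb]_(s in A) ((k x s)%:E * (f s)%:E) <=
    ph x `^ p'^-1 * (\int[leb]_(s in A) ((f s)%:E `^ p)) `^ p^-1.
Proof.
move=> mA; apply: (@hoelder_set _ _ hp) => //; first exact: kernel_section_meas.
exact: (pk_ge0 hk).
Qed.

Lemma kernel_op_le_head x : F x `^ p' <= W x.
Proof.
apply: le_trans (phW x).
have ph0 := kernel_pow_ge0 p' k x.
rewrite -[leRHS](@poweRrK _ _ p'^-1 p') ?mulVf ?gt_eqF//.
apply: le_poweR; [exact: F0| |exact: ltW].
apply: le_trans (kf_hoelder x measurableT) _.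
rewrite -[leRHS]mule1; apply: lee_wpmul2l; first exact: poweR_ge0.
rewrite -(poweR1r p^-1); apply: le_poweR; [|exact: fp1|by rewrite invr_ge0 ltW].
by apply: integral_ge0 => s _; exact: poweR_ge0.
Qed.

(** The bound on M^b W^(a+1) makes tails of mu finite where F, hence W, is bounded
    below; where F is infinite they are null. *)
Lemma measure_level_lty (c : R) (E : set R) : (0 < c)%R -> measurable E ->
  (forall x, E x -> c%:E <= F x) -> mu E < +oo.
Proof.
move=> c0 mE Ec.
have [a0 b0] := (alpha_gt0 hq hqp, beta_gt0 hq hqp).
pose C := ((c `^ p') `^ (a + 1))%R.
have C0 : (0 < C)%R by rewrite !powR_gt0.
pose B : \bar R := ((2%:E `^ (a + 1) * sig%:E) * (C^-1)%:E) `^ b^-1.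
have B0 : 0 <= B by exact: poweR_ge0.
have Boo : B < +oo.
  by apply: poweR_lty; rewrite poweR_EFin -!EFinM ltry.
apply: (le_lt_trans _ Boo); apply: measure_le_of_tails => // t Et.
apply: (@le_trans _ _ (tail_mass mu t)).
  by apply: le_measure; rewrite ?inE//; exact: measurableI.
have bV : (b * b^-1 = 1)%R by rewrite mulfV// gt_eqF.
rewrite -(poweRrK (tail_mass_ge0 mu t) bV) /B; apply: le_poweR.
- exact: poweR_ge0.
- rewrite lee_pdivlMr//; apply: le_trans (tail_mass_head_le t).
  apply: lee_wpmul2l; first exact: poweR_ge0.
  rewrite /C -!poweR_EFin; apply: le_poweR; [exact: poweR_ge0| |by rewrite addr_ge0// ltW].
  apply: le_trans (kernel_op_le_head t).
  by apply: le_poweR; [rewrite lee_fin ltW|exact: Ec|exact: ltW].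
- by rewrite invr_ge0 ltW.
Qed.

Lemma measure_infinite_level (E : set R) : measurable E ->
  (forall x, E x -> F x = +oo) -> mu E = 0.
Proof.
move=> mE Eoo; apply/eqP; rewrite eq_le measure_ge0 andbT.
have [a0 b0] := (alpha_gt0 hq hqp, beta_gt0 hq hqp).
apply: measure_le_of_tails => // t Et.
apply: (@le_trans _ _ (tail_mass mu t)).
  by apply: le_measure; rewrite ?inE//; exact: measurableI.
have Woo : W t = +oo.
  apply/eqP; rewrite -leye_eq; apply: le_trans (kernel_op_le_head t).
  by rewrite (Eoo _ Et) poweRyr// gt_eqF.
have := tail_mass_head_le t; rewrite Woo poweRyr ?gt_eqF ?addr_gt0//.
have [->//|M0] := eqVneq (tail_mass mu t) 0.
rewrite gt0_muley; last by rewrite poweR_gt0// lt0e M0 tail_mass_ge0.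
by rewrite poweR_EFin -EFinM leye_eq.
Qed.

(** Ratio of consecutive levels: splitting the kernel at a point with F < c/lam
    leaves a remainder of at most 2h(c/lam) = c/2, which is absorbed. *)
Let lam := (4 * h)%R.
Let h0 : (0 < h)%R. Proof. exact: lt_le_trans h1. Qed.
Let lam0 : (0 < lam)%R. Proof. by rewrite mulr_gt0. Qed.

Let level c := [set x : RT | c%:E <= F x] `&` [set x : RT | F x < (lam * c)%:E].

Let mlevel c : measurable (level c).
Proof.
apply: measurableI; rewrite -[X in measurable X]setTI.
- exact: emeasurable_fun_c_infty.
- exact: emeasurable_fun_infty_o.
Qed.

(** The integral F(x) is divided according to the size of F(s). Where
    F(s) >= c/lam, Hoelder's inequality is used on D. The set L where
    F(s) < c/lam is cut at a point t of L whose head carries half of the integral,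
    and there k(x,s) is split at t; the term with k(t,s) contributes at most
    h F(t) < h c/lam. *)
Lemma level_point x c : (0 < c)%R -> level c x ->
  exists2 t, (t <= x)%R & c%:E <= (8 * h)%:E * ((kap x t)%:E * Rg t +
    ph x `^ p'^-1 * (\int[leb]_(s in level (c / lam) `|` level c) ((f s)%:E `^ p)) `^ p^-1).
Proof.
move=> c0 [/= cF Fc].
set D := level (c / lam) `|` level c.
have mD : measurable D by exact: measurableU.
pose L := [set s : RT | F s < (c / lam)%:E] `&` `]-oo, x]%classic.
have mL : measurable L.
  apply: measurableI => //; rewrite -[X in measurable X]setTI.
  exact: emeasurable_fun_infty_o.
pose kf s := (k x s)%:E * (f s)%:E.
have mkf : measurable_fun [set: R] kf.
  apply: emeasurable_funM; last exact: mfE.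
  by apply/measurable_EFinP; exact: kernel_section_meas.
have kf0 s : 0 <= kf s by rewrite mule_ge0// lee_fin// (pk_ge0 hk).
have kfx : \int[leb]_s kf s = F x by [].
pose I := \int[leb]_(s in L) kf s.
pose J := ph x `^ p'^-1 * (\int[leb]_(s in D) ((f s)%:E `^ p)) `^ p^-1.
have I0 : 0 <= I by apply: integral_ge0 => s _; exact: kf0.
have J0 : 0 <= J by apply: mule_ge0; exact: poweR_ge0.
have FIJ : F x <= I + J.
  rewrite -kfx; apply: (@le_trans _ _ (I + \int[leb]_(s in D) kf s)); last first.
    by apply: leeD => //; exact: kf_hoelder.
  rewrite /I [in leRHS](integral_mkcond L) [in leRHS](integral_mkcond D).
  have mr (A : set RT) : measurable A -> measurable_fun [set: R] (kf \_ A).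
    by move=> mA; exact: (iffLR (measurable_restrictT kf mA) (measurable_funTS mkf)).
  have r0 (A : set RT) s : 0 <= (kf \_ A) s.
    by apply: erestrict_ge0 => t _; exact: kf0.
  rewrite -ge0_integralD; [|exact: measurableT|by move=> s _; exact: r0|exact: mr
    |by move=> s _; exact: r0|exact: mr].
  apply: ge0_le_integral; first exact: measurableT.
  - by move=> s _; exact: kf0.
  - exact: mkf.
  - by apply: emeasurable_funD; exact: mr.
  move=> s _; have [xs|sx] := ltP x s.
    by rewrite /kf k_supp// mul0e adde_ge0.
  have [Fs|Fs] := ltP (F s) (c / lam)%:E.
    rewrite {1}patchE ifT ?leeDl//; by rewrite inE; split => //=.
  rewrite [X in _ <= _ + X]patchE ifT ?leeDr// inE.
  have Fsc : F s < (lam * c)%:E by apply: le_lt_trans (F_nd sx) Fc.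
  have [cs|cs] := leP c%:E (F s); first by right.
  left; split => //=; rewrite mulrC divfK//; exact: lt0r_neq0.
have Ifin : I \is a fin_num.
  rewrite ge0_fin_numE//; apply: (@le_lt_trans _ _ (F x)).
    rewrite -kfx; apply: ge0_subset_integral; [exact: mL|exact: measurableT|exact: mkf
      |by move=> s _; exact: kf0|exact: subsetT].
  by apply: lt_trans Fc _; rewrite ltry.
have cJ t : (t <= x)%R -> I <= 2%:E * (h%:E * ((kap x t)%:E * Rg t)) + (c / 2)%:E ->
    c%:E <= (8 * h)%:E * ((kap x t)%:E * Rg t + J).
  move=> tx It; have X0 : 0 <= (kap x t)%:E * Rg t.
    by apply: mule_ge0; [rewrite lee_fin|apply: integral_ge0 => s _; rewrite mule_ge0// lee_fin].
  move: It; set X := (kap x t)%:E * Rg t in X0 *.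
  move=> It; have : c%:E <= 2%:E * (h%:E * X) + (c / 2)%:E + J.
    by apply: (le_trans cF); apply: (le_trans FIJ); exact: leeD.
  case: X X0 {It} => [X||//] X0; case: J J0 {FIJ} => [J||//] J0.
  - rewrite lee_fin in X0; rewrite lee_fin in J0.
    rewrite -(EFinM h) -(EFinM 2) -!EFinD -EFinM !lee_fin => H.
    have hJ : (J <= h * J)%R by rewrite ler_peMl.
    lra.
  - by move=> _; rewrite addey// gt0_muley ?leey// lte_fin mulr_gt0.
  - by move=> _; rewrite addye// gt0_muley ?leey// lte_fin mulr_gt0.
  - by move=> _; rewrite addye// gt0_muley ?leey// lte_fin mulr_gt0.
have [I_0|I_n0] := eqVneq I 0.
  exists x => //; apply: cJ => //; rewrite I_0.
  apply: adde_ge0; last by rewrite lee_fin divr_ge0// ltW.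
  apply: mule_ge0 => //; apply: mule_ge0; first by rewrite lee_fin ltW.
  by apply: mule_ge0; [rewrite lee_fin|apply: integral_ge0 => s _; rewrite mule_ge0// lee_fin].
have [t [Lt It]] : exists t, L t /\ I <= 2%:E * \int[leb]_(s in L `&` `]-oo, t]) kf s.
  apply: contrapT => H.
  (* otherwise every head of L has less than half of the integral over L *)
  suff : I <= I * 2^-1%:E.
    move: (I) Ifin I0 I_n0 => [i||]// _; rewrite lee_fin eqe => i0 in0.
    rewrite -EFinM lee_fin; have : (0 < i)%R by rewrite lt_neqAle eq_sym in0.
    move=> *; lra.
  apply: (@integral_le_of_tails _ _ _ leb (fun y : RT => - y)%R) => //.
  - exact: oppr_measurable.
  - by apply: mule_ge0.
  move=> t Lt; rewrite leNgt; apply/negP => lt; apply: H; exists t; split => //.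
  rewrite -(@lee_pdivrMl _ 2)// muleC; apply: ltW; apply: (lt_le_trans lt).
  rewrite le_eqVlt; apply/orP; left; apply/eqP; congr (integral _ _ _).
  by congr (_ `&` _); apply/seteqP; split => y /=; rewrite in_itv/= lerN2.
case: (Lt) => /= Ft tx; rewrite in_itv/= in tx.
exists t => //; apply: cJ => //; apply: (le_trans It).
apply: (@le_trans _ _ (2%:E * (h%:E * ((kap x t)%:E * Rg t + F t)))).
  apply: lee_wpmul2l => //.
  have mgf : measurable_fun [set: R] (fun s => (g s)%:E * (f s)%:E).
    by apply: emeasurable_funM; exact/measurable_EFinP.
  have mkt : measurable_fun [set: R] (fun s => (k t s)%:E * (f s)%:E).
    apply: emeasurable_funM; last exact: mfE.
    by apply/measurable_EFinP; exact: kernel_section_meas.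
  have gf0 s : 0 <= (g s)%:E * (f s)%:E by rewrite mule_ge0// lee_fin.
  have kt0 s : 0 <= (k t s)%:E * (f s)%:E by rewrite mule_ge0// lee_fin// (pk_ge0 hk).
  apply: (@le_trans _ _ (\int[leb]_(s in `]-oo, t])
     (h%:E * ((kap x t)%:E * ((g s)%:E * (f s)%:E) + (k t s)%:E * (f s)%:E)))).
    apply: (@le_trans _ _ (\int[leb]_(s in `]-oo, t]) kf s)).
      apply: ge0_subset_integral; [by apply: measurableI|exact: measurable_itv
        |exact: measurable_funTS|by move=> s _; exact: kf0|exact: subIsetr].
    apply: ge0_le_integral; first exact: measurable_itv.
    - by move=> s _; exact: kf0.
    - exact: measurable_funTS.
    - apply: measurable_funTS; apply: measurable_funeM; apply: emeasurable_funD; last exact: mkt.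
      exact: measurable_funeM.
    - move=> s st; have {}st : (s <= t)%R by move: st; rewrite /= in_itv.
      rewrite /kf -(EFinM (g s)) -(EFinM (kap x t)) -(EFinM (k t s)) -EFinD -(EFinM h).
      rewrite -(EFinM (k x s)) lee_fin.
      have := k_split st tx => /(ler_wpM2r (f0 s)) /le_trans; apply.
      by rewrite -mulrA mulrDl !mulrA.
  rewrite ge0_integralZl; [|exact: measurable_itv| | |by rewrite lee_fin ltW]; last 2 first.
  - apply: measurable_funTS; apply: emeasurable_funD; last exact: mkt.
    exact: measurable_funeM.
  - by move=> s _; apply: adde_ge0; [rewrite mule_ge0// lee_fin|].
  apply: lee_wpmul2l; first by rewrite lee_fin ltW.
  rewrite ge0_integralD; [|exact: measurable_itv
    |by move=> s _; rewrite mule_ge0// lee_fin|by apply: measurable_funTS; exact: measurable_funeM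
    |by move=> s _|exact: measurable_funTS].
  apply: leeD.
    rewrite ge0_integralZl; [exact: lexx|exact: measurable_itv|exact: measurable_funTS
      |by move=> s _; exact: gf0|by rewrite lee_fin].
  apply: ge0_subset_integral; [exact: measurable_itv|exact: measurableT|exact: mkt
    |by move=> s _; exact: kt0|exact: subsetT].
have X0 : 0 <= (kap x t)%:E * Rg t.
  by apply: mule_ge0; [rewrite lee_fin|apply: integral_ge0 => s _; rewrite mule_ge0// lee_fin].
rewrite ge0_muleDr// ge0_muleDr//; last 2 first.
- by rewrite mule_ge0// lee_fin ltW.
- by rewrite mule_ge0// lee_fin ltW.
apply: leeD => //; apply: (@le_trans _ _ (2%:E * (h%:E * (c / lam)%:E))).
  by apply: lee_wpmul2l => //; apply: lee_wpmul2l; [rewrite lee_fin ltW|exact: ltW].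
rewrite -!EFinM lee_fin /lam le_eqVlt; apply/orP; left; apply/eqP.
have hn0 := lt0r_neq0 h0.
by field.
Qed.

Let Rg0 t : 0 <= Rg t.
Proof. by apply: integral_ge0 => s _; rewrite mule_ge0// lee_fin. Qed.

Let mkapq t : measurable_fun [set: R] (fun y => (kap y t)%:E `^ q).
Proof.
apply: measurable_fun_poweR; apply/measurable_EFinP.
exact: (measurableT_comp mkap (pair2_measurable t)).
Qed.

Let q0 : (0 < q)%R. Proof. by case: (exponent_gt0 hq hqp). Qed.

Let fD c := \int[leb]_(s in level (c / lam) `|` level c) ((f s)%:E `^ p).

Let fD0 c : 0 <= fD c. Proof. by apply: integral_ge0 => s _; exact: poweR_ge0. Qed.

Let tailE c x := level c `&` `[x, +oo[%classic.

Let mtailE c x : measurable (tailE c x).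
Proof. by apply: measurableI; [exact: mlevel|exact: measurable_itv]. Qed.

Let C0 := (2 * (16 * h) `^ q)%R.

(** The point x is chosen far enough to the left in the level set to leave half
    of its mass on the right of x. There kap(x,t) <= kap(y,t), so that
    mu(E) kap(x,t)^q is at most the integral over E. *)
Lemma level_block c : (0 < c)%R -> exists xt : R * R, [/\ (xt.2 <= xt.1)%R &
  (c `^ q)%:E * mu (level c) <= C0%:E *
    ((\int[mu]_(y in tailE c xt.1) ((kap y xt.2)%:E `^ q)) * Rg xt.2 `^ q +
     mu (tailE c xt.1) * (ph xt.1 `^ (p'^-1 * q) * fD c `^ (p^-1 * q)))].
Proof.
move=> c0; have [mu0|mun0] := eqVneq (mu (level c)) 0.
  exists (0%R, 0%R); split => //; rewrite mu0 mule0; apply: mule_ge0.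
    by rewrite lee_fin mulr_ge0// powR_ge0.
  apply: adde_ge0; apply: mule_ge0; rewrite ?poweR_ge0//.
    by apply: integral_ge0 => y _; exact: poweR_ge0.
  by apply: mule_ge0; exact: poweR_ge0.
have muoo : mu (level c) < +oo by apply: (measure_level_lty c0); [exact: mlevel|by move=> x []].
have mufin : mu (level c) \is a fin_num by rewrite ge0_fin_numE.
have [x [xc mux]] : exists x, level c x /\ mu (level c) <= 2%:E * mu (tailE c x).
  apply: contrapT => H.
  suff : mu (level c) <= mu (level c) * 2^-1%:E.
    have mg0 : 0 <= mu (level c) by exact: measure_ge0.
    move: (mu (level c)) mufin mun0 mg0 => [i||]// _.
    rewrite lee_fin eqe => in0 i0.
    rewrite -EFinM lee_fin; have : (0 < i)%R by rewrite lt_neqAle eq_sym in0.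
    move=> *; lra.
  apply: measure_le_of_tails; [exact: mlevel|by apply: mule_ge0|].
  move=> t tc; rewrite leNgt; apply/negP => lt; apply: H; exists t; split => //.
  by rewrite -(@lee_pdivrMl _ 2)// muleC ltW.
have [t tx cle] := level_point c0 xc.
exists (x, t); split => //=.
set E := tailE c x in mux *.
set J := ph x `^ p'^-1 * fD c `^ p^-1 in cle *.
set X := (kap x t)%:E * Rg t in cle *.
have X0 : 0 <= X by apply: mule_ge0 => //; rewrite lee_fin.
have J0 : 0 <= J by apply: mule_ge0; exact: poweR_ge0.
have h8 : (0 <= 8 * h)%R by rewrite mulr_ge0// ltW.
have cq : (c `^ q)%:E <= ((16 * h) `^ q)%:E * (X `^ q + J `^ q).
  rewrite -!poweR_EFin; apply: (@le_trans _ _ (((8 * h)%:E * (X + J)) `^ q)).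
    by apply: le_poweR; [rewrite lee_fin ltW|exact: cle|exact: ltW].
  rewrite poweRM ?adde_ge0//.
  have -> : (16 * h)%:E `^ q = (8 * h)%:E `^ q * 2%:E `^ q.
    by rewrite -poweRM// -EFinM; congr (_%:E `^ _); ring.
  rewrite -muleA; apply: lee_wpmul2l; first exact: poweR_ge0.
  by apply: poweR_add_le => //; exact: ltW.
have kX : mu E * X `^ q <= (\int[mu]_(y in E) ((kap y t)%:E `^ q)) * Rg t `^ q.
  rewrite /X poweRM ?lee_fin// muleA; apply: lee_wpmul2r; first exact: poweR_ge0.
  rewrite muleC -integral_cst; last exact: mtailE.
  apply: ge0_le_integral; first exact: mtailE.
  - by move=> y _; exact: poweR_ge0.
  - exact: measurable_cst.
  - by apply: measurable_funTS; exact: mkapq.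
  - move=> y [_ xy]; have {}xy : (x <= y)%R by move: xy; rewrite /= in_itv/= andbT.
    by apply: le_poweR; [rewrite lee_fin|rewrite lee_fin kap_homo|exact: ltW].
have JE : J `^ q = ph x `^ (p'^-1 * q) * fD c `^ (p^-1 * q).
  by rewrite /J poweRM ?poweR_ge0// -!poweRrM.
apply: (@le_trans _ _ ((c `^ q)%:E * (2%:E * mu E))).
  by apply: lee_wpmul2l; rewrite ?lee_fin ?powR_ge0.
rewrite /C0 EFinM muleCA -[leRHS]muleA; apply: lee_wpmul2l => //.
apply: (@le_trans _ _ (((16 * h) `^ q)%:E * (X `^ q + J `^ q) * mu E)).
  by apply: lee_wpmul2r.
rewrite -muleA; apply: lee_wpmul2l; first by rewrite lee_fin powR_ge0.
rewrite ge0_muleDl ?poweR_ge0//; apply: leeD; first by rewrite muleC.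
by rewrite JE muleC.
Qed.

(** Expand W(x_i)^(a+1) by the tail lemma and exchange sum and integral: at y only
    the sets E_i contained in [y,oo) occur, and as b >= 1 the sum of mu(E_i)^b is at
    most the b-th power of the measure of their union, that is, at most M(y)^b. *)
Lemma disjoint_tails_sum (E : nat -> set RT) (x : nat -> R) n :
  (forall i, measurable (E i)) -> trivIset setT E ->
  (forall i, E i `<=` `[x i, +oo[%classic) ->
  \sum_(i < n) mu (E i) `^ b * W (x i) `^ (a + 1) <= 2%:E `^ (a + 1) * sig%:E.
Proof.
move=> mE tE Ex; have [a0 b0] := (alpha_gt0 hq hqp, beta_gt0 hq hqp).
have b1 : (1 <= b)%R by have := betaB1_gt0 hq hqp; rewrite subr_gt0 => /ltW.
pose G i y := (if (y <= x i)%R then mu (E i) `^ b else 0) * (W y `^ a * w y).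
have G0 i y : 0 <= G i y.
  by apply: mule_ge0; [case: ifP => // _; exact: poweR_ge0|exact: Waw0].
have mG i : measurable_fun [set: R] (G i).
  apply: emeasurable_funM => //.
  by apply: measurable_if_le_cst; exact: measurable_cst.
have pointwise y : \sum_(i < n) (if (y <= x i)%R then mu (E i) `^ b else 0) <=
    tail_mass mu y `^ b.
  pose E' i := if (y <= x i)%R then E i else set0.
  have mE' i : measurable (E' i) by rewrite /E'; case: ifP.
  have E'E i : E' i `<=` E i by rewrite /E'; case: ifP => _ z; [|case].
  have tE' : trivIset setT E'.
    apply/trivIsetP => i j _ _ ij; apply/seteqP; split => // z [/E'E zi /E'E zj].
    by move/trivIsetP : tE => /(_ i j Logic.I Logic.I ij) <-; split.
  apply: (@le_trans _ _ ((\sum_(i < n) mu (E' i)) `^ b)).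
    have E'b i : (if (y <= x i)%R then mu (E i) `^ b else 0) = mu (E' i) `^ b.
      by rewrite /E'; case: ifP => // _; rewrite measure0 poweR0r// gt_eqF.
    under eq_bigr do rewrite E'b.
    elim: n => [|n IH]; first by rewrite !big_ord0 poweR0r// gt_eqF.
    rewrite !big_ord_recr/=; apply: le_trans (poweR_superadd _ _ b1).
    - by apply: leeD.
    - by apply: sume_ge0.
    - by [].
  apply: le_poweR; [by apply: sume_ge0| |exact: ltW].
  rewrite -(measure_bigsetU mu mE' tE').
  apply: le_measure; rewrite ?inE; [exact: bigsetU_measurable|exact: measurable_itv|].
  rewrite -bigcup_mkord => z [i _]; rewrite /E'; case: ifP => // yx /Ex.
  by rewrite /= !in_itv/= !andbT; exact: le_trans.
apply: (@le_trans _ _ (\sum_(i < n) 2%:E `^ (a + 1) * \int[m]_y G i y)).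
  apply: lee_sum => i _.
  apply: (@le_trans _ _ (mu (E i) `^ b * (2%:E `^ (a + 1) *
      \int[m]_(y in `]-oo, x i]) (W y `^ a * w y)))).
    by apply: lee_wpmul2l; [exact: poweR_ge0|exact: poweR_head_density_le].
  rewrite muleCA; apply: lee_wpmul2l; first exact: poweR_ge0.
  rewrite integral_headE -ge0_integralZl; [|exact: measurableT
    |exact: measurable_if_le_cst|by move=> y _; case: ifP => // _; exact: Waw0
    |exact: poweR_ge0].
  rewrite le_eqVlt; apply/orP; left; apply/eqP; apply: eq_integral => y _.
  by rewrite /G; case: ifP => _; rewrite ?mule0 ?mul0e.
rewrite -ge0_sume_distrr; last by move=> i _; apply: integral_ge0 => y _; exact: G0.
apply: lee_wpmul2l; first exact: poweR_ge0.
rewrite -(big_mkord xpredT (fun i => \int[m]_y G i y)).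
rewrite -ge0_integral_sum; [|exact: measurableT|exact: mG|by move=> i y _; exact: G0].
apply: le_trans Ssig; apply: ge0_le_integral; first exact: measurableT.
- by move=> y _; apply: sume_ge0.
- by apply: emeasurable_sum => i; exact: mG.
- apply: emeasurable_funM; last exact: mw.
  by apply: emeasurable_funM; exact: measurable_fun_poweR.
move=> y _; rewrite big_mkord -ge0_sume_distrl; last first.
  by move=> i _; case: ifP => // _; exact: poweR_ge0.
by rewrite -[leRHS]muleA; apply: lee_wpmul2r; [exact: Waw0|exact: pointwise].
Qed.

Let lev c0 i := (c0 * lam ^+ i)%R.

Let lam1 : (1 <= lam)%R. Proof. by rewrite /lam; have := h1 => ?; lra. Qed.

Let lev_gt0 c0 i : (0 < c0)%R -> (0 < lev c0 i)%R.
Proof. by move=> c00; rewrite mulr_gt0// exprn_gt0. Qed.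

Let levS c0 i : (lam * lev c0 i)%R = lev c0 i.+1.
Proof. by rewrite /lev exprS mulrCA. Qed.

Let lev_nd c0 i j : (0 < c0)%R -> (i <= j)%N -> (lev c0 i <= lev c0 j)%R.
Proof. by move=> c00 ij; rewrite ler_pM2l// ler_weXn2l. Qed.

Let level_trivIset c0 : (0 < c0)%R -> trivIset setT (fun i => level (lev c0 i)).
Proof.
move=> c00; have H i j x : (i < j)%N -> level (lev c0 i) x -> ~ level (lev c0 j) x.
  move=> ij [_ /= xi] [/= jx _]; have := le_lt_trans jx xi.
  by rewrite lte_fin levS ltNge lev_nd.
apply/trivIsetP => i j _ _ ij; apply/seteqP; split => // x [xi xj].
by case: (ltngtP i j) ij => // ij _; [exact: H ij xi xj|exact: H ij xj xi].
Qed.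

Let levels_cover c0 n : (0 < c0)%R ->
  [set x : RT | c0%:E <= F x] `&` [set x : RT | F x < (lev c0 n)%:E] =
  \big[setU/set0]_(i < n) level (lev c0 i).
Proof.
move=> c00; elim: n => [|n IH].
  rewrite big_ord0; apply/seteqP; split => // x [/= cF Fc].
  by have := le_lt_trans cF Fc; rewrite /lev expr0 mulr1 ltxx.
rewrite big_ord_recr/= -IH; apply/seteqP; split => x.
  move=> [/= cF Fc]; have [Fn|nF] := ltP (F x) (lev c0 n)%:E; first by left.
  by right; split => //=; rewrite levS.
move=> [[/= cF Fc]|[/= cF]]; last rewrite levS => Fc; split => //=.
  by apply: lt_le_trans Fc _; rewrite lee_fin lev_nd.
by apply: le_trans cF; rewrite lee_fin -[leLHS]mulr1 ler_pM2l// exprn_ege1.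
Qed.

Let levels_integral_f c0 n : (0 < c0)%R ->
  \sum_(i < n) \int[leb]_(s in level (lev c0 i)) ((f s)%:E `^ p) <= 1.
Proof.
move=> c00; have mfp : measurable_fun [set: R] (fun s => (f s)%:E `^ p).
  by apply: measurable_fun_poweR; exact: mfE.
rewrite -(big_mkord xpredT (fun i => \int[leb]_(s in level (lev c0 i)) ((f s)%:E `^ p))).
rewrite -ge0_integral_bigsetU; [|by move=> i; exact: mlevel|exact: iota_uniq
  |by apply: sub_trivIset (level_trivIset c00)|exact: measurable_funTS
  |by move=> s _; exact: poweR_ge0].
apply: le_trans fp1; apply: ge0_subset_integral => //; last first.
  by move=> s _; exact: poweR_ge0.
by apply: bigsetU_measurable => i _; exact: mlevel.
Qed.

Let fD_sum c0 n : (0 < c0)%R -> \sum_(i < n) fD (lev c0 i) <= 2%:E.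
Proof.
move=> c00; have cl0 : (0 < c0 / lam)%R by rewrite divr_gt0.
have mfp : measurable_fun [set: R] (fun s => (f s)%:E `^ p).
  by apply: measurable_fun_poweR; exact: mfE.
have E i : (lev c0 i / lam)%R = lev (c0 / lam) i by rewrite /lev mulrAC.
apply: (@le_trans _ _ (\sum_(i < n) (\int[leb]_(s in level (lev (c0 / lam) i)) ((f s)%:E `^ p) +
    \int[leb]_(s in level (lev c0 i)) ((f s)%:E `^ p)))).
  apply: lee_sum => i _; rewrite /fD E ge0_integral_setU; [exact: lexx|exact: mlevel
    |exact: mlevel|exact: measurable_funTS|by move=> s _; exact: poweR_ge0|].
  rewrite disj_set2E; apply/eqP/seteqP; split => // s [[_ /= H1] [/= H2 _]].
  have := le_lt_trans H2 H1.
  by rewrite -E mulrC divfK ?ltxx//; exact: lt0r_neq0.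
by rewrite big_split/=; apply: (leeD (levels_integral_f n cl0) (levels_integral_f n c00)).
Qed.

(** The discrete sums that come from the outer kernel are bounded separately, by
    Hardy's inequality; here their bound Z is a parameter. *)
Variable Z : \bar R.
Hypothesis HZ : forall n (E : nat -> set RT) (t : nat -> R),
  (forall i, measurable (E i)) -> trivIset setT E ->
  (forall i, E i `<=` `[t i, +oo[%classic) ->
  \sum_(i < n) (\int[mu]_(y in E i) ((kap y (t i))%:E `^ q)) * Rg (t i) `^ q <= Z.

Let Cup : \bar R := (lam `^ q)%:E * (C0%:E * (Z + sig%:E `^ b^-1 * (2%:E `^ (a + 1) + 2%:E))).

Let levels_integral c0 n : (0 < c0)%R ->
  \int[mu]_(x in [set x : RT | c0%:E <= F x] `&` [set x : RT | F x < (lev c0 n)%:E])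
    (F x `^ q) <= Cup.
Proof.
move=> c00; have [a0 b0] := (alpha_gt0 hq hqp, beta_gt0 hq hqp).
have C00 : (0 <= C0)%R by rewrite mulr_ge0// powR_ge0.
have mFq : measurable_fun [set: R] (fun x => F x `^ q) by exact: measurable_fun_poweR.
rewrite levels_cover//.
rewrite -(big_mkord xpredT (fun i => level (lev c0 i))).
rewrite ge0_integral_bigsetU; [|by move=> i; exact: mlevel|exact: iota_uniq
  |by apply: sub_trivIset (level_trivIset c00)|exact: measurable_funTS
  |by move=> s _; exact: poweR_ge0].
rewrite big_mkord.
have [xt Hxt] := choice (fun i => level_block (lev_gt0 i c00)).
pose x i := (xt i).1; pose t i := (xt i).2; pose E i := tailE (lev c0 i) (x i).
have tx i : (t i <= x i)%R by have [] := Hxt i.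
have mE i : measurable (E i) by exact: mtailE.
have tE : trivIset setT E.
  apply/trivIsetP => i j _ _ ij; apply/seteqP; split => // y [[yi _] [yj _]].
  by move/trivIsetP : (level_trivIset c00) => /(_ i j Logic.I Logic.I ij) <-; split.
have Ex i : E i `<=` `[x i, +oo[%classic by move=> y [].
have Et i : E i `<=` `[t i, +oo[%classic.
  by move=> y /Ex; rewrite /= !in_itv/= !andbT; exact: le_trans.
pose u i := (\int[mu]_(y in E i) ((kap y (t i))%:E `^ q)) * Rg (t i) `^ q.
pose v i := mu (E i) * (ph (x i) `^ (p'^-1 * q) * fD (lev c0 i) `^ (p^-1 * q)).
have u0 i : 0 <= u i.
  apply: mule_ge0; last exact: poweR_ge0.
  by apply: integral_ge0 => y _; exact: poweR_ge0.
have v0 i : 0 <= v i by apply: mule_ge0 => //; apply: mule_ge0; exact: poweR_ge0.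
have step i : \int[mu]_(y in level (lev c0 i)) (F y `^ q) <=
    (lam `^ q)%:E * (C0%:E * (u i + v i)).
  apply: (@le_trans _ _ ((lam `^ q)%:E * (((lev c0 i) `^ q)%:E * mu (level (lev c0 i))))).
    rewrite muleA -EFinM -powRM ?(ltW lam0)//; last exact/ltW/lev_gt0.
    rewrite -integral_cst; last exact: mlevel.
    apply: ge0_le_integral; first exact: mlevel.
    - by move=> y _; exact: poweR_ge0.
    - exact: measurable_funTS.
    - exact: measurable_cst.
    - move=> y [_ /= Fy]; rewrite -poweR_EFin; apply: le_poweR; [exact: F0|exact: ltW|exact: ltW].
  by apply: lee_wpmul2l; [rewrite lee_fin powR_ge0|have [] := Hxt i].
apply: (@le_trans _ _ (\sum_(i < n) (lam `^ q)%:E * (C0%:E * (u i + v i)))).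
  by apply: lee_sum => i _; exact: step.
rewrite -ge0_sume_distrr; last first.
  by move=> i _; apply: mule_ge0; [rewrite lee_fin|apply: adde_ge0].
apply: lee_wpmul2l; first by rewrite lee_fin powR_ge0.
rewrite -ge0_sume_distrr; last by move=> i _; apply: adde_ge0.
apply: lee_wpmul2l; first by rewrite lee_fin.
rewrite big_split/=; apply: leeD; first exact: HZ.
pose s : \bar R := sig%:E `^ b^-1.
have s0 : 0 <= s by exact: poweR_ge0.
pose X i := mu (E i) `^ b * ph (x i) `^ (a + 1).
have X0 i : 0 <= X i by apply: mule_ge0; exact: poweR_ge0.
have Xs0 i : 0 <= X i * (sig^-1)%:E.
  by apply: mule_ge0 => //; rewrite lee_fin invr_ge0 ltW.
have q_p0 : (0 <= p^-1 * q)%R by apply: mulr_ge0; [rewrite invr_ge0 ltW|exact: ltW].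
have bV0 : (0 <= b^-1)%R by rewrite invr_ge0 ltW.
have [nq np np1 npq nq1] := exponent_neq0 hq hqp.
(* the exponents q/p' and 1 of ph and mu(E) are those of (mu(E)^b ph^(a+1))^(1/b) *)
have vX i : v i <= s * (X i * (sig^-1)%:E + fD (lev c0 i)).
  have XE : mu (E i) * ph (x i) `^ (p'^-1 * q) = s * (X i * (sig^-1)%:E) `^ b^-1.
    rewrite /s -poweRM ?lee_fin ?(ltW sig0)//.
    rewrite muleCA -EFinM mulfV ?gt_eqF// mule1 /X poweRM ?poweR_ge0// -!poweRrM.
    rewrite mulfV ?gt_eqF// poweRe1//; congr (_ * _ `^ _).
    by rewrite /conj_exp; field; rewrite np npq np1.
  rewrite /v muleA XE -muleA; apply: lee_wpmul2l => //.
  apply: poweR_mul_le_add => //.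
  by field; rewrite np npq.
apply: (@le_trans _ _ (\sum_(i < n) s * (X i * (sig^-1)%:E + fD (lev c0 i)))).
  by apply: lee_sum => i _; exact: vX.
rewrite -ge0_sume_distrr; last by move=> i _; apply: adde_ge0.
apply: lee_wpmul2l => //; rewrite big_split/=; apply: leeD; last exact: fD_sum.
rewrite -ge0_sume_distrl; last by move=> i _; exact: X0.
rewrite lee_pdivrMr//; apply: le_trans (disjoint_tails_sum n mE tE Ex).
apply: lee_sum => i _; apply: lee_wpmul2l; first exact: poweR_ge0.
by apply: le_poweR; [exact: kernel_pow_ge0|exact: phW|rewrite addr_ge0// ltW].
Qed.

(** The values of F between lam^-n and lam^n are covered by 2n levels, F is finite
    mu-almost everywhere, and points with F = 0 do not contribute. *)
Lemma upper_bound_levels : \int[mu]_x (F x `^ q) <=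
  ((4 * h) `^ q)%:E * ((2 * (16 * h) `^ q)%:E *
    (Z + sig%:E `^ b^-1 * (2%:E `^ (a + 1) + 2%:E))).
Proof.
have mFq : measurable_fun [set: R] (fun x => F x `^ q) by exact: measurable_fun_poweR.
pose P := [set x : RT | F x = +oo].
have mP : measurable P by rewrite -[X in measurable X]setTI; exact: measurable_eqe.
have P0 : mu P = 0 by exact: measure_infinite_level.
rewrite (ge0_negligible_integral mP measurableT mFq _ P0); last first.
  by move=> x _; exact: poweR_ge0.
pose B n := [set x : RT | ((lam ^+ n)^-1)%:E <= F x] `&`
  [set x : RT | F x < (lev (lam ^+ n)^-1 (n + n))%:E].
have lamn0 n : (0 < lam ^+ n)%R by exact: exprn_gt0.
have levE n : lev (lam ^+ n)^-1 (n + n) = (lam ^+ n)%R.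
  by rewrite /lev exprD mulrA mulVf ?mul1r// lt0r_neq0.
have mB n : measurable (B n).
  apply: measurableI; rewrite -[X in measurable X]setTI.
  - exact: emeasurable_fun_c_infty.
  - exact: emeasurable_fun_infty_o.
have BS n : B n `<=` B n.+1.
  move=> x [/= nF Fn]; split => /=.
    apply: le_trans nF; rewrite lee_fin lef_pV2 ?posrE// exprS ler_peMl//.
    exact: ltW.
  by apply: lt_le_trans Fn _; rewrite !levE lee_fin exprS ler_peMl// ltW.
have mr (D : set RT) : measurable D -> measurable_fun [set: R] ((fun x => F x `^ q) \_ D).
  by move=> mD; exact: (iffLR (measurable_restrictT _ mD) (measurable_funTS mFq)).
have r0 (D : set RT) x : 0 <= ((fun x => F x `^ q) \_ D) x.
  by apply: erestrict_ge0 => y _; exact: poweR_ge0.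
rewrite integral_mkcond.
apply: (@ge0_integral_le_nd _ _ _ mu _ (fun n => (fun x => F x `^ q) \_ (B n))).
- by apply: mr; exact: measurableD.
- exact: r0.
- by move=> n; exact: mr.
- by move=> n; exact: r0.
- move=> x; apply/nondecreasing_seqP => n; rewrite !patchE.
  case: ifPn => xn; last by case: ifP => // _; exact: poweR_ge0.
  by rewrite ifT// inE; apply: BS; rewrite inE in xn.
- move=> x d xd; have d0 : 0 <= d by apply: le_trans (xd 0%N); exact: r0.
  rewrite patchE; case: ifPn => //; rewrite inE => -[_ /= Foo].
  have [F_0|Fn0] := eqVneq (F x) 0; first by rewrite F_0 poweR0r ?gt_eqF.
  have Ffin : F x \is a fin_num by rewrite ge0_fin_numE ?F0// ltey; apply/eqP.
  have fF : (0 < fine (F x))%R by rewrite fine_gt0// lt0e Fn0 F0 ltey; apply/eqP.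
  have big (r : R) : (0 <= r)%R -> exists n, (r < lam ^+ n)%R.
    move=> r_0; exists (Num.bound r); apply: (lt_trans (archi_boundP r_0)).
    apply: (@lt_le_trans _ _ (2 ^+ Num.bound r)%R).
      by rewrite -natrX ltr_nat ltn_expl.
    by rewrite lerXn2r ?nnegrE ?(ltW lam0)// /lam; have := h1 => ?; lra.
  have [n1 Fn1] := big _ (ltW fF).
  have [n2 Fn2] : exists n, ((fine (F x))^-1 < lam ^+ n)%R.
    by apply: big; rewrite invr_ge0 ltW.
  have Bx : B (maxn n1 n2) x.
    split; rewrite /= -(fineK Ffin) ?levE ?lee_fin ?lte_fin.
      rewrite invf_ple ?posrE//; apply: (le_trans (ltW Fn2)).
      by rewrite ler_weXn2l// leq_maxr.
    by apply: (lt_le_trans Fn1); rewrite ler_weXn2l// leq_maxl.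
  by have := xd (maxn n1 n2); rewrite patchE ifT// inE.
- move=> n; rewrite -integral_mkcond; apply: levels_integral.
  by rewrite invr_gt0.
Qed.

End Blocks.

(** * Hardy's inequality and the upper bound *)

Section Hardy.
Context {R : realType} (p q : R) (hq : 1 < q) (hqp : q < p).
Local Open Scope ereal_scope.
Local Notation RT := (measurableTypeR R).
Local Notation leb := (@lebesgue_measure R).
Local Notation p' := (conj_exp p).
Local Notation b := (p / (p - q))%R.
Local Notation a := (p * (q - 1) / (p - q))%R.
Variables (g f : R -> R) (sig : R).
Hypothesis mg : measurable_fun [set: R] g.
Hypothesis g0 : forall s, (0 <= g s)%R.
Hypothesis g_neg : forall s, (s <= 0)%R -> g s = 0%R.
Hypothesis mf : measurable_fun [set: R] f.
Hypothesis f0 : forall s, (0 <= f s)%R.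
Hypothesis fp1 : \int[leb]_s ((f s)%:E `^ p) <= 1.
Hypothesis sig0 : (0 < sig)%R.
Let Rg t := \int[leb]_(s in `]-oo, t]) ((g s)%:E * (f s)%:E).

(** For this kernel the splitting condition holds with outer kernel 0. *)
Let kH x s := if (s <= x)%R then g s else 0%R.

Let hkH : positive_kernel kH.
Proof.
split.
- apply: measurable_fun_ifT => //.
    exact: (measurable_fun_ler (measurable_snd : measurable_fun setT (@snd RT RT)) measurable_fst).
  exact: (measurableT_comp mg measurable_snd).
- by move=> x s; rewrite /kH; case: ifP.
- move=> x y s xy; rewrite /kH; case: ifPn => sx; last by case: ifP.
  by rewrite (le_trans sx xy).
Qed.

Let kH_op x : kernel_op kH (EFin \o f) x = Rg x.
Proof.
rewrite /Rg integral_headE; apply: eq_integral => s _.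
by rewrite /kH; case: ifP => // _; rewrite mul0e.
Qed.

Let p'0 : (0 < p')%R. Proof. exact: conj_exp_gt0 hq hqp. Qed.

Let kH_pow x : kernel_pow p' kH x = head_pow p g x.
Proof.
rewrite /head_pow integral_headE; apply: eq_integral => s _.
by rewrite /kH; case: ifP => // _; rewrite poweR0r ?gt_eqF.
Qed.

Let mw : measurable_fun [set: R] (fun s => (g s)%:E `^ p').
Proof. by apply: measurable_fun_poweR; exact/measurable_EFinP. Qed.

(** Hardy's inequality for an arbitrary measure nu: the level argument for the
    kernel kH, with the measure nu and the density g^p'. No outer sums occur. *)
Lemma hardy (nu : {measure set RT -> \bar R}) :
  \int[leb]_y (tail_mass nu y `^ b * head_pow p g y `^ a * (g y)%:E `^ p') <= sig%:E ->
  \int[nu]_x (Rg x `^ q) <= (4 `^ q)%:E * ((2 * 16 `^ q)%:E *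
    (sig%:E `^ b^-1 * (2%:E `^ (a + 1) + 2%:E))).
Proof.
move=> nusig.
have := @upper_bound_levels R p q hq hqp 1 kH (fun _ _ => 0%R) (fun _ => 0%R) (lexx 1%R) hkH.
rewrite !mulr1 -[sig%:E `^ _ * _]add0e.
under eq_integral => x _ do rewrite -kH_op.
apply.
- by move=> x s xs; rewrite /kH leNgt xs.
- exact: measurable_cst.
- by [].
- by [].
- exact: measurable_cst.
- by [].
- move=> x t s st tx; rewrite mul1r mul0r add0r /kH st (le_trans st tx).
  exact: lexx.
- exact: mw.
- by move=> x; exact: poweR_ge0.
- exact: (fun x => erefl (head_pow p g x)).
- by move=> x; rewrite kH_pow.
- exact: sig0.
- exact: nusig.
- exact: mf.
- exact: f0.
- exact: fp1.
- move=> n E t mE tE Et; rewrite big1// => i _.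
  under eq_integral => y _ do rewrite poweR0r ?(gt_eqF (lt_trans ltr01 hq))//.
  by rewrite integral0 mul0e.
Qed.

Variables (kap : R -> R -> R) (mu : {measure set RT -> \bar R}).
Hypothesis mkap : measurable_fun (setT : set (RT * RT)) (fun z => kap z.1 z.2).
Hypothesis kap0 : forall x s, (0 <= kap x s)%R.
Hypothesis kap_anti : forall x s t, (0 < s)%R -> (s <= t)%R -> (kap x t <= kap x s)%R.
Local Notation U := (kernel_tail q kap mu).
Hypothesis Usig :
  \int[leb]_z (U z `^ b * head_pow p g z `^ a * (g z)%:E `^ p') <= sig%:E.

(** U is antitone only for z > 0; on the rest of the line g vanishes, and the value
    +oo makes the function antitone everywhere. *)
Let U1 z := if (0 < z)%R then U z else +oo.

Let U1_anti : {homo U1 : x y / (x <= y)%R >-> y <= x}.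
Proof.
move=> x y xy; rewrite /U1; case: ifPn => y0; case: ifPn => x0.
- exact: (kernel_tail_anti hq hqp mkap kap0 kap_anti).
- by rewrite leey.
- by move: y0; rewrite (lt_le_trans x0 xy).
- by [].
Qed.

Let U0 z : 0 <= U z. Proof. by apply: integral_ge0 => x _; exact: poweR_ge0. Qed.

Let U10 z : 0 <= U1 z. Proof. by rewrite /U1; case: ifP. Qed.

Let U1E z : U1 z `^ b * head_pow p g z `^ a * (g z)%:E `^ p' =
  U z `^ b * head_pow p g z `^ a * (g z)%:E `^ p'.
Proof.
rewrite /U1; case: ltP => // z0.
by rewrite g_neg// poweR0r ?gt_eqF// !mule0.
Qed.

Let U1sig :
  \int[leb]_z (U1 z `^ b * head_pow p g z `^ a * (g z)%:E `^ p') <= sig%:E.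
Proof. by under eq_integral => z _ do rewrite U1E. Qed.

Let head_pow0 t : 0 <= head_pow p g t.
Proof. by apply: integral_ge0 => s _; exact: poweR_ge0. Qed.

(** By finiteness of the functional, G(t) = 0 where U(t) is infinite. This settles
    the infinite coefficients, which cannot be masses of a discrete measure. *)
Let Rg_eq0 t : U t = +oo -> Rg t = 0.
Proof.
move=> Uoo.
have [a0 b0] := (alpha_gt0 hq hqp, beta_gt0 hq hqp).
have hp : (1 < p)%R by exact: lt_trans hq hqp.
have G0 : head_pow p g t = 0.
  have H := antitone_head_le leb mw (fun s => poweR_ge0 _ _) U10 U1_anti (ltW a0) (ltW b0) t.
  have U1oo : U1 t = +oo by rewrite /U1 Uoo; case: ifP.
  have [//|Gn0] := eqVneq (head_pow p g t) 0.
  have : U1 t `^ b * head_pow p g t `^ (a + 1) <= 2%:E `^ (a + 1) * sig%:E.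
    apply: (le_trans H); apply: lee_wpmul2l; first exact: poweR_ge0.
    exact: U1sig.
  rewrite U1oo poweRyr ?gt_eqF// gt0_mulye; last by rewrite poweR_gt0// lt0e Gn0 head_pow0.
  by rewrite poweR_EFin -EFinM leye_eq.
apply/eqP; rewrite eq_le; apply/andP; split; last first.
  by apply: integral_ge0 => s _; rewrite mule_ge0// lee_fin.
rewrite -kH_op /kernel_op.
apply: (le_trans (@hoelder_set _ _ hp _ _ _ measurableT (kernel_section_meas t hkH) mf
  (pk_ge0 hkH t) f0)).
rewrite -/(kernel_pow p' kH t) kH_pow G0 poweR0r ?mul0e// invr_eq0.
by rewrite gt_eqF.
Qed.

(** The sum is the integral of Rg^q for nu = sum_i u_i delta_(t_i), where u_i is the
    integral over E_i. As kap is antitone in its second variable, nu [y,oo) is at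
    most the sum of the integrals of kap(.,y)^q over disjoint sets, that is, at most
    U(y). *)
Lemma discrete_hardy n (E : nat -> set RT) (t : nat -> R) :
  (forall i, measurable (E i)) -> trivIset setT E ->
  (forall i, E i `<=` `[t i, +oo[%classic) ->
  \sum_(i < n) (\int[mu]_(y in E i) ((kap y (t i))%:E `^ q)) * Rg (t i) `^ q <=
    (4 `^ q)%:E * ((2 * 16 `^ q)%:E * (sig%:E `^ b^-1 * (2%:E `^ (a + 1) + 2%:E))).
Proof.
move=> mE tE Et.
have [a0 b0] := (alpha_gt0 hq hqp, beta_gt0 hq hqp).
have q0 : (0 < q)%R by case: (exponent_gt0 hq hqp).
pose u i := \int[mu]_(y in E i) ((kap y (t i))%:E `^ q).
have u0 i : 0 <= u i by apply: integral_ge0 => y _; exact: poweR_ge0.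
pose c i : {nonneg R} := NngNum (fine_ge0 (u0 i)).
pose nu : {measure set RT -> \bar R} := msum (fun i => mscale (c i) (dirac (t i : RT))) n.
have mRg : measurable_fun [set: R] (fun x => Rg x `^ q).
  apply: measurable_fun_poweR; apply: (measurable_head leb).
    by apply: emeasurable_funM; exact/measurable_EFinP.
  by move=> s; rewrite mule_ge0// lee_fin.
have intnu : \int[nu]_x (Rg x `^ q) = \sum_(i < n) (fine (u i))%:E * Rg (t i) `^ q.
  rewrite ge0_integral_measure_sum//; last by move=> x _; exact: poweR_ge0.
  apply: eq_bigr => i _; rewrite ge0_integral_mscale//; last by move=> x _; exact: poweR_ge0.
  by rewrite integral_dirac//= diracT mul1e.
have -> : \sum_(i < n) (\int[mu]_(y in E i) ((kap y (t i))%:E `^ q)) * Rg (t i) `^ q =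
    \int[nu]_x (Rg x `^ q).
  rewrite intnu; apply: eq_bigr => i _; rewrite -/(u i).
  have [uoo|ufin] := eqVneq (u i) +oo; last by rewrite fineK// ge0_fin_numE// ltey.
  rewrite (_ : Rg (t i) = 0) ?poweR0r ?gt_eqF// ?mule0//.
  apply: Rg_eq0; apply/eqP; rewrite -leye_eq -uoo.
  apply: ge0_subset_integral; [exact: mE|exact: measurableT| |by move=> y _; exact: poweR_ge0
    |exact: subsetT].
  apply: measurable_fun_poweR; apply/measurable_EFinP.
  exact: (measurableT_comp mkap (pair2_measurable (t i))).
apply: hardy; apply: le_trans U1sig.
have U1E' : measurable_fun [set: R] U1 by exact: nonincreasing_emeasurable.
have mG : measurable_fun [set: R] (head_pow p g).
  exact: (measurable_head leb mw (fun s => poweR_ge0 _ _)).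
apply: ge0_le_integral; first exact: measurableT.
- by move=> y _; apply: mule_ge0; [apply: mule_ge0|]; exact: poweR_ge0.
- apply: emeasurable_funM; last exact: mw.
  by apply: emeasurable_funM; apply: measurable_fun_poweR; [exact: measurable_tail_mass|].
- apply: emeasurable_funM; last exact: mw.
  by apply: emeasurable_funM; exact: measurable_fun_poweR.
move=> y _; apply: lee_wpmul2r; first exact: poweR_ge0.
apply: lee_wpmul2r; first exact: poweR_ge0.
apply: le_poweR; [exact: tail_mass_ge0| |exact: ltW].
rewrite /U1; case: ifPn => [y0|_]; last exact: leey.
have tail_nu : tail_mass nu y = \sum_(i < n) (fine (u i))%:E * \d_(t i) (`[y, +oo[%classic : set RT).
  by [].
rewrite tail_nu.
have mky : measurable_fun [set: R] (fun x => (kap x y)%:E `^ q).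
  apply: measurable_fun_poweR; apply/measurable_EFinP.
  exact: (measurableT_comp mkap (pair2_measurable y)).
apply: (@le_trans _ _ (\sum_(i < n) \int[mu]_(x in E i) ((kap x y)%:E `^ q))).
  apply: lee_sum => i _; rewrite diracE.
  have Iy0 : 0 <= \int[mu]_(x in E i) ((kap x y)%:E `^ q).
    by apply: integral_ge0 => x _; exact: poweR_ge0.
  case: (boolP (t i \in _)) => [|_]; last by rewrite mule0.
  rewrite mem_setE/= in_itv/= andbT mule1 => yt.
  apply: (@le_trans _ _ (u i)).
    by have := u0 i; case: (u i) => [r||]//= _; rewrite leey.
  apply: ge0_le_integral; first exact: mE.
  - by move=> x _; exact: poweR_ge0.
  - apply: measurable_funTS; apply: measurable_fun_poweR; apply/measurable_EFinP.
    exact: (measurableT_comp mkap (pair2_measurable (t i))).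
  - exact: measurable_funTS.
  - move=> x _; rewrite ?poweR_EFin lee_fin; apply: ge0_ler_powR; rewrite ?nnegrE ?kap_anti//.
    exact: ltW.
rewrite -(big_mkord xpredT (fun i => \int[mu]_(x in E i) ((kap x y)%:E `^ q))).
rewrite -ge0_integral_bigsetU; [|exact: mE|exact: iota_uniq
  |by apply: sub_trivIset tE|exact: measurable_funTS|by move=> s _; exact: poweR_ge0].
apply: ge0_subset_integral; [|exact: measurableT|exact: mky|by move=> s _; exact: poweR_ge0
  |exact: subsetT].
by apply: bigsetU_measurable => i _; exact: mE.
Qed.

End Hardy.

Section UpperBound.
Context {R : realType} (p q : R) (hq : 1 < q) (hqp : q < p).
Local Open Scope ereal_scope.
Local Notation RT := (measurableTypeR R).
Local Notation leb := (@lebesgue_measure R).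
Local Notation p' := (conj_exp p).
Local Notation b := (p / (p - q))%R.
Local Notation a := (p * (q - 1) / (p - q))%R.

Definition upper_constant (h : R) : \bar R := ((4 * h) `^ q)%:E * ((2 * (16 * h) `^ q)%:E *
  ((4 `^ q)%:E * (2 * 16 `^ q)%:E * (2%:E `^ (a + 1) + 2%:E) + (2%:E `^ (a + 1) + 2%:E))).

Lemma upper_bound (h : R) (k kap : R -> R -> R) (g f : R -> R)
    (mu eta : {measure set RT -> \bar R}) (W : R -> \bar R) (sig : R) :
  (1 <= h)%R -> positive_kernel k -> (forall x s, (x < s)%R -> k x s = 0%R) ->
  measurable_fun (setT : set (RT * RT)) (fun z => kap z.1 z.2) ->
  (forall x s, (0 <= kap x s)%R) ->
  (forall x y s, (x <= y)%R -> (kap x s <= kap y s)%R) ->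
  (forall x s t, (0 < s)%R -> (s <= t)%R -> (kap x t <= kap x s)%R) ->
  measurable_fun [set: R] g -> (forall s, (0 <= g s)%R) ->
  (forall s, (s <= 0)%R -> g s = 0%R) ->
  (forall x t s, (s <= t)%R -> (t <= x)%R -> (k x s <= h * (kap x t * g s + k t s))%R) ->
  (forall x, eta `]-oo, x]%classic = W x) -> (forall x, kernel_pow p' k x <= W x) ->
  (0 < sig)%R ->
  \int[eta]_x (tail_mass mu x `^ b * W x `^ a) <= sig%:E ->
  \int[leb]_z (kernel_tail q kap mu z `^ b * head_pow p g z `^ a * (g z)%:E `^ p') <= sig%:E ->
  measurable_fun [set: R] f -> (forall s, (0 <= f s)%R) ->
  \int[leb]_s ((f s)%:E `^ p) <= 1 ->
  \int[mu]_x (kernel_op k (EFin \o f) x `^ q) <= upper_constant h * sig%:E `^ b^-1.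
Proof.
move=> h1 hk ksupp mkap kap0 kap_homo kap_anti mg g0 g_neg ksplit etaW phW sig0 Ssig Usig mf f0 fp1.
pose c : \bar R := 2%:E `^ (a + 1) + 2%:E.
have c0 : 0 <= c by apply: adde_ge0; [exact: poweR_ge0|].
have := @upper_bound_levels R p q hq hqp h k kap g h1 hk ksupp mkap kap0 kap_homo mg g0 ksplit
  mu eta (cst 1) W (measurable_cst _) (fun _ => lee01) _ phW sig sig0 _ f mf f0 fp1.
move=> /(_ _ _ ((4 `^ q)%:E * ((2 * 16 `^ q)%:E * (sig%:E `^ b^-1 * c)))).
have s0 : 0 <= sig%:E `^ b^-1 by exact: poweR_ge0.
have e1 : 0 <= (4 `^ q)%:E :> \bar R by rewrite lee_fin powR_ge0.
have e2 : 0 <= (2 * 16 `^ q)%:E :> \bar R by rewrite lee_fin mulr_ge0// powR_ge0.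
move=> /(_ _ _ (discrete_hardy hq hqp mg g0 g_neg mf f0 fp1 sig0 mkap kap0 kap_anti Usig)).
have -> : ((4 * h) `^ q)%:E * ((2 * (16 * h) `^ q)%:E *
   ((4 `^ q)%:E * ((2 * 16 `^ q)%:E * (sig%:E `^ b^-1 * c)) + sig%:E `^ b^-1 * c)) =
   upper_constant h * sig%:E `^ b^-1.
  rewrite /upper_constant -/c -!muleA; congr (_ * (_ * _)).
  rewrite ge0_muleDl//; last by rewrite !mule_ge0.
  by rewrite -!muleA (muleC c).
apply.
- by move=> x; rewrite integral_cst//= mul1e.
- by under eq_integral => y _ do rewrite mule1.
Qed.

End UpperBound.

(** * Extension by zero of the half-line data *)

Section ZeroExtension.
Context {R : realType}.
Local Notation RT := (measurableTypeR R).
Local Notation leb := (@lebesgue_measure R).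

Definition ext_fun (w : R -> R) (s : R) : R := if 0 < s then w s else 0.

Definition ext_kernel (K : R -> R -> R) (x s : R) : R :=
  if (0 < s) && (s <= x) then K x s else 0.

Lemma ext_fun_neg (w : R -> R) s : s <= 0 -> ext_fun w s = 0.
Proof. by rewrite /ext_fun leNgt => /negbTE ->. Qed.

Lemma ext_fun_pos (w : R -> R) s : 0 < s -> ext_fun w s = w s.
Proof. by rewrite /ext_fun => ->. Qed.

Lemma ext_fun_ge0 (w : R -> R) s : (forall t, 0 < t -> 0 <= w t) -> 0 <= ext_fun w s.
Proof. by rewrite /ext_fun; case: ifP => // s0 /(_ _ s0). Qed.

Lemma measurable_Ipos : measurable (Ipos R : set RT).
Proof. exact: measurable_itv. Qed.

Lemma ext_funE (w : R -> R) : ext_fun w = w \_ (Ipos R).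
Proof.
by apply/funext => s; rewrite patchE mem_setE/= in_itv/= andbT.
Qed.

Lemma measurable_ext_fun (w : R -> R) : measurable_fun (Ipos R : set RT) w ->
  measurable_fun [set: R] (ext_fun w).
Proof. by move=> mw; rewrite ext_funE; exact: (iffLR (measurable_restrictT _ measurable_Ipos) mw). Qed.

Lemma measurable_Omega : measurable (@Omega R).
Proof.
rewrite (_ : @Omega R = [set xs | 0 < xs.2] `&` [set xs | xs.2 <= xs.1])//.
apply: measurableI.
  rewrite -[X in measurable X]setTI.
  have := @measurable_fun_ltr _ _ R setT (cst 0) snd (measurable_cst _) (measurable_snd : measurable_fun setT (@snd RT RT)).
  by move=> /(_ measurableT [set true] Logic.I); rewrite setTI.
have := @measurable_fun_ler _ _ R setT snd fst (measurable_snd : measurable_fun setT (@snd RT RT)) (measurable_fst : measurable_fun setT (@fst RT RT)).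
by move=> /(_ measurableT [set true] Logic.I); rewrite setTI.
Qed.

Lemma measurable_ext_kernel (K : R -> R -> R) :
  measurable_fun (@Omega R) (fun xs => K xs.1 xs.2) ->
  measurable_fun (setT : set (RT * RT)) (fun xs => ext_kernel K xs.1 xs.2).
Proof.
move=> mK; rewrite (_ : (fun _ => _) = (fun xs => K xs.1 xs.2) \_ (@Omega R)).
  exact: (iffLR (measurable_restrictT _ measurable_Omega) mK).
apply/funext => -[x s]; rewrite patchE/= /ext_kernel; case: ifPn => [/andP H|H].
  by rewrite mem_set.
by rewrite memNset// => -[/= s0 sx]; rewrite s0 sx in H.
Qed.

Lemma ext_kernel_ge0 (K : R -> R -> R) x s : (forall y t, 0 < t -> t <= y -> 0 <= K y t) ->
  0 <= ext_kernel K x s.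
Proof. by rewrite /ext_kernel; case: ifP => // /andP[s0 sx] /(_ _ _ s0 sx). Qed.

Lemma ext_kernel_homo (K : R -> R -> R) x y s : (forall y t, 0 < t -> t <= y -> 0 <= K y t) ->
  (forall x y s, 0 < s -> s <= x -> x <= y -> K x s <= K y s) ->
  x <= y -> ext_kernel K x s <= ext_kernel K y s.
Proof.
move=> K0 Kxy xy; rewrite {1}/ext_kernel; case: ifP => [/andP[s0 sx]|_]; last exact: ext_kernel_ge0.
by rewrite /ext_kernel s0 (le_trans sx xy); exact: Kxy.
Qed.

Lemma ext_kernel_in (K : R -> R -> R) x s : 0 < s -> s <= x -> ext_kernel K x s = K x s.
Proof. by rewrite /ext_kernel => -> ->. Qed.

Lemma ext_kernel_out (K : R -> R -> R) x s : x < s -> ext_kernel K x s = 0.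
Proof. by rewrite /ext_kernel ltNge => /negbTE ->; rewrite andbF. Qed.

Lemma positive_kernelM (k : R -> R -> R) (w : R -> R) : positive_kernel k ->
  measurable_fun [set: R] w -> (forall s, 0 <= w s) ->
  positive_kernel (fun x s => k x s * w s).
Proof.
move=> hk mw w0; split => [|x s|x y s xy].
- apply: measurable_funM; [exact: pk_meas hk|].
  exact: (measurableT_comp mw measurable_snd).
- by rewrite mulr_ge0 ?(pk_ge0 hk).
- by rewrite ler_wpM2r// (pk_homo hk).
Qed.

Lemma positive_ext_kernel (K : R -> R -> R) :
  measurable_fun (@Omega R) (fun xs => K xs.1 xs.2) ->
  (forall x s, 0 < s -> s <= x -> 0 <= K x s) ->
  (forall x y s, 0 < s -> s <= x -> x <= y -> K x s <= K y s) ->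
  positive_kernel (ext_kernel K).
Proof.
move=> mK K0 Kh; split; first exact: measurable_ext_kernel.
- by move=> x s; exact: ext_kernel_ge0.
- by move=> x y s; exact: ext_kernel_homo.
Qed.

End ZeroExtension.

Section Transfer.
Context {R : realType} (p q h : R) (hq : 1 < q) (hqp : q < p).
Local Open Scope ereal_scope.
Local Notation RT := (measurableTypeR R).
Local Notation leb := (@lebesgue_measure R).
Local Notation p' := (conj_exp p).
Variables (K : R -> R -> R) (r : R -> R) (K0 : R -> R -> R) (v : R -> R).
Hypothesis vpos : forall s, (0 < s)%R -> (0 < v s)%R.
Hypothesis mv : measurable_fun (Ipos R : set RT) v.
Hypothesis O1 : O1plus h K r K0.

Local Notation k := (fun x s => (ext_kernel K x s * ext_fun v s)%R).
Local Notation kap := (ext_kernel K0).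
Local Notation g := (fun s => (ext_fun r s * ext_fun v s)%R).

Lemma ext_weight_ge0 s : (0 <= ext_fun v s)%R.
Proof. by apply: ext_fun_ge0 => t /vpos/ltW. Qed.

Lemma factor_ge0 s : (0 <= g s)%R.
Proof. by rewrite mulr_ge0 ?ext_weight_ge0// ext_fun_ge0//; exact: (O1_r_ge0 O1). Qed.

Lemma measurable_factor : measurable_fun [set: R] g.
Proof.
by apply: measurable_funM; apply: measurable_ext_fun => //; exact: (O1_r_meas O1).
Qed.

Lemma factor_neg s : (s <= 0)%R -> g s = 0%R.
Proof. by move=> s0; rewrite /= !ext_fun_neg// mulr0. Qed.

Lemma oinarov_kernel : positive_kernel k.
Proof.
case: O1 => mK K_ge0 K_homo _ _ _ _ _ _ _ _.
apply: positive_kernelM; [exact: positive_ext_kernel|exact: measurable_ext_fun|].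
exact: ext_weight_ge0.
Qed.

Lemma outer_kernel : positive_kernel kap.
Proof. by case: O1 => *; exact: positive_ext_kernel. Qed.

Lemma outer_kernel_anti x s t : (0 < s)%R -> (s <= t)%R -> (kap x t <= kap x s)%R.
Proof.
move=> s0 st; rewrite {1}/ext_kernel; case: ifP => [/andP[t0 tx]|_]; last exact: (pk_ge0 outer_kernel).
by rewrite ext_kernel_in ?(le_trans st tx)//; exact: (O1_K0_anti O1).
Qed.

Lemma outer_factor_kernel : positive_kernel (fun x s => (kap x s * g s)%R).
Proof.
exact: (positive_kernelM outer_kernel measurable_factor factor_ge0).
Qed.

Lemma oinarov_split x t s : (s <= t)%R -> (t <= x)%R ->
  (k x s <= h * (kap x t * g s + k t s))%R.
Proof.
move=> st tx; have [s0|s0] := leP s 0%R.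
  by rewrite /= !(ext_fun_neg _ s0) !mulr0 addr0 mulr0.
have [_ H] := O1_ineq O1 s0 st tx.
rewrite /= !ext_kernel_in ?(lt_le_trans s0 st)//; last exact: le_trans tx.
rewrite mulrA -mulrDl mulrA ler_wpM2r ?ext_weight_ge0//.
by rewrite ext_fun_pos.
Qed.

(** The lower half of the splitting inequality at t = s. *)
Lemma outer_factor_le x s : (kap x s * g s <= h * k x s)%R.
Proof.
have h1 := O1_h_ge1 O1; have h0 : (0 < h)%R by exact: lt_le_trans h1.
have R0 : (0 <= h * k x s)%R by rewrite mulr_ge0 ?(ltW h0)//; exact: (pk_ge0 oinarov_kernel).
have [s0|s0] := leP s 0%R; first by rewrite [X in (_ * X)%R]factor_neg// mulr0.
have [sx|xs] := leP s x; last by rewrite ext_kernel_out// mul0r.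
have [H _] := O1_ineq O1 s0 (lexx s) sx.
rewrite /= mulrA [leRHS]mulrA ler_wpM2r ?ext_weight_ge0// !ext_kernel_in// ext_fun_pos//.
rewrite ler_pdivrMl// in H; apply: le_trans H; rewrite lerDl.
exact: (O1_K_ge0 O1).
Qed.

(** This holds for signed f as well: both sides are the same integral, with the same
    convention when it diverges. *)
Lemma KplusE f : Kplus K v f = kernel_op k (EFin \o ext_fun f).
Proof.
apply/funext => x; rewrite /Kplus /kernel_op integral_mkcond.
apply: eq_integral => s _; rewrite patchE mem_setE/= in_itv/= -EFinM.
rewrite /ext_kernel /ext_fun; case: ltP => s0 /=; last by rewrite !mulr0.
by case: ifP => //; rewrite !mul0r.
Qed.

Lemma phiE : phi p K v = kernel_pow p' k.
Proof.
have p'0 : p' != 0%R by rewrite gt_eqF// (conj_exp_gt0 hq hqp).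
apply/funext => x; rewrite /phi /kernel_pow integral_mkcond.
apply: eq_integral => s _; rewrite patchE mem_setE/= in_itv/= -poweR_EFin.
rewrite /ext_kernel /ext_fun; case: ltP => s0 /=; last by rewrite mulr0 powR0.
case: ifP => sx; last by rewrite mul0r powR0.
by rewrite powRM ?(O1_K_ge0 O1)// ltW// vpos.
Qed.

Lemma norm_on_IE (m : {measure set RT -> \bar R}) (e : R) (G : R -> \bar R) :
  (0 < e)%R -> norm_on_I m e G = (\int[m]_(x in Ipos R) (`|G x| `^ e)) `^ e^-1.
Proof.
move=> e0; rewrite /norm_on_I unlock [in RHS]integral_mkcond; congr (_ `^ _).
apply: eq_integral => x _; rewrite !patchE; case: ifP => // _.
by rewrite abse0 poweR0r// gt_eqF.
Qed.

Lemma norm_on_I_leb (e : R) (f : R -> R) : (0 < e)%R ->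
  norm_on_I leb e (EFin \o f) = (\int[leb]_s (`|(ext_fun f s)%:E| `^ e)) `^ e^-1.
Proof.
move=> e0; rewrite (norm_on_IE _ _ e0); apply: (congr1 (poweR^~ _)); rewrite integral_mkcond.
apply: eq_integral => x _; rewrite patchE mem_setE/= in_itv/= andbT /ext_fun.
by case: ifP => // _; rewrite normr0 powR0// gt_eqF.
Qed.

End Transfer.

(** * Norms of the operator *)

Section Signed.
Context {R : realType}.
Local Open Scope ereal_scope.
Local Notation RT := (measurableTypeR R).
Local Notation leb := (@lebesgue_measure R).
Variables (k : R -> R -> R) (F : R -> \bar R).
Hypothesis hk : positive_kernel k.
Hypothesis mF : measurable_fun [set: R] F.

Lemma measurable_kernel_op_signed : measurable_fun [set: R] (kernel_op k F).
Proof.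
have pos x s : 0 <= (k x s)%:E by rewrite lee_fin (pk_ge0 hk).
have -> : kernel_op k F = kernel_op k F^\+ \- kernel_op k F^\-.
  apply/funext => x; rewrite /kernel_op integralE; congr (_ - _); apply: eq_integral => s _.
    by rewrite !funeposE maxe_pMr// mule0.
  by rewrite !funenegE -muleN maxe_pMr// mule0.
apply: emeasurable_funB; apply: measurable_kernel_op => //.
- exact: measurable_funepos.
- exact: measurable_funeneg.
Qed.

Lemma kernel_op_abse_le x : `|kernel_op k F x| <= kernel_op k (abse \o F) x.
Proof.
apply: le_trans (le_abse_integral _ _ _) _ => //.
  by apply: emeasurable_funM => //; apply/measurable_EFinP; exact: kernel_section_meas.
rewrite le_eqVlt; apply/orP; left; apply/eqP; apply: eq_integral => s _.
by rewrite abseM gee0_abs// lee_fin (pk_ge0 hk).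
Qed.

End Signed.

Section OperatorNorm.
Context {R : realType}.
Local Open Scope ereal_scope.
Implicit Types (A x : \bar R) (N e : R).

(** Used to avoid dividing by a norm, which may be zero: the bound is proved for
    every positive t above it. *)
Lemma lee_mul_of_fin A x N : (0 <= N)%R -> 0 <= x -> x < +oo ->
  (forall t : R, (0 < t)%R -> x <= t%:E -> A <= (N * t)%:E) -> A <= N%:E * x.
Proof.
move=> N0; case: x => [x||]// x0 _ H; apply/lee_addgt0Pr => e e0.
have N1 : (0 < N + 1)%R by rewrite ltr_wpDl.
have d0 : (0 < e / (N + 1))%R by rewrite divr_gt0.
apply: (le_trans (H (x + e / (N + 1))%R _ _)).
- by rewrite ltr_wpDl.
- by rewrite lee_fin lerDl ltW.
- rewrite -EFinM -EFinD lee_fin mulrDr lerD2l mulrCA ger_pMr//.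
  by rewrite ler_pdivrMr// mul1r lerDl.
Qed.

End OperatorNorm.

Section Norms.
Context {R : realType} (p q h : R) (hq : 1 < q) (hqp : q < p).
Local Open Scope ereal_scope.
Local Notation RT := (measurableTypeR R).
Local Notation leb := (@lebesgue_measure R).
Variables (K : R -> R -> R) (r : R -> R) (K0 : R -> R -> R) (v : R -> R).
Hypothesis vpos : forall s, (0 < s)%R -> (0 < v s)%R.
Hypothesis mv : measurable_fun (Ipos R : set RT) v.
Hypothesis O1 : O1plus h K r K0.
Variable mu : {measure set RT -> \bar R}.
Local Notation mu' := (mrestr mu (@measurable_Ipos R)).
Local Notation k := (fun x s => (ext_kernel K x s * ext_fun v s)%R).

Let hk : positive_kernel k. Proof. exact: (oinarov_kernel vpos mv O1). Qed.

Lemma in_Lp_meas (f : R -> R) : in_Lp p f -> measurable_fun [set: R] (ext_fun f).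
Proof. by case=> mf _; exact: measurable_ext_fun. Qed.

Lemma norm_Kplus (f : R -> R) : measurable_fun [set: R] (ext_fun f) ->
  norm_on_I mu q (Kplus K v f) =
  (\int[mu']_x (`|kernel_op k (EFin \o ext_fun f) x| `^ q)) `^ q^-1.
Proof.
have [q0 p0 p10 pq0 q10] := exponent_gt0 hq hqp.
move=> mf; rewrite norm_on_IE// (KplusE K v); congr (_ `^ _).
rewrite ge0_integral_mrestr//; last by move=> x; exact: poweR_ge0.
apply: measurable_fun_poweR; apply: measurableT_comp => //.
by apply: measurable_kernel_op_signed => //; exact/measurable_EFinP.
Qed.

Lemma norm_on_I_ge0 (m : {measure set RT -> \bar R}) e G : (0 < e)%R -> 0 <= norm_on_I m e G.
Proof. by move=> e0; rewrite norm_on_IE// poweR_ge0. Qed.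

(** Reduction to nonnegative functions, whose images scale without any condition of
    integrability. *)
Lemma norm_Kplus_le_abs (f : R -> R) : measurable_fun [set: R] (ext_fun f) ->
  norm_on_I mu q (Kplus K v f) <= norm_on_I mu q (Kplus K v (fun s => `|f s|)%R).
Proof.
have [q0 p0 p10 pq0 q10] := exponent_gt0 hq hqp.
have abs_ext : ext_fun (fun s => `|f s|)%R = (fun s => `|ext_fun f s|)%R.
  by apply/funext => s; rewrite /ext_fun; case: ifP; rewrite // normr0.
move=> mf; have maf : measurable_fun [set: R] (ext_fun (fun s => `|f s|)%R).
  by rewrite abs_ext; exact: measurableT_comp.
rewrite (norm_Kplus mf) (norm_Kplus maf); apply: le_poweR.
- by apply: integral_ge0 => x _; exact: poweR_ge0.
- apply: ge0_le_integral => //.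
  + by move=> x _; exact: poweR_ge0.
  + apply: measurable_fun_poweR; apply: measurableT_comp => //.
    by apply: measurable_kernel_op_signed => //; exact/measurable_EFinP.
  + apply: measurable_fun_poweR; apply: measurableT_comp => //.
    by apply: measurable_kernel_op_signed => //; exact/measurable_EFinP.
  + move=> x _; apply: le_poweR; [exact: abse_ge0| |exact: ltW].
    rewrite abs_ext [leRHS]gee0_abs; last by apply: kernel_op_ge0 => // s; rewrite lee_fin.
    exact: (@kernel_op_abse_le _ k (EFin \o ext_fun f) hk (iffRL (measurable_EFinP _ _) mf)).
- by rewrite invr_ge0 ltW.
Qed.

Lemma ext_funZ (f : R -> R) (c : R) : ext_fun (fun s => c * f s)%R = (fun s => c * ext_fun f s)%R.
Proof. by apply/funext => s; rewrite /ext_fun; case: ifP; rewrite // mulr0. Qed.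

Lemma norm_Kplus_scale (f : R -> R) (c : R) : (0 < c)%R ->
  measurable_fun [set: R] (ext_fun f) -> (forall s, 0 <= ext_fun f s)%R ->
  norm_on_I mu q (Kplus K v (fun s => c * f s)%R) = c%:E * norm_on_I mu q (Kplus K v f).
Proof.
have [q0 p0 p10 pq0 q10] := exponent_gt0 hq hqp.
move=> c0 mf f0; have mcf : measurable_fun [set: R] (ext_fun (fun s => c * f s)%R).
  by rewrite ext_funZ; exact: measurable_funM.
have mop : measurable_fun [set: R] (kernel_op k (EFin \o ext_fun f)).
  by apply: measurable_kernel_op_signed => //; exact/measurable_EFinP.
rewrite !norm_Kplus//.
have E x : kernel_op k (EFin \o ext_fun (fun s => c * f s)%R) x =
    c%:E * kernel_op k (EFin \o ext_fun f) x.
  rewrite ext_funZ /kernel_op -ge0_integralZl//=; last 3 first.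
  - apply: emeasurable_funM; apply/measurable_EFinP; [exact: kernel_section_meas hk|exact: mf].
  - by move=> s _; rewrite -EFinM lee_fin mulr_ge0// (pk_ge0 hk).
  - by rewrite lee_fin ltW.
  by apply: eq_integral => s _; rewrite EFinM muleCA.
under eq_integral => x _ do rewrite E abseM poweRM//.
rewrite ge0_integralZl//; last 3 first.
- by apply: measurable_fun_poweR; exact: measurableT_comp.
- by move=> x _; exact: poweR_ge0.
- exact: poweR_ge0.
rewrite poweRM ?poweR_ge0//; last by apply: integral_ge0 => x _; exact: poweR_ge0.
by rewrite poweRrK ?mulfV ?gt_eqF// gee0_abs// lee_fin ltW.
Qed.

Lemma norm_Lp_scale (f : R -> R) (c : R) : (0 < c)%R -> measurable_fun [set: R] (ext_fun f) ->
  norm_on_I leb p (EFin \o (fun s => c * f s)%R) = c%:E * norm_on_I leb p (EFin \o f).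
Proof.
have [q0 p0 p10 pq0 q10] := exponent_gt0 hq hqp.
move=> c0 mf; rewrite !norm_on_I_leb// ext_funZ.
under eq_integral => s _ do rewrite EFinM abseM poweRM//.
rewrite ge0_integralZl//; last 3 first.
- apply: measurable_fun_poweR; apply: measurableT_comp => //; exact/measurable_EFinP.
- by move=> x _; exact: poweR_ge0.
- exact: poweR_ge0.
rewrite poweRM ?poweR_ge0//; last by apply: integral_ge0 => x _; exact: poweR_ge0.
by rewrite poweRrK ?mulfV ?gt_eqF// gee0_abs// lee_fin ltW.
Qed.

Lemma norm_Lp_abs (f : R -> R) :
  norm_on_I leb p (EFin \o (fun s => `|f s|)%R) = norm_on_I leb p (EFin \o f).
Proof.
have [q0 p0 p10 pq0 q10] := exponent_gt0 hq hqp.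
rewrite !(norm_on_I_leb _ p0); apply: (congr1 (poweR^~ _)); apply: eq_integral => s _; congr (_ `^ _).
by rewrite /ext_fun; case: ifP => //= _; rewrite normr_id.
Qed.

Lemma Kplus_norm_ge0 : 0 <= Kplus_norm p q mu K v.
Proof.
have [q0 p0 p10 pq0 q10] := exponent_gt0 hq hqp.
have Z : norm_on_I leb p (EFin \o cst 0%R) = 0.
  rewrite norm_on_I_leb//; under eq_integral => s _.
    rewrite /ext_fun; rewrite (_ : (if _ then _ else _) = 0%R) ?abse0 ?poweR0r ?gt_eqF//; last by case: ifP.
    over.
  by rewrite integral0 poweR0r// gt_eqF// invr_gt0.
apply: (@le_trans _ _ (norm_on_I mu q (Kplus K v (cst 0%R)))); first exact: norm_on_I_ge0.
apply: ereal_sup_ubound; exists (cst 0%R) => //; split; last by rewrite Z.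
by split; [exact: measurable_cst|rewrite Z].
Qed.

Lemma Kplus_le_norm (N : R) (f : R -> R) : Kplus_norm p q mu K v = N%:E -> in_Lp p f ->
  norm_on_I mu q (Kplus K v f) <= N%:E * norm_on_I leb p (EFin \o f).
Proof.
have [q0 p0 p10 pq0 q10] := exponent_gt0 hq hqp.
move=> NE fLp; have mf := in_Lp_meas fLp; case: (fLp) => mfI foo.
have N0 : (0 <= N)%R by rewrite -lee_fin -NE Kplus_norm_ge0.
apply: le_trans (norm_Kplus_le_abs mf) _.
apply: lee_mul_of_fin => //; first exact: norm_on_I_ge0.
move=> t t0 ft; pose af s : R := `|f s|%R.
have mafI : measurable_fun (Ipos R : set RT) af by exact: measurableT_comp.
have maf : measurable_fun [set: R] (ext_fun af) by exact: measurable_ext_fun.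
have nf : norm_on_I leb p (EFin \o (fun s => t^-1 * af s)%R) <= 1.
  rewrite norm_Lp_scale ?invr_gt0// norm_Lp_abs muleC lee_pdivrMr// mul1e//.
have : norm_on_I mu q (Kplus K v (fun s => t^-1 * af s)%R) <= N%:E.
  rewrite -NE; apply: ereal_sup_ubound; exists (fun s => t^-1 * af s)%R => //.
  split => //; split; last exact: le_lt_trans nf (ltry _).
  exact: measurable_funM.
rewrite norm_Kplus_scale ?invr_gt0//; last by move=> s; apply: ext_fun_ge0 => y _; exact: normr_ge0.
by rewrite muleC lee_pdivrMr// -EFinM.
Qed.

End Norms.

(** * The two functionals as integrals over the line *)

Section Weights.
Context {R : realType} (p q h : R) (hq : 1 < q) (hqp : q < p).
Local Open Scope ereal_scope.
Local Notation RT := (measurableTypeR R).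
Local Notation leb := (@lebesgue_measure R).
Local Notation p' := (conj_exp p).
Local Notation b := (p / (p - q))%R.
Local Notation a := (p * (q - 1) / (p - q))%R.
Variables (K : R -> R -> R) (r : R -> R) (K0 : R -> R -> R) (v : R -> R).
Hypothesis vpos : forall s, (0 < s)%R -> (0 < v s)%R.
Hypothesis mv : measurable_fun (Ipos R : set RT) v.
Hypothesis O1 : O1plus h K r K0.
Variables mu eta : {measure set RT -> \bar R}.
Local Notation mu' := (mrestr mu (@measurable_Ipos R)).
Local Notation eta' := (mrestr eta (@measurable_Ipos R)).
Local Notation k := (fun x s => (ext_kernel K x s * ext_fun v s)%R).
Local Notation kap := (ext_kernel K0).
Local Notation g := (fun s => (ext_fun r s * ext_fun v s)%R).
Local Notation ph := (kernel_pow p' k).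

Let hk : positive_kernel k. Proof. exact: (oinarov_kernel vpos mv O1). Qed.
Let hkap : positive_kernel kap. Proof. exact: (outer_kernel O1). Qed.
Let p'0 : (0 < p')%R. Proof. exact: conj_exp_gt0 hq hqp. Qed.

(** A test function with values in [0,+oo] and finite norm is finite almost
    everywhere, hence may be replaced by its real part. *)
Lemma operator_bound_of_norm (N : R) : Kplus_norm p q mu K v = N%:E ->
  operator_bound p q mu' k (N `^ q).
Proof.
have [q0 p0 p10 pq0 q10] := exponent_gt0 hq hqp.
move=> NE F mF F0 Foo.
have N0 : (0 <= N)%R by rewrite -lee_fin -NE Kplus_norm_ge0.
pose f s := fine (F s).
have mf : measurable_fun [set: R] f by exact: measurableT_comp.
have mfI : measurable_fun (Ipos R : set RT) f by exact: measurable_funTS.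
have mef : measurable_fun [set: R] (ext_fun f) by exact: measurable_ext_fun.
have f0 s : (0 <= f s)%R by exact: fine_ge0.
have ef0 s : (0 <= ext_fun f s)%R by exact: ext_fun_ge0.
have S0 : 0 <= \int[leb]_s (F s `^ p) by apply: integral_ge0 => s _; exact: poweR_ge0.
have mFp : measurable_fun [set: R] (fun s => F s `^ p) by exact: measurable_fun_poweR.
have nf : norm_on_I leb p (EFin \o f) <= (\int[leb]_s (F s `^ p)) `^ p^-1.
  rewrite norm_on_I_leb//; apply: le_poweR; last by rewrite invr_ge0 ltW.
    by apply: integral_ge0 => s _; exact: poweR_ge0.
  apply: ge0_le_integral => //.
  - by move=> s _; exact: poweR_ge0.
  - by apply: measurable_fun_poweR; apply: measurableT_comp => //; exact/measurable_EFinP.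
  - move=> s _; apply: le_poweR; [exact: abse_ge0| |exact: ltW].
    rewrite gee0_abs ?lee_fin//; rewrite /ext_fun; case: ifP => // _.
    by rewrite /f; have := F0 s; case: (F s) => //= *; rewrite leey.
have fLp : in_Lp p f by split => //; apply: le_lt_trans nf _; exact: poweR_lty.
have opE x : kernel_op k F x = kernel_op k (EFin \o ext_fun f) x.
  have mk : measurable_fun [set: R] (fun s => (k x s)%:E).
    by apply/measurable_EFinP; exact: kernel_section_meas hk.
  apply: ge0_ae_eq_integral => //.
  - exact: emeasurable_funM.
  - by apply: emeasurable_funM => //; exact/measurable_EFinP.
  - by move=> s _; rewrite mule_ge0// lee_fin; exact: (pk_ge0 hk).
  - by move=> s _; apply: mule_ge0; rewrite lee_fin; [exact: (pk_ge0 hk)|exact: ef0].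
  have : leb.-integrable [set: R] (fun s => F s `^ p).
    apply/integrableP; split => //.
    by under eq_integral => s _ do rewrite gee0_abs ?poweR_ge0//.
  move=> /(integrable_ae measurableT); apply: filterS => s /= /(_ Logic.I) Ffin _.
  have [s0|s0] := leP s 0%R; first by rewrite [ext_fun v s]ext_fun_neg// mulr0 !mul0e.
  congr (_ * _); rewrite /= ext_fun_pos// /f fineK//; move: Ffin (F0 s); case: (F s) => //.
  by rewrite poweRyr ?gt_eqF.
have : norm_on_I mu q (Kplus K v f) <= N%:E * (\int[leb]_s (F s `^ p)) `^ p^-1.
  apply: le_trans (Kplus_le_norm hq hqp vpos mv O1 NE fLp) _.
  by apply: lee_wpmul2l; rewrite ?lee_fin.
rewrite (norm_Kplus hq hqp vpos mv O1)//.
have E : \int[mu']_x (`|kernel_op k (EFin \o ext_fun f) x| `^ q) =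
    \int[mu']_x (kernel_op k F x `^ q).
  by apply: eq_integral => x _; rewrite -opE gee0_abs ?kernel_op_ge0.
rewrite E => H.
have I0 : 0 <= \int[mu']_x (kernel_op k F x `^ q).
  by apply: integral_ge0 => x _; exact: poweR_ge0.
have qV : (q^-1 * q = 1)%R by rewrite mulVf ?gt_eqF.
rewrite -[leLHS](poweRrK I0 qV); apply: le_trans (le_poweR (poweR_ge0 _ _) H (ltW q0)) _.
by rewrite poweRM ?lee_fin ?poweR_ge0// -poweRrM (mulrC (p^-1)%R) -poweR_EFin.
Qed.

Lemma operator_bound_outer (N : R) : (0 <= N)%R -> operator_bound p q mu' k N ->
  operator_bound p q mu' (fun x s => kap x s * g s)%R (h `^ q * N).
Proof.
have [q0 p0 p10 pq0 q10] := exponent_gt0 hq hqp.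
have h0 : (0 <= h)%R by apply: le_trans (O1_h_ge1 O1).
have hkg := outer_factor_kernel vpos mv O1.
move=> N0 opN F mF F0 Foo; rewrite EFinM -muleA -poweR_EFin.
apply: (@le_trans _ _ ((h%:E `^ q) * \int[mu']_x (kernel_op k F x `^ q))); last first.
  by apply: lee_wpmul2l; [exact: poweR_ge0|exact: opN].
rewrite -ge0_integralZl//; last 3 first.
- by apply: measurable_fun_poweR; exact: measurable_kernel_op.
- by move=> x _; exact: poweR_ge0.
- exact: poweR_ge0.
apply: ge0_le_integral => //.
- by move=> x _; exact: poweR_ge0.
- by apply: measurable_fun_poweR; exact: measurable_kernel_op.
- apply: measurable_funeM.
  by apply: measurable_fun_poweR; exact: measurable_kernel_op.
move=> x _; rewrite -poweRM ?lee_fin//; last exact: kernel_op_ge0.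
apply: le_poweR; [exact: kernel_op_ge0| |exact: ltW].
have mk (k1 : R -> R -> R) : positive_kernel k1 ->
    measurable_fun [set: R] (fun s => (k1 x s)%:E * F s).
  move=> hk1; apply: emeasurable_funM => //.
  by apply/measurable_EFinP; exact: kernel_section_meas hk1.
rewrite /kernel_op -ge0_integralZl//; last 2 first.
- exact: (mk _ hk).
- by move=> s _; rewrite mule_ge0// lee_fin; exact: (pk_ge0 hk).
apply: ge0_le_integral => //.
- by move=> s _; rewrite mule_ge0// lee_fin; exact: (pk_ge0 hkg).
- exact: (mk _ hkg).
- by apply: measurable_funeM; exact: (mk _ hk).
move=> s _; rewrite muleA -EFinM; apply: lee_wpmul2r; first exact: F0.
by rewrite lee_fin; exact: (outer_factor_le vpos mv O1).
Qed.

Lemma right_lim_ge (x : R) : ph x <= right_lim ph x.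
Proof.
have nd := kernel_pow_nondecreasing hk (ltW p'0).
have cv := @nondecreasing_at_right_cvge _ ph x (BInfty _ false) _ (fun y z _ _ => nd y z).
rewrite /right_lim (cvg_lim _ (cv isT))//; apply: le_ereal_inf_tmp => _ [y /= xy <-].
by apply: nd; move: xy; rewrite in_itv/= andbT => /ltW.
Qed.

Lemma right_lim_le (x y : R) : (x < y)%R -> right_lim ph x <= ph y.
Proof.
have nd := kernel_pow_nondecreasing hk (ltW p'0).
have cv := @nondecreasing_at_right_cvge _ ph x (BInfty _ false) _ (fun y z _ _ => nd y z).
move=> xy; rewrite /right_lim (cvg_lim _ (cv isT))//; apply: ge_ereal_inf.
by exists (ph y) => //; exists y => //=; rewrite in_itv/= andbT.
Qed.

Hypothesis Seta : is_stieltjes (phi p K v) eta.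
Hypothesis atoms : forall x : R, (0 < x)%R -> 0 < mu [set x] ->
  right_lim (phi p K v) x = phi p K v x.

Local Notation W := (fun x => eta' `]-oo, x]%classic).

Lemma stieltjes_headE x : (0 < x)%R -> W x = right_lim ph x.
Proof.
move=> x0; rewrite -(phiE hq hqp vpos O1) Seta//; congr (eta _).
by apply/seteqP; split => y; rewrite /Ipos /= !in_itv/= ?andbT;
  [case=> -> ->|case/andP=> -> ->].
Qed.

Lemma mrestr_headN (x : R) : (x <= 0)%R -> W x = 0.
Proof.
move=> x0; rewrite -[RHS](measure0 eta); congr (eta _).
apply/seteqP; split => y //; rewrite /Ipos /= !in_itv/= andbT => -[yx y0].
by have := lt_le_trans y0 (le_trans yx x0); rewrite ltxx.
Qed.

Lemma kernel_powN (x : R) : (x <= 0)%R -> ph x = 0.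
Proof.
move=> x0; rewrite /kernel_pow -[RHS](integral0 leb setT); apply: eq_integral => s _.
have [xs|sx] := ltP x s.
  by rewrite ext_kernel_out// mul0r poweR0r// gt_eqF.
by rewrite ext_fun_neg ?(le_trans sx)// mulr0 poweR0r// gt_eqF.
Qed.

Lemma kernel_pow_le_head x : ph x <= W x.
Proof.
have [x0|x0] := leP x 0%R; first by rewrite kernel_powN.
by rewrite stieltjes_headE//; exact: right_lim_ge.
Qed.

Lemma head_le_kernel_pow x y : (x < y)%R -> W x <= ph y.
Proof.
have [x0|x0] := leP x 0%R => xy; first by rewrite mrestr_headN// kernel_pow_ge0.
by rewrite stieltjes_headE//; exact: right_lim_le.
Qed.

Lemma atom_continuous x : 0 < mu' [set x] -> ph x = W x.
Proof.
have [x0|x0] := leP x 0%R; first by rewrite kernel_powN// mrestr_headN.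
move=> mux; rewrite stieltjes_headE// -(phiE hq hqp vpos O1) atoms//.
apply: lt_le_trans mux _; apply: (@le_measure _ _ _ mu); rewrite ?inE//.
by apply: measurableI => //; exact: measurable_Ipos.
Qed.

Lemma tail_mass_mrestr (x : R) : (0 < x)%R -> tail_mass mu' x = mu `[x, +oo[%classic.
Proof.
move=> x0; congr (mu _); apply/setIidPl => y; rewrite /Ipos /= !in_itv/= !andbT.
exact: lt_le_trans.
Qed.

Lemma B11E : B11 p q mu eta K v =
  (\int[eta']_x (tail_mass mu' x `^ b * W x `^ a)) `^ ((p - q) / (p * q)).
Proof.
have mW : measurable_fun [set: R] W.
  apply: nondecreasing_emeasurable => x y xy; apply: le_measure; rewrite ?inE//.
  by move=> z /=; rewrite !in_itv/= => /le_trans; exact.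
congr (_ `^ _); rewrite ge0_integral_mrestr; last 2 first.
- apply: emeasurable_funM; apply: measurable_fun_poweR => //.
  exact: measurable_tail_mass.
- by move=> x; rewrite mule_ge0 ?poweR_ge0.
apply: eq_integral => x; rewrite inE /Ipos /= in_itv/= andbT => x0.
congr (_ `^ _ * _ `^ _); first by rewrite -tail_mass_mrestr.
by rewrite (phiE hq hqp vpos O1) -stieltjes_headE.
Qed.

Lemma B10E : B10 p q mu r K0 v =
  (\int[leb]_z (kernel_tail q kap mu' z `^ b * head_pow p g z `^ a * (g z)%:E `^ p'))
    `^ ((p - q) / (p * q)).
Proof.
have [q0 p0 p10 pq0 q10] := exponent_gt0 hq hqp.
rewrite /B10; congr (_ `^ _); rewrite integral_mkcond; apply: eq_integral => z _.
rewrite patchE mem_setE/= in_itv/= andbT; case: ltP => z0; last first.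
  by rewrite /= ext_fun_neg// mul0r powR0 ?mule0// gt_eqF.
have gE s : (0 < s)%R -> ((ext_fun r s * ext_fun v s) `^ p' = r s `^ p' * v s `^ p')%R.
  move=> s0; rewrite !ext_fun_pos// powRM//; first exact: (O1_r_ge0 O1).
  by rewrite ltW// vpos.
rewrite gE//; congr (_ `^ _ * _ `^ _ * _).
- rewrite /kernel_tail ge0_integral_mrestr; last 2 first.
  + apply: measurable_fun_poweR; apply/measurable_EFinP.
    exact: (measurableT_comp (pk_meas hkap) (pair2_measurable z)).
  + by move=> x; exact: poweR_ge0.
  rewrite [LHS]integral_mkcond [RHS]integral_mkcond; apply: eq_integral => x _.
  rewrite !patchE !mem_setE/= !in_itv/= !andbT; case: (leP z x) => zx.
    by rewrite (lt_le_trans z0 zx) ext_kernel_in.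
  by case: ifP => // _; rewrite ext_kernel_out// powR0// gt_eqF.
- rewrite /head_pow [LHS]integral_mkcond [RHS]integral_mkcond; apply: eq_integral => s _.
  rewrite !patchE !mem_setE/= !in_itv/=; case: (ltP 0%R s) => s0 /=.
    by case: ifP => // _; rewrite -gE.
  by case: ifP => // _; rewrite ext_fun_neg// mul0r powR0// gt_eqF.
Qed.

End Weights.

(** * The two-sided estimate *)

Section TwoSided.
Context {R : realType} (p q h : R) (hq : 1 < q) (hqp : q < p).
Local Open Scope ereal_scope.
Local Notation RT := (measurableTypeR R).
Local Notation leb := (@lebesgue_measure R).
Local Notation p' := (conj_exp p).
Local Notation b := (p / (p - q))%R.
Local Notation a := (p * (q - 1) / (p - q))%R.
Local Notation e := ((p - q) / (p * q))%R.

Lemma betaMe : (b * e = q^-1)%R.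
Proof. by have [? ? ? ? ?] := exponent_neq0 hq hqp; field; do ?[apply/andP; split]. Qed.

Lemma betaVe : (b^-1 * q^-1 = e)%R.
Proof. by have [? ? ? ? ?] := exponent_neq0 hq hqp; field; do ?[apply/andP; split]. Qed.

Lemma e_gt0 : (0 < e)%R.
Proof. by have [? ? ? ? ?] := exponent_gt0 hq hqp; rewrite divr_gt0// mulr_gt0. Qed.

(** From the functionals to the quantities B, which are their e-th powers. *)
Lemma poweR_beta_le (I : \bar R) (c N : R) : 0 <= I -> (0 <= c)%R -> (0 <= N)%R ->
  I <= (c%:E * (N `^ q)%:E) `^ b -> I `^ e <= (c `^ q^-1)%:E * N%:E.
Proof.
have [q0 p0 p10 pq0 q10] := exponent_gt0 hq hqp.
move=> I0 c0 N0 IcN; apply: le_trans (le_poweR I0 IcN (ltW e_gt0)) _.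
rewrite -poweRrM betaMe poweRM; [|by rewrite lee_fin|by rewrite lee_fin powR_ge0].
by rewrite -!poweR_EFin (@poweRrK _ N%:E)// mulfV// gt_eqF.
Qed.

Lemma upper_constant_fin_num : upper_constant p q h \is a fin_num.
Proof. by []. Qed.

Definition tail_constant : R := (2 * 2 `^ (b - 1)) `^ q^-1.
Definition split_constant : R := (2 `^ ((a / p + 1) * (q - 1)) * h `^ q) `^ q^-1.
Definition norm_constant : R := fine (upper_constant p q h) `^ q^-1.

Variables (K : R -> R -> R) (r : R -> R) (K0 : R -> R -> R) (v : R -> R).
Hypothesis vpos : forall s, (0 < s)%R -> (0 < v s)%R.
Hypothesis mv : measurable_fun (Ipos R : set RT) v.
Hypothesis O1 : O1plus h K r K0.
Variables mu eta : {measure set RT -> \bar R}.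
Hypothesis Seta : is_stieltjes (phi p K v) eta.
Hypothesis atoms : forall x : R, (0 < x)%R -> 0 < mu [set x] ->
  right_lim (phi p K v) x = phi p K v x.
Local Notation mu' := (mrestr mu (@measurable_Ipos R)).
Local Notation eta' := (mrestr eta (@measurable_Ipos R)).
Local Notation k := (fun x s => (ext_kernel K x s * ext_fun v s)%R).
Local Notation kap := (ext_kernel K0).
Local Notation g := (fun s => (ext_fun r s * ext_fun v s)%R).
Local Notation W := (fun x => eta' `]-oo, x]%classic).

Let hk : positive_kernel k. Proof. exact: (oinarov_kernel vpos mv O1). Qed.

Lemma B11_le_norm (N : R) : Kplus_norm p q mu K v = N%:E ->
  B11 p q mu eta K v <= tail_constant%:E * N%:E.
Proof.
move=> NE; have N0 : (0 <= N)%R by rewrite -lee_fin -NE Kplus_norm_ge0.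
have b0 := beta_gt0 hq hqp.
rewrite (B11E hq hqp vpos O1 mu Seta); apply: poweR_beta_le => //.
  by apply: integral_ge0 => x _; rewrite mule_ge0 ?poweR_ge0.
apply: le_trans (lower_tail_bound hq hqp hk (powR_ge0 _ _)
  (operator_bound_of_norm hq hqp vpos mv O1 NE) (fun _ => erefl)
  (kernel_pow_le_head hq hqp vpos mv O1 Seta)
  (head_le_kernel_pow hq hqp vpos mv O1 Seta)
  (atom_continuous hq hqp vpos O1 Seta atoms)) _.
have y0 : 0 <= (2 `^ (b - 1))%:E * (N `^ q)%:E by rewrite -EFinM lee_fin mulr_ge0 ?powR_ge0.
by rewrite [in leRHS]EFinM -[in leRHS]muleA [leRHS]poweRM.
Qed.

Lemma B10_le_norm (N : R) : Kplus_norm p q mu K v = N%:E ->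
  B10 p q mu r K0 v <= split_constant%:E * N%:E.
Proof.
move=> NE; have N0 : (0 <= N)%R by rewrite -lee_fin -NE Kplus_norm_ge0.
have hkap := outer_kernel O1.
rewrite (B10E hq hqp vpos O1 mu); apply: poweR_beta_le => //.
- by apply: integral_ge0 => x _; rewrite !mule_ge0 ?poweR_ge0.
- by rewrite mulr_ge0 ?powR_ge0.
have opN := operator_bound_outer hq hqp vpos mv O1 (powR_ge0 _ _)
  (operator_bound_of_norm hq hqp vpos mv O1 NE).
have Nh0 : (0 <= h `^ q * N `^ q)%R by rewrite mulr_ge0 ?powR_ge0.
have H := @lower_split_bound R p q hq hqp kap g (pk_meas hkap) (pk_ge0 hkap)
  (outer_kernel_anti O1) (measurable_factor mv O1) (factor_ge0 vpos O1)
  (@factor_neg _ r v) mu' _ Nh0 (outer_factor_kernel vpos mv O1) opN.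
by apply: le_trans H _; rewrite !EFinM muleA.
Qed.

(** The bound T replaces the maximum of the two quantities because the latter may
    be zero, whereas the level argument needs a positive bound. *)
Lemma norm_le_B (T : R) : (0 < T)%R -> B1plus p q mu eta K r K0 v <= T%:E ->
  Kplus_norm p q mu K v <= (norm_constant * T)%:E.
Proof.
have [q0 p0 p10 pq0 q10] := exponent_gt0 hq hqp; have e0 := e_gt0.
move=> T0; rewrite ge_max => /andP[B0T B1T].
have hkap := outer_kernel O1.
pose sig : R := (T `^ e^-1)%R.
have sig0 : (0 < sig)%R by rewrite powR_gt0.
have sigE : (sig%:E : \bar R) `^ e = T%:E by rewrite -poweR_EFin poweRrK ?mulVf ?gt_eqF// lee_fin ltW.
have le_sig (I : \bar R) : 0 <= I -> I `^ e <= T%:E -> I <= sig%:E.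
  by move=> I0; rewrite -sigE; apply: lee_poweRV; rewrite // lee_fin ltW.
apply: ge_ereal_sup => _ [f [fLp f1] <-].
have mf := in_Lp_meas fLp; have mfI := fLp.1.
apply: le_trans (norm_Kplus_le_abs hq hqp vpos mv O1 mu mf) _.
pose af s : R := `|f s|%R.
have mafI : measurable_fun (Ipos R : set RT) af by exact: measurableT_comp.
have maf : measurable_fun [set: R] (ext_fun af) by exact: measurable_ext_fun.
have af0 s : (0 <= ext_fun af s)%R by apply: ext_fun_ge0 => y _; exact: normr_ge0.
have af1 : \int[leb]_s ((ext_fun af s)%:E `^ p) <= 1.
  move: f1; rewrite -(norm_Lp_abs hq hqp) norm_on_I_leb// => af1.
  have S0 : 0 <= \int[leb]_s (`|(ext_fun af s)%:E| `^ p).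
    by apply: integral_ge0 => s _; exact: poweR_ge0.
  have -> : \int[leb]_s ((ext_fun af s)%:E `^ p) = \int[leb]_s (`|(ext_fun af s)%:E| `^ p).
    by apply: eq_integral => s _; rewrite gee0_abs ?lee_fin.
  apply: (@lee_poweRV _ _ _ p^-1) => //; first by rewrite invr_gt0.
  by rewrite poweR_EFin powR1.
have k_out x s : (x < s)%R -> (ext_kernel K x s * ext_fun v s = 0)%R.
  by move=> xs; rewrite ext_kernel_out// mul0r.
have S1 : \int[eta']_x (tail_mass mu' x `^ b * W x `^ a) <= sig%:E.
  apply: le_sig; last by rewrite -(B11E hq hqp vpos O1 mu Seta).
  by apply: integral_ge0 => x _; rewrite mule_ge0 ?poweR_ge0.
have S2 : \int[leb]_z (kernel_tail q kap mu' z `^ b * head_pow p g z `^ a * (g z)%:E `^ p') <=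
    sig%:E.
  apply: le_sig; last by rewrite -(B10E hq hqp vpos O1 mu).
  by apply: integral_ge0 => x _; rewrite !mule_ge0 ?poweR_ge0.
have H := @upper_bound R p q hq hqp h k kap g (ext_fun af) mu' eta' W sig (O1_h_ge1 O1) hk
  k_out (pk_meas hkap) (pk_ge0 hkap) (pk_homo hkap)
  (outer_kernel_anti O1) (measurable_factor mv O1) (factor_ge0 vpos O1)
  (@factor_neg _ r v) (oinarov_split vpos O1) (fun _ => erefl)
  (kernel_pow_le_head hq hqp vpos mv O1 Seta) sig0 S1 S2 maf af0 af1.
rewrite (norm_Kplus hq hqp vpos mv O1)//.
have op0 : 0 <= \int[mu']_x (kernel_op k (EFin \o ext_fun af) x `^ q).
  by apply: integral_ge0 => x _; exact: poweR_ge0.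
have -> : \int[mu']_x (`|kernel_op k (EFin \o ext_fun af) x| `^ q) =
    \int[mu']_x (kernel_op k (EFin \o ext_fun af) x `^ q).
  by apply: eq_integral => x _; rewrite gee0_abs ?kernel_op_ge0.
apply: (le_trans (le_poweR op0 H _)); first by rewrite invr_ge0 ltW.
have u0 : 0 <= upper_constant p q h.
  by rewrite !mule_ge0 ?adde_ge0 ?mule_ge0 ?poweR_ge0 ?lee_fin ?mulr_ge0 ?powR_ge0.
rewrite poweRM ?poweR_ge0// -poweRrM betaVe sigE.
by rewrite EFinM /norm_constant -poweR_EFin fineK// upper_constant_fin_num.
Qed.

End TwoSided.

Theorem theorem2p1 (R : realType) (p q h : R) (hq : 1 < q) (hqp : q < p)
    (hh : 1 <= h) :
  exists2 C : R, 0 < C &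
  forall (mu eta : {measure set (measurableTypeR R) -> \bar R})
         (v : R -> R) (K : R -> R -> R) (r : R -> R) (K0 : R -> R -> R),
    (forall s, 0 < s -> 0 < v s) ->
    locally_integrable (Ipos R) v ->
    locally_integrable (Ipos R) (fun s => v s `^ conj_exp p) ->
    O1plus h K r K0 ->
    is_stieltjes (phi p K v) eta ->
    (* phi may differ from phi(. + 0) only on a mu-null set *)
    (forall x : R, 0 < x -> (0 < mu [set x])%E ->
       right_lim (phi p K v) x = phi p K v x) ->
    (Kplus_bounded p q mu K v <-> (B1plus p q mu eta K r K0 v < +oo)%E) /\
    ((C^-1)%:E * B1plus p q mu eta K r K0 v <= Kplus_norm p q mu K v)%E /\
    (Kplus_norm p q mu K v <= C%:E * B1plus p q mu eta K r K0 v)%E.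
Proof.
pose c1 := tail_constant p q; pose c2 := split_constant p q h; pose c3 := norm_constant p q h.
have c10 : 0 <= c1 by exact: powR_ge0.
have c20 : 0 <= c2 by exact: powR_ge0.
have c30 : 0 <= c3 by exact: powR_ge0.
have sum_gt0 (x y z : R) : 0 <= x -> 0 <= y -> 0 <= z -> 0 < 1 + x + y + z by lra.
have C0 := sum_gt0 _ _ _ c10 c20 c30.
exists (1 + c1 + c2 + c3) => // mu eta v K r K0 vpos [mv _ _] _ O1 Seta atoms.
set C := 1 + c1 + c2 + c3 in C0 *; set B := B1plus p q mu eta K r K0 v.
set N := Kplus_norm p q mu K v.
have B0 : (0 <= B)%E by rewrite le_max poweR_ge0.
have N0 : (0 <= N)%E by exact: Kplus_norm_ge0.
have lower : (B <= C%:E * N)%E.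
  have [Noo|Nfin] := eqVneq N +oo%E; first by rewrite Noo gt0_muley ?leey ?lte_fin.
  have NE : N = (fine N)%:E by rewrite fineK// ge0_fin_numE// ltey.
  have f0 : 0 <= fine N by exact: fine_ge0.
  rewrite ge_max NE; apply/andP; split.
    apply: le_trans (B10_le_norm hq hqp vpos mv O1 NE) _.
    by rewrite -!EFinM lee_fin ler_wpM2r// /C -/c2; lra.
  apply: le_trans (B11_le_norm hq hqp vpos mv O1 Seta atoms NE) _.
  by rewrite -!EFinM lee_fin ler_wpM2r// /C -/c1; lra.
have upper : (N <= C%:E * B)%E.
  have [Boo|Bfin] := eqVneq B +oo%E; first by rewrite Boo gt0_muley ?leey ?lte_fin.
  apply: lee_mul_of_fin => //; [exact: ltW|by rewrite ltey|].
  move=> t t0 Bt; apply: le_trans (norm_le_B hq hqp vpos mv O1 Seta t0 Bt) _.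
  by rewrite lee_fin ler_wpM2r ?ltW// /C -/c3; lra.
split; last by split => //; rewrite muleC lee_pdivrMr// muleC.
split => [[c bc]|Boo].
- have Nc : (N <= `|c|%:E)%E.
    apply: ge_ereal_sup => _ [f [fLp f1] <-]; apply: le_trans (bc f fLp) _.
    have n0 : (0 <= norm_on_I lebesgue_measure p (EFin \o f))%E.
      by apply: norm_on_I_ge0; exact: lt_trans (lt_trans ltr01 hq) hqp.
    apply: (@le_trans _ _ (`|c|%:E * norm_on_I lebesgue_measure p (EFin \o f))%E).
      by apply: lee_wpmul2r => //; rewrite lee_fin ler_norm.
    by rewrite -[leRHS]mule1; apply: lee_wpmul2l => //; rewrite lee_fin.
  apply: le_lt_trans lower _; apply: lte_mul_pinfty; rewrite ?lee_fin ?ltW//.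
  exact: le_lt_trans Nc (ltry _).
have Noo : (N < +oo)%E.
  by apply: le_lt_trans upper _; apply: lte_mul_pinfty; rewrite ?lee_fin ?ltW.
exists (fine N) => f fLp; apply: (Kplus_le_norm hq hqp vpos mv O1) => //.
by rewrite fineK// ge0_fin_numE.
Qed.
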